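(* Let $\{\mathfrak{a}_1,\dots,\mathfrak{a}_d\}$ be a basis of $\mathbb{R}^d$ and $\Gamma=(V,E)$ a locally finite infinite graph with vertex set $V\subset\mathbb{R}^d$, invariant under the translations by each $\mathfrak{a}_i$. Let $\mathbb{Z}^d_{\mathfrak{a}}=\{\sum n_i\mathfrak{a}_i:n\in\mathbb{Z}^d\}$, $\mathcal{C}_{\mathfrak{a}}=\{\sum x_i\mathfrak{a}_i:x_i\in[0,1)\}$, $V_f=V\cap\mathcal{C}_{\mathfrak{a}}=\{v_1,\dots,v_\nu\}$, so that every $v\in V$ is uniquely $v=\lfloor v\rfloor_{\mathfrak{a}}+\{v\}_{\mathfrak{a}}$ with $\lfloor v\rfloor_{\mathfrak{a}}\in\mathbb{Z}^d_{\mathfrak{a}}$, $\{v\}_{\mathfrak{a}}\in V_f$. Let $\mathfrak{b}_j$ be the dual basis ($\mathfrak{a}_i\cdot\mathfrak{b}_j=2\pi\delta_{ij}$), $\mathbb{T}^d_\ast=[0,1)^d$, $\theta_{\mathfrak{b}}=\sum_i\theta_i\mathfrak{b}_i$. Let $H=\mathcal{A}+Q$ on $\ell^2(\Gamma)$ with $\mathcal{A}$ the adjacency matrix and $Q$ real with $Q(v+\mathfrak{a}_i)=Q(v)$. Define $(U\psi)_{\theta_{\mathfrak{b}}}(v_n)=\sum_{k_{\mathfrak{a}}\in\mathbb{Z}^d_{\mathfrak{a}}}e^{-\mathrm{i}\theta_{\mathfrak{b}}\cdot(v_n+k_{\mathfrak{a}})}\psi(v_n+k_{\mathfrak{a}})$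 and the $\nu\times\nu$ matrices $[H(\theta_{\mathfrak{b}})f](v_n)=\sum_{u\sim v_n}e^{\mathrm{i}\theta_{\mathfrak{b}}\cdot(u-v_n)}f(\{u\}_{\mathfrak{a}})+Q(v_n)f(v_n)$, with eigen-decomposition $H(\theta_{\mathfrak{b}})=\sum_{n=1}^\nu E_n(\theta_{\mathfrak{b}})P_n(\theta_{\mathfrak{b}})$ (eigenvalues increasing, counted with multiplicity). Let $\psi\in\ell^2(\Gamma)$ with $\|\psi\|=1$. Let $\Omega=\mathbb{T}^d_\ast\times\{1,\dots,\nu\}$, let $\mu^\psi$ be the probability measure on $\Omega$ with $\int_\Omega f\,\mathrm{d}\mu^\psi=\int_{\mathbb{T}^d_\ast}\sum_{n=1}^\nu f(\theta,n)\|P_n(\theta_{\mathfrak{b}})(U\psi)_{\theta_{\mathfrak{b}}}\|^2\,\mathrm{d}\theta$, let $h\colon\Omega\to\mathbb{R}^d$, $h(\theta,n)=\frac{1}{2\pi}\sum_{i=1}^d\mathfrak{a}_i\partial_{\theta_i}E_n(\theta_{\mathfrak{b}})$, and let $\nu_\infty^\psi=h_\star\mu^\psi$ be the image measure. Let $X_t$ be a random vector in $\mathbb{R}^d$ with distribution $\mathbb{P}(X_t=v)=|e^{-\mathrm{i}tH}\psi(v)|^2$, $v\in V$. Then $X_t/t$ converges in distribution, as $t\to+\infty$, to a random vector $Y$ with distribution $\nu_\infty^\psi$.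
   Context: The functions $E_n$ are differentiable for a.e. $\theta$, so $h$ is defined $\mu^\psi$-a.e. *)

(* Defs.v *)
From HB Require Import structures.
From mathcomp Require Export all_boot all_order all_algebra.
From mathcomp Require Export all_classical all_reals all_analysis.
From mathcomp Require Export complex.
Export Order.TTheory GRing.Theory Num.Theory.
Export numFieldNormedType.Exports.

Set Implicit Arguments.
Unset Strict Implicit.
Unset Printing Implicit Defensive.

Local Open Scope ring_scope.
Local Open Scope classical_set_scope.

Definition dotp (R : realType) (d : nat) (x y : 'rV[R]_d) : R :=
  \sum_(i < d) x 0 i * y 0 i.

Definition expi (R : realType) (phi : R) : R[i] := (cos phi +i* sin phi)%C.

Definition cabs2 (R : realType) (z : R[i]) : R :=
  complex.Re z ^+ 2 + complex.Im z ^+ 2.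

Definition vnorm2 (R : realType) (nu : nat) (x : 'cV[R[i]]_nu) : R :=
  \sum_(m < nu) cabs2 (x m 0).

Definition basis_mx (R : realType) (d : nat) (a : 'I_d -> 'rV[R]_d) : 'M[R]_d :=
  \matrix_(i, j) a i 0 j.

Definition coords (R : realType) (d : nat) (a : 'I_d -> 'rV[R]_d) (v : 'rV[R]_d)
  : 'rV[R]_d := v *m invmx (basis_mx a).

Definition lattice_pt (R : realType) (d : nat) (a : 'I_d -> 'rV[R]_d)
  (k : 'I_d -> int) : 'rV[R]_d := \sum_(i < d) (k i)%:~R *: a i.

Definition cellA (R : realType) (d : nat) (a : 'I_d -> 'rV[R]_d) : set 'rV[R]_d :=
  [set v | forall i : 'I_d, 0 <= coords a v 0 i < 1].

Definition fracpt (R : realType) (d : nat) (a : 'I_d -> 'rV[R]_d) (v : 'rV[R]_d)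
  : 'rV[R]_d :=
  \sum_(i < d) (coords a v 0 i - (Num.floor (coords a v 0 i))%:~R) *: a i.

Definition thb (R : realType) (d : nat) (b : 'I_d -> 'rV[R]_d) (th : 'I_d -> R)
  : 'rV[R]_d := \sum_(i < d) th i *: b i.

(* H = A + Q acting on functions V -> C (only values on V matter):
   (H f)(v) = sum_{u ~ v} f(u) + Q(v) f(v) *)
Definition Hop (R : realType) (d : nat) (adj : 'rV[R]_d -> 'rV[R]_d -> Prop)
  (Q : 'rV[R]_d -> R) (f : 'rV[R]_d -> R[i]) (v : 'rV[R]_d) : R[i] :=
  (\sum_(u \in [set u | adj v u]) f u) + (Q v)%:C%C * f v.

Definition evol_partial (R : realType) (d : nat)
  (adj : 'rV[R]_d -> 'rV[R]_d -> Prop) (Q : 'rV[R]_d -> R) (t : R)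
  (psi : 'rV[R]_d -> R[i]) (v : 'rV[R]_d) (N : nat) : R[i] :=
  \sum_(k < N) ((- 'i * t%:C%C) ^+ k / (k`!)%:R) * iter k (Hop adj Q) psi v.

(* (e^{-itH} psi)(v) : limit of the exponential series (H is bounded) *)
Definition evol (R : realType) (d : nat)
  (adj : 'rV[R]_d -> 'rV[R]_d -> Prop) (Q : 'rV[R]_d -> R) (t : R)
  (psi : 'rV[R]_d -> R[i]) (v : 'rV[R]_d) : R[i] :=
  (limn (fun N => complex.Re (evol_partial adj Q t psi v N)) +i*
   limn (fun N => complex.Im (evol_partial adj Q t psi v N)))%C.

Definition bloch_mx (R : realType) (d : nat) (a : 'I_d -> 'rV[R]_d)
  (adj : 'rV[R]_d -> 'rV[R]_d -> Prop) (Q : 'rV[R]_d -> R)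
  (nu : nat) (vf : 'I_nu -> 'rV[R]_d) (x : 'rV[R]_d) : 'M[R[i]]_nu :=
  \matrix_(n, m)
    ((\sum_(u \in [set u | adj (vf n) u])
        (if fracpt a u == vf m then expi (dotp x (u - vf n)) else 0))
     + (n == m)%:R * (Q (vf n))%:C%C).

Definition boxpt (d N : nat) (k : {ffun 'I_d -> 'I_(2 * N).+1}) : 'I_d -> int :=
  fun i => (k i)%:Z - N%:Z.

Definition Upartial (R : realType) (d : nat) (a b : 'I_d -> 'rV[R]_d)
  (nu : nat) (vf : 'I_nu -> 'rV[R]_d) (psi : 'rV[R]_d -> R[i]) (N : nat)
  (th : 'I_d -> R) (n : 'I_nu) : R[i] :=
  \sum_(k : {ffun 'I_d -> 'I_(2 * N).+1})
     expi (- dotp (thb b th) (vf n + lattice_pt a (boxpt k)))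
     * psi (vf n + lattice_pt a (boxpt k)).

Definition torus (R : realType) (d : nat) : set (d.-tuple R) :=
  [set th | forall i : 'I_d, 0 <= tnth th i < 1].

(* lam is Lebesgue measure on R^d (characterised by its value on boxes) *)
Definition is_lebesgue_measure (R : realType) (d : nat)
  (lam : {measure set (d.-tuple R) -> \bar R}) : Prop :=
  forall lo hi : d.-tuple R, (forall i, tnth lo i <= tnth hi i) ->
    lam [set th | forall i, tnth lo i <= tnth th i < tnth hi i]
    = (\prod_(i < d) (tnth hi i - tnth lo i))%:E.

Definition pderiv_b (R : realType) (d : nat) (b : 'I_d -> 'rV[R]_d)
  (E : 'rV[R]_d -> R) (th : 'I_d -> R) (i : 'I_d) : R :=
  derive1 (fun s : R => E (thb b (fun j => th j + (if j == i then s else 0)))) 0.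

Definition hmap (R : realType) (d : nat) (a b : 'I_d -> 'rV[R]_d)
  (E : 'rV[R]_d -> R) (th : 'I_d -> R) : 'rV[R]_d :=
  (2 * pi)^-1 *: \sum_(i < d) pderiv_b b E th i *: a i.

Definition rpos (R : realType) (x : R) : R := Num.max x 0.
Definition rneg (R : realType) (x : R) : R := Num.max (- x) 0.

Definition ssum (R : realType) (T : choiceType) (S : set T) (f : T -> R) : R :=
  fine ((\esum_(v in S) (rpos (f v))%:E) - (\esum_(v in S) (rneg (f v))%:E))%E.

(* Main.v *)
Require Import Defs.
From mathcomp Require Import measurable_realfun ring lra zify.
Set Implicit Arguments.
Unset Strict Implicit.
Unset Printing Implicit Defensive.
Local Open Scope ring_scope.
Local Open Scope classical_set_scope.

(* After the Bloch transform, a finitely supported state evolves by multiplication with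
   exp(-i t H(theta)).  By Parseval the characteristic function of X_t/t at eta is the torus
   integral of < e^(-itH(theta)) U, e^(-itH(theta')) U' > with theta' = theta - eta/(2 pi t).
   Ky Fan's principle writes the sum of the k lowest band functions as an infimum of
   trigonometric polynomials, so it is Lipschitz and semiconcave and therefore differentiable at
   almost every theta.  At such theta, bands that touch have equal gradients and spectral
   projections of distinct eigenvalues become orthogonal in the limit, so the integrand tends to
   the sum over n of exp(i eta . grad E_n / 2 pi) |P_n U|^2, and dominated convergence applies.
   Exponential weights confine X_t/t to a fixed box up to a small probability.  There a continuous
   test function is uniformly close to a trigonometric polynomial (Bernstein polynomials in
   sines), and unitarity extends the result from box truncations of psi to psi itself. *)

(** * Integration over the torus *)

Section RiemannSums.
Variables (R : realType) (d : nat).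
Implicit Types (x y : 'I_d -> R) (F : ('I_d -> R) -> R) (M : nat).

(** The measure [lam] is known only through its values on boxes, so every integral that has to be
    evaluated is a limit of grid averages of Lipschitz functions: orthogonality of characters
    becomes a sum of roots of unity, smallness of second differences a telescoping sum. The families
    [E] and [P] are given pointwise in theta without any regularity, and at a crossing the
    individual [P] may jump. Regularity of [E] is therefore extracted from traces against frozen
    projections, and the evolved correlations, which involve [P], are shown measurable as limits of
    partial exponential series, whose Bloch transforms are trigonometric polynomials. At a crossing
    only the total projection of a cluster matters, because the limiting phases agree inside it.
    Trigonometric polynomials approximate a test function only on a box, so the spreading needs a
    linear bound whose constant is independent of the state. The limiting integrand takes default
    values where some band is not differentiable; the limit is computed off a null set and
    identified with the stated integral afterwards. *)

Definition dist1 x y : R := \sum_i `|x i - y i|.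

Definition lipschitz_fun F :=
  exists2 C : R, 0 <= C & forall x y, `|F x - F y| <= C * dist1 x y.

Definition grid M (j : {ffun 'I_d -> 'I_M.+1}) : 'I_d -> R :=
  fun i => (j i)%:R / M.+1%:R.

Definition round M x : 'I_d -> R :=
  fun i => (Num.truncn (M.+1%:R * x i))%:R / M.+1%:R.

Definition grid_avg F M : R :=
  M.+1%:R ^- d * \sum_(j : {ffun 'I_d -> 'I_M.+1}) F (grid j).

Definition grid_cell M (j : {ffun 'I_d -> 'I_M.+1}) : set (d.-tuple R) :=
  [set th | forall i, grid j i <= tnth th i < grid j i + M.+1%:R^-1].

Lemma dist1_ge0 x y : 0 <= dist1 x y.
Proof. by apply: sumr_ge0. Qed.

Lemma measurable_box (lo hi : 'I_d -> R) :
  measurable [set th : d.-tuple R | forall i, lo i <= tnth th i < hi i].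
Proof.
rewrite [X in measurable X](_ : _ =
  \bigcap_(i in [set: 'I_d]) ((fun th : d.-tuple R => tnth th i) @^-1` `[lo i, hi i[)).
  apply: fin_bigcap_measurable => // i _.
  rewrite -[X in measurable X]setTI.
  by apply: (@measurable_tnth _ R d i measurableT); exact: measurable_itv.
apply/seteqP; split=> th /= H i; first by move=> _ /=; rewrite in_itv /=.
by have := H i I; rewrite /= in_itv.
Qed.

Lemma measurable_torus : measurable (@torus R d).
Proof. exact: (measurable_box (fun=> 0) (fun=> 1)). Qed.

Lemma measurable_grid_cell M (j : {ffun 'I_d -> 'I_M.+1}) : measurable (grid_cell j).
Proof. exact: measurable_box. Qed.

Lemma round_near M x : (forall i, 0 <= x i) -> dist1 (round M x) x <= d%:R / M.+1%:R.
Proof.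
move=> x0; rewrite /dist1.
apply: (le_trans (ler_sum _ (G := fun=> M.+1%:R^-1) _)).
  move=> i _; rewrite /round.
  have M0 : 0 < M.+1%:R :> R by rewrite ltr0n.
  have h0 : 0 <= M.+1%:R * x i by rewrite mulr_ge0 ?ler0n.
  have /andP[h1 h2] := truncn_itv h0.
  rewrite distrC ger0_norm; last by rewrite subr_ge0 ler_pdivrMr // [leRHS]mulrC.
  rewrite -(ler_pM2l M0) mulrBr mulrCA divff ?gt_eqF // mulr1.
  rewrite lerBlDr addrC; apply: ltW; apply: lt_le_trans h2 _.
  by rewrite -addn1 natrD.
by rewrite sumr_const card_ord mulrC mulr_natr.
Qed.

Lemma round_cell M (th : d.-tuple R) : torus th ->
  exists2 j : {ffun 'I_d -> 'I_M.+1}, grid_cell j th & round M (tnth th) = grid j.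
Proof.
move=> Tth.
have M0 : 0 < M.+1%:R :> R by rewrite ltr0n.
have lt i : (Num.truncn (M.+1%:R * tnth th i) < M.+1)%N.
  have /andP[h0 h1] := Tth i.
  rewrite truncn_lt_nat; last by rewrite mulr_ge0.
  by rewrite gtr_pMr.
exists [ffun i => Ordinal (lt i)]; last by apply/funext=> i; rewrite /round /grid ffunE.
move=> i; rewrite /grid ffunE /=; have /andP[h0 h1] := Tth i.
have /truncn_itv/andP[h2 h3] : 0 <= M.+1%:R * tnth th i by rewrite mulr_ge0.
rewrite ler_pdivrMr // [leRHS]mulrC h2 /= -[X in _ + X]mul1r -mulrDl ltr_pdivlMr // [ltLHS]mulrC.
by rewrite natr1.
Qed.

Lemma grid_cell_inj M (j j' : {ffun 'I_d -> 'I_M.+1}) th :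
  grid_cell j th -> grid_cell j' th -> j = j'.
Proof.
have M0 : 0 < M.+1%:R :> R by rewrite ltr0n.
move=> H H'; apply/ffunP => i; apply/val_inj/eqP; rewrite eqn_leq.
have aux (k k' : 'I_M.+1) : k%:R / M.+1%:R <= tnth th i ->
    tnth th i < k'%:R / M.+1%:R + M.+1%:R^-1 -> (k <= k')%N.
  move=> h1 h2; have := le_lt_trans h1 h2.
  rewrite -[X in _ + X]mul1r -mulrDl ltr_pM2r ?invr_gt0 // natr1 ltr_nat.
  by rewrite ltnS.
have /andP[a1 a2] := H i; have /andP[b1 b2] := H' i.
by rewrite (aux _ _ a1 b2) (aux _ _ b1 a2).
Qed.

Lemma fun_roundE F M (th : d.-tuple R) : torus th ->
  F (round M (tnth th)) = \sum_j F (@grid M j) * \1_(grid_cell j) th.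
Proof.
move=> /(round_cell M)[j jth ->]; rewrite (bigD1 j) //= indicE mem_set // mulr1.
rewrite big1 ?addr0 // => k kj; rewrite indicE memNset ?mulr0 //.
by move=> /(grid_cell_inj jth) jk; rewrite jk eqxx in kj.
Qed.

Lemma measurable_fun_round F M :
  measurable_fun (@torus R d) (fun th => F (round M (tnth th))).
Proof.
apply: (eq_measurable_fun (fun th => \sum_j F (@grid M j) * \1_(grid_cell j) th)).
  by move=> th /set_mem Tth; rewrite fun_roundE.
apply: measurable_sum => j; apply: measurable_funM; first exact: measurable_cst.
by apply: measurable_indic; exact: measurable_grid_cell.
Qed.

(** Rounded functions are finite combinations of indicators of grid cells, so their pointwise limits
    are measurable. Convergence along roundings is all the continuity asked of [F]. *)
Lemma measurable_fun_rounding F :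
  (forall x, (forall i, 0 <= x i) -> F (round M x) @[M --> \oo] --> F x) ->
  measurable_fun (@torus R d) (fun th => F (tnth th)).
Proof.
move=> cF; apply: (measurable_fun_cvg (measurable_fun_round F)) => th Tth.
by apply: cF => i; have /andP[] := Tth i.
Qed.

Lemma cvg_invS : (M.+1%:R^-1 : R) @[M --> \oo] --> 0.
Proof. exact: cvg_harmonic. Qed.

Lemma cvg_dist1_round x : (forall i, 0 <= x i) ->
  dist1 (round M x) x @[M --> \oo] --> 0.
Proof.
move=> x0; apply: (@squeeze_cvgr _ _ _ _ (fun=> 0) (fun M => d%:R / M.+1%:R)).
- by apply: nearW => M; rewrite dist1_ge0 round_near.
- exact: cvg_cst.
- by rewrite -[X in _ --> X](mulr0 d%:R); apply: cvgM; [exact: cvg_cst|exact: cvg_invS].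
Qed.

Lemma lipschitz_measurable F : lipschitz_fun F ->
  measurable_fun (@torus R d) (fun th => F (tnth th)).
Proof.
case=> C C0 CF; apply: measurable_fun_rounding => x x0.
apply/subr_cvg0/norm_cvg0P/(@squeeze_cvgr _ _ _ _ (fun=> 0) (fun M => C * dist1 (round M x) x)).
- by apply: nearW => M; rewrite normr_ge0 CF.
- exact: cvg_cst.
- by rewrite -[X in _ --> X](mulr0 C); apply: cvgM; [exact: cvg_cst|exact: cvg_dist1_round].
Qed.

End RiemannSums.
Arguments grid {R d M}.
Arguments grid_cell {R d M}.
Arguments round {R d}.

(** * Lebesgue integrals on the torus as limits of grid averages *)

Section TorusIntegral.
Variables (R : realType) (d : nat).
Variable lam : {measure set (d.-tuple R) -> \bar R}.
Hypothesis Hlam : is_lebesgue_measure lam.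
Implicit Types (F : ('I_d -> R) -> R) (M : nat).
Local Notation T := (@torus R d).

Lemma lam_torus : lam T = 1%E.
Proof.
rewrite (_ : T = [set th | forall i, tnth [tuple of nseq d (0 : R)] i <= tnth th i <
    tnth [tuple of nseq d (1 : R)] i]).
  rewrite Hlam => [|i]; last by rewrite !tnth_nseq ler01.
  by under eq_bigr do rewrite !tnth_nseq subr0; rewrite big1.
by apply/seteqP; split=> th /= H i; have := H i; rewrite !tnth_nseq.
Qed.

Lemma lam_grid_cell M (j : {ffun 'I_d -> 'I_M.+1}) :
  lam (grid_cell j) = (M.+1%:R ^- d)%:E.
Proof.
pose lo := [tuple grid j i | i < d] : d.-tuple R.
pose hi := [tuple grid j i + M.+1%:R^-1 | i < d] : d.-tuple R.
rewrite (_ : grid_cell j = [set th | forall i, tnth lo i <= tnth th i < tnth hi i]).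
  rewrite Hlam => [|i]; last by rewrite !tnth_mktuple lerDl invr_ge0 ler0n.
  under eq_bigr do rewrite !tnth_mktuple addrC addKr.
  by rewrite prodr_const card_ord exprVn.
by apply/seteqP; split=> th /= H i; have := H i; rewrite !tnth_mktuple.
Qed.

Lemma bounded_integrable (D : set (d.-tuple R)) (f : d.-tuple R -> R) (K : R) :
  measurable D -> D `<=` T -> measurable_fun D f ->
  (forall th, D th -> `|f th| <= K) -> lam.-integrable D (EFin \o f).
Proof.
move=> mD DT mf fK; apply: measurable_bounded_integrable => //.
  apply: (@le_lt_trans _ _ 1%E); last by rewrite ltry.
  by rewrite -lam_torus; apply: le_measure; rewrite ?inE //; exact: measurable_torus.
by exists K; split; [exact: num_real|move=> r Kr th Dth; apply: le_trans (fK _ Dth) (ltW Kr)].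
Qed.

Lemma integrableD_EFin (D : set (d.-tuple R)) (f g : d.-tuple R -> R) : measurable D ->
  lam.-integrable D (EFin \o f) -> lam.-integrable D (EFin \o g) ->
  lam.-integrable D (EFin \o (fun x => f x + g x)).
Proof. by move=> mD fi gi; exact: (integrableD mD fi gi). Qed.

Lemma integrableB_EFin (D : set (d.-tuple R)) (f g : d.-tuple R -> R) : measurable D ->
  lam.-integrable D (EFin \o f) -> lam.-integrable D (EFin \o g) ->
  lam.-integrable D (EFin \o (fun x => f x - g x)).
Proof. by move=> mD fi gi; exact: (integrableB mD fi gi). Qed.

Lemma integrableZl_EFin (D : set (d.-tuple R)) (c : R) (f : d.-tuple R -> R) : measurable D ->
  lam.-integrable D (EFin \o f) -> lam.-integrable D (EFin \o (fun x => c * f x)).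
Proof. by move=> mD fi; exact: (integrableZl mD c fi). Qed.

Lemma integrable_sum_EFin (D : set (d.-tuple R)) (I : Type) (s : seq I)
    (f : I -> d.-tuple R -> R) : measurable D ->
  (forall i, lam.-integrable D (EFin \o f i)) ->
  lam.-integrable D (EFin \o (fun x => \sum_(i <- s) f i x)).
Proof.
move=> mD intf; rewrite (_ : EFin \o _ = (fun x => \sum_(i <- s) (EFin \o f i) x)%E).
  by apply: integrable_sum => // k _; exact: intf.
by apply/funext => x; rewrite /= sumEFin.
Qed.

Lemma Rintegral_sum (D : set (d.-tuple R)) (I : Type) (s : seq I) (f : I -> d.-tuple R -> R) :
  measurable D -> (forall i, lam.-integrable D (EFin \o f i)) ->
  (\int[lam]_(x in D) (\sum_(i <- s) f i x) = \sum_(i <- s) \int[lam]_(x in D) f i x)%R.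
Proof.
move=> mD intf; elim: s => [|i s IH].
  by rewrite big_nil; under eq_Rintegral do rewrite big_nil; rewrite Rintegral_cst // mul0r.
rewrite big_cons -IH; under eq_Rintegral do rewrite big_cons.
by rewrite RintegralD //; exact: integrable_sum_EFin.
Qed.

Lemma Rintegral_round F M :
  (\int[lam]_(x in T) F (round M (tnth x)) = grid_avg F M)%R.
Proof.
rewrite (@eq_Rintegral _ _ _ lam T (fun th => \sum_j F (@grid R d M j) * \1_(grid_cell j) th)%R).
  2: by move=> th /set_mem Tth; rewrite fun_roundE.
have mj (j : {ffun 'I_d -> 'I_M.+1}) : measurable (@grid_cell R _ _ j).
  exact: measurable_grid_cell.
have ij (j : {ffun 'I_d -> 'I_M.+1}) : lam.-integrable T (EFin \o (\1_(grid_cell j) : d.-tuple R -> R)).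
  apply: (@bounded_integrable _ _ 1) => //; first exact: measurable_torus.
    by move=> th _; rewrite indicE; case: (_ \in _); rewrite ?normr1 ?normr0.
rewrite Rintegral_sum; [|exact: measurable_torus|]; last first.
  by move=> j; apply: integrableZl_EFin => //; exact: measurable_torus.
rewrite /grid_avg mulr_sumr; apply: eq_bigr => j _.
rewrite RintegralZl //; last exact: measurable_torus.
rewrite mulrC; congr (_ * _).
rewrite /Rintegral integral_indic //; last exact: measurable_torus.
rewrite setIidl ?lam_grid_cell // => th jth i.
have M0 : 0 < M.+1%:R :> R by rewrite ltr0n.
have /andP[a1 a2] := jth i; apply/andP; split.
  by apply: le_trans a1; rewrite /grid divr_ge0.
apply: (lt_le_trans a2); rewrite /grid -[X in _ + X]mul1r -mulrDl ler_pdivrMr // mul1r.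
by rewrite natr1 ler_nat.
Qed.

Lemma lipschitz_integrable F (D : set (d.-tuple R)) : measurable D -> D `<=` T ->
  lipschitz_fun F ->
  lam.-integrable D (EFin \o (fun th => F (tnth th))).
Proof.
move=> mD DT LF; have [C C0 CF] := LF.
apply: (@bounded_integrable _ _ (`|F (fun=> 0)| + C * d%:R)) => //.
  by apply: measurable_funS (lipschitz_measurable LF); [exact: measurable_torus|].
move=> th /DT Tth; rewrite -[F (tnth th)](subrK (F (fun=> 0))) addrC.
apply: le_trans (ler_normD _ _) _; rewrite lerD2l.
apply: le_trans (CF _ _) _; apply: ler_wpM2l => //.
rewrite -[d in X in _ <= X]card_ord -sumr_const; apply: ler_sum => i _.
by have /andP[h0 h1] := Tth i; rewrite subr0 ger0_norm // ltW.
Qed.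

(** Rounding moves a point by at most [d / M.+1] in [dist1]. The explicit rate is reused where the
    grid has to be matched to the step of a second difference. *)
Lemma grid_avg_dist F M (C : R) : 0 <= C ->
  (forall x y, `|F x - F y| <= C * dist1 x y) ->
  `|\int[lam]_(x in T) F (tnth x) - grid_avg F M|%R <= C * (d%:R / M.+1%:R).
Proof.
move=> C0 CF; have mT := @measurable_torus R d.
have iF : lam.-integrable T (EFin \o (fun th => F (tnth th))).
  by apply: lipschitz_integrable => //; exists C.
have bF th : T th -> `|F (tnth th) - F (round M (tnth th))| <= C * (d%:R / M.+1%:R).
  move=> Tth; rewrite distrC; apply: le_trans (CF _ _) _; apply: ler_wpM2l => //.
  by apply: round_near => i; have /andP[] := Tth i.
have iB : lam.-integrable T (EFin \o (fun th => F (tnth th) - F (round M (tnth th)))).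
  apply: (@bounded_integrable _ _ (C * (d%:R / M.+1%:R))) => //.
  apply: measurable_funB; first by apply: lipschitz_measurable; exists C.
  exact: measurable_fun_round.
have iR : lam.-integrable T (EFin \o (fun th => F (round M (tnth th)))).
  have := integrableB_EFin mT iF iB.
  by congr (_.-integrable _ (EFin \o _)); apply/funext => th; rewrite opprB addrCA subrr addr0.
rewrite -Rintegral_round -RintegralB //.
apply: le_trans (le_normr_Rintegral mT iB) _.
apply: (@le_trans _ _ (\int[lam]_(x in T) (C * (d%:R / M.+1%:R)))%R).
  apply: le_Rintegral => //.
    by rewrite (_ : EFin \o _ = (abse \o (EFin \o (fun th => F (tnth th) - F (round M (tnth th)))))) //;
       exact: integrable_abse.
  by apply: (@bounded_integrable _ _ `|C * (d%:R / M.+1%:R)|).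
by rewrite Rintegral_cst // lam_torus /= mulr1.
Qed.

Lemma cvg_grid_avg F : lipschitz_fun F ->
  grid_avg F M @[M --> \oo] --> (\int[lam]_(x in T) F (tnth x))%R.
Proof.
case=> C C0 CF; apply/subr_cvg0/norm_cvg0P.
apply: (@squeeze_cvgr _ _ _ _ (fun=> 0) (fun M => C * (d%:R / M.+1%:R))).
- by apply: nearW => M; rewrite normr_ge0 distrC grid_avg_dist.
- exact: cvg_cst.
- rewrite -[X in _ --> X](mulr0 C) -[X in _ * X](mulr0 d%:R).
  by apply: cvgM; [exact: cvg_cst|]; apply: cvgM; [exact: cvg_cst|exact: cvg_invS].
Qed.

End TorusIntegral.

(** * Complex numbers and characters *)

Section ComplexNumbers.
Variable R : realType.
Implicit Types (z w : R[i]) (x y : R).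

Lemma ReD z w : complex.Re (z + w) = complex.Re z + complex.Re w.
Proof. by case: z w => [a b] [c e]. Qed.

Lemma ImD z w : complex.Im (z + w) = complex.Im z + complex.Im w.
Proof. by case: z w => [a b] [c e]. Qed.

Lemma ReN z : complex.Re (- z) = - complex.Re z.
Proof. by case: z. Qed.

Lemma ImN z : complex.Im (- z) = - complex.Im z.
Proof. by case: z. Qed.

Lemma ReM z w :
  complex.Re (z * w) = complex.Re z * complex.Re w - complex.Im z * complex.Im w.
Proof. by case: z w => [a b] [c e]. Qed.

Lemma ImM z w :
  complex.Im (z * w) = complex.Re z * complex.Im w + complex.Im z * complex.Re w.
Proof. by case: z w => [a b] [c e]. Qed.

Lemma Re_conj z : complex.Re (Num.conj z) = complex.Re z.
Proof. by case: z. Qed.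

Lemma Im_conj z : complex.Im (Num.conj z) = - complex.Im z.
Proof. by case: z. Qed.

Lemma ReMr x z : complex.Re (x%:C%C * z) = x * complex.Re z.
Proof. by rewrite ReM /= mul0r subr0. Qed.

Lemma ImMr x z : complex.Im (x%:C%C * z) = x * complex.Im z.
Proof. by rewrite ImM /= mul0r addr0. Qed.

Lemma complex_inj z w :
  complex.Re z = complex.Re w -> complex.Im z = complex.Im w -> z = w.
Proof. by case: z w => [a b] [c e] /= -> ->. Qed.

Lemma Re_sum I (r : seq I) (P : pred I) (F : I -> R[i]) :
  complex.Re (\sum_(i <- r | P i) F i) = \sum_(i <- r | P i) complex.Re (F i).
Proof. by apply: (big_morph (@complex.Re R)) => //; exact: ReD. Qed.

Lemma Im_sum I (r : seq I) (P : pred I) (F : I -> R[i]) :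
  complex.Im (\sum_(i <- r | P i) F i) = \sum_(i <- r | P i) complex.Im (F i).
Proof. by apply: (big_morph (@complex.Im R)) => //; exact: ImD. Qed.

Lemma expiD x y : expi (x + y) = expi x * expi y.
Proof. by apply: complex_inj; rewrite ?ReM ?ImM /= ?cosD ?sinD; ring. Qed.

Lemma expi0 : expi 0 = 1 :> R[i].
Proof. by rewrite /expi cos0 sin0. Qed.

Lemma expiN x : expi (- x) = Num.conj (expi x).
Proof. by apply: complex_inj; rewrite ?Re_conj ?Im_conj /= ?cosN ?sinN. Qed.

Lemma expi_sum I (r : seq I) (F : I -> R) :
  expi (\sum_(i <- r) F i) = \prod_(i <- r) expi (F i).
Proof. by apply: (big_morph (@expi R)); [exact: expiD|exact: expi0]. Qed.

Lemma expiMn x n : expi (x *+ n) = expi x ^+ n.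
Proof.
by elim: n => [|n IH]; rewrite ?mulr0n ?expi0 ?expr0 // mulrS exprS expiD IH.
Qed.

Lemma expi_2pi_int (k : int) : expi (2 * pi * k%:~R) = 1 :> R[i].
Proof.
have e1 : expi (2 * pi) = 1 :> R[i].
  by rewrite mulr_natl /expi cos_mulr2n sin_mulr2n sinpi mulr0 mul0rn cospi sqrrN expr1n mulr2n addrK.
case: k => n; first by rewrite -[Posz n]/(n%:Z) mulr_natr expiMn e1 expr1n.
by rewrite NegzE mulrNz mulrN expiN mulr_natr expiMn e1 expr1n rmorph1.
Qed.

Lemma cabs2_ge0 z : 0 <= cabs2 z.
Proof. by rewrite addr_ge0 ?sqr_ge0. Qed.

Lemma cabs2M z w : cabs2 (z * w) = cabs2 z * cabs2 w.
Proof. by rewrite /cabs2 ReM ImM; ring. Qed.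

Lemma cabs2_conj z : cabs2 (Num.conj z) = cabs2 z.
Proof. by rewrite /cabs2 Re_conj Im_conj sqrrN. Qed.

Lemma cabs2_expi x : cabs2 (expi x) = 1.
Proof. by rewrite /cabs2 /= cos2Dsin2. Qed.

Lemma cabs2E z : cabs2 z = complex.Re (Num.conj z * z).
Proof. by rewrite ReM Re_conj Im_conj /cabs2; ring. Qed.

Lemma cabs2_0 : cabs2 (0 : R[i]) = 0.
Proof. by rewrite /cabs2 /= expr0n /= addr0. Qed.

Lemma conjM_cabs2 z : Num.conj z * z = (cabs2 z)%:C%C.
Proof. by apply: complex_inj; rewrite ?ReM ?ImM ?Re_conj ?Im_conj /cabs2 /=; ring. Qed.

(** A modulus with values in [R]: the norm of [R[i]] takes values in [R[i]], whereas all limits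
    below are taken in [R]. *)
Definition cnorm z : R := Num.sqrt (cabs2 z).

Lemma cnormE z : cnorm z = ComplexField.Normc.normc z.
Proof. by case: z. Qed.

Lemma cnorm_ge0 z : 0 <= cnorm z. Proof. exact: sqrtr_ge0. Qed.

Lemma cnormM z w : cnorm (z * w) = cnorm z * cnorm w.
Proof. by rewrite /cnorm cabs2M sqrtrM // cabs2_ge0. Qed.

Lemma ler_cnormD z w : cnorm (z + w) <= cnorm z + cnorm w.
Proof. by rewrite !cnormE; exact: le_normcD. Qed.

Lemma cnorm0 : cnorm 0 = 0. Proof. by rewrite /cnorm cabs2_0 sqrtr0. Qed.

Lemma cnormN z : cnorm (- z) = cnorm z.
Proof. by rewrite /cnorm /cabs2 ReN ImN !sqrrN. Qed.

Lemma ler_cnorm_sum I (r : seq I) (P : pred I) (F : I -> R[i]) :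
  cnorm (\sum_(i <- r | P i) F i) <= \sum_(i <- r | P i) cnorm (F i).
Proof.
elim/big_rec2: _ => [|i y1 y2 _ H]; first by rewrite cnorm0.
by apply: le_trans (ler_cnormD _ _) _; rewrite lerD2l.
Qed.

Lemma cnorm_sqr z : cnorm z ^+ 2 = cabs2 z.
Proof. by rewrite sqr_sqrtr ?cabs2_ge0. Qed.

Lemma cnorm_expi x : cnorm (expi x) = 1.
Proof. by rewrite /cnorm cabs2_expi sqrtr1. Qed.

Lemma cnorm_conj z : cnorm (Num.conj z) = cnorm z.
Proof. by rewrite /cnorm cabs2_conj. Qed.

Lemma cnormr x : cnorm (x%:C%C) = `|x|.
Proof. by rewrite /cnorm /cabs2 /= expr0n /= addr0 sqrtr_sqr. Qed.

Lemma Re_le_cnorm z : `|complex.Re z| <= cnorm z.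
Proof.
by rewrite -sqrtr_sqr; apply: ler_wsqrtr; rewrite /cabs2 lerDl sqr_ge0.
Qed.

Lemma Im_le_cnorm z : `|complex.Im z| <= cnorm z.
Proof.
by rewrite -sqrtr_sqr; apply: ler_wsqrtr; rewrite /cabs2 lerDr sqr_ge0.
Qed.

Lemma cnorm_le_ReIm z : cnorm z <= `|complex.Re z| + `|complex.Im z|.
Proof.
rewrite -(@ler_pXn2r _ 2) ?nnegrE ?addr_ge0 ?cnorm_ge0 // cnorm_sqr /cabs2.
rewrite -(real_normK (num_real (complex.Re z))) -(real_normK (num_real (complex.Im z))).
have := normr_ge0 (complex.Re z); have := normr_ge0 (complex.Im z); nra.
Qed.

Lemma cos_mvt x y : x <= y ->
  exists2 c, x <= c <= y & cos y - cos x = - sin c * (y - x).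
Proof.
move=> xy.
have H1 c : c \in `]x, y[%R -> is_derive c 1 (@cos R) (- sin c).
  by move=> _; exact: is_derive_cos.
have H2 : {within `[x, y], continuous (@cos R)}.
  by apply: continuous_subspaceT; exact: continuous_cos.
by have [c cyz ->] := MVT_segment xy H1 H2; exists c => //; move: cyz; rewrite in_itv.
Qed.

Lemma dist_cos x y : `|cos x - cos y| <= `|x - y|.
Proof.
wlog xy : x y / y <= x.
  move=> H; case: (leP y x) => [|/ltW] /H //; by rewrite distrC (distrC x).
have [c _ ->] := cos_mvt xy.
by rewrite normrM ler_piMl // normrN sin_max.
Qed.

Lemma sin_cos_shift x : sin x = cos (x - pi / 2).
Proof. by rewrite cosB cos_pihalf sin_pihalf mulr0 add0r mulr1. Qed.

Lemma dist_sin x y : `|sin x - sin y| <= `|x - y|.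
Proof.
rewrite !sin_cos_shift; apply: le_trans (dist_cos _ _) _.
by rewrite opprB addrA subrK.
Qed.

(** Mean value theorem and the 1-Lipschitz bound on the sine. This one-sided estimate is the only
    source of semiconcavity in the whole proof. *)
Lemma cos_taylor1 x h : cos (x + h) <= cos x - sin x * h + h ^+ 2.
Proof.
have [h0|/ltW h0] := leP 0 h.
  have [|c /andP[c1 c2] E] := @cos_mvt x (x + h); first by rewrite lerDl.
  have := dist_sin c x; rewrite [X in _ <= X]ger0_norm ?subr_ge0 // ler_norml => /andP[D1 D2].
  nra.
have [|c /andP[c1 c2] E] := @cos_mvt (x + h) x; first by rewrite gerDl.
have := dist_sin c x; rewrite [X in _ <= X]ler0_norm ?subr_le0 // ler_norml => /andP[D1 D2].
nra.
Qed.

(** Polar form of [z]; it transfers real estimates on the cosine to characters with complex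
    coefficients. *)
Lemma Re_expi_phase z : exists a, forall y, complex.Re (z * expi y) = cnorm z * cos (y + a).
Proof.
have [z0|zn0] := eqVneq (cnorm z) 0.
  exists 0 => y; rewrite z0 mul0r; apply/eqP; rewrite -normr_eq0 eq_le normr_ge0 andbT.
  by apply: (le_trans (Re_le_cnorm _)); rewrite cnormM z0 mul0r.
pose u := complex.Re z / cnorm z; pose v := complex.Im z / cnorm z.
have uv : u ^+ 2 + v ^+ 2 = 1.
  by rewrite /u /v !expr_div_n -mulrDl -[X in X / _]/(cabs2 z) -cnorm_sqr divff // expf_neq0.
have u1 : -1 <= u <= 1 by have := sqr_ge0 v; nra.
have [a ca sa] : exists2 a, cos a = u & sin a = v.
  have [v0|v0] := leP 0 v.
    exists (acos u); first by rewrite acosK // in_itv.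
    by rewrite sin_acos // -uv addrAC subrr add0r sqrtr_sqr ger0_norm.
  exists (- acos u); first by rewrite cosN acosK // in_itv.
  by rewrite sinN sin_acos // -uv addrAC subrr add0r sqrtr_sqr ltr0_norm ?opprK.
exists a => y; rewrite cosD ca sa ReM /= /u /v; by field.
Qed.

End ComplexNumbers.

(** * Lipschitz and semiconcavity bounds for characters *)

Section TrigonometricFunctions.
Variables (R : realType) (d : nat).
Implicit Types (c x y h : 'I_d -> R) (F G : ('I_d -> R) -> R) (z : R[i]).

Definition lin c x : R := \sum_i c i * x i.

Lemma linDr c x y : lin c (fun i => x i + y i) = lin c x + lin c y.
Proof. by rewrite -big_split; apply: eq_bigr => i _; rewrite mulrDr. Qed.

Lemma linZr c (s : R) x : lin c (fun i => s * x i) = s * lin c x.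
Proof. by rewrite mulr_sumr; apply: eq_bigr => i _; rewrite mulrCA. Qed.

Lemma dist_lin c x y : `|lin c x - lin c y| <= (\sum_i `|c i|) * dist1 x y.
Proof.
rewrite -sumrB; apply: le_trans (ler_norm_sum _ _ _) _.
rewrite mulr_suml; apply: ler_sum => i _; rewrite -mulrBr normrM.
apply: ler_wpM2l => //; rewrite /dist1 (bigD1 i) //= lerDl.
by apply: sumr_ge0.
Qed.

Lemma lipschitz_cst (r : R) : lipschitz_fun (fun _ : 'I_d -> R => r).
Proof. by exists 0 => // x y; rewrite subrr normr0 mul0r. Qed.

Lemma lipschitzD F G : lipschitz_fun F -> lipschitz_fun G ->
  lipschitz_fun (fun x => F x + G x).
Proof.
move=> [C C0 CF] [K K0 KG]; exists (C + K); first exact: addr_ge0.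
move=> x y; rewrite opprD addrACA mulrDl; apply: le_trans (ler_normD _ _) _.
by apply: lerD.
Qed.

Lemma lipschitzZ (r : R) F : lipschitz_fun F -> lipschitz_fun (fun x => r * F x).
Proof.
move=> [C C0 CF]; exists (`|r| * C); first exact: mulr_ge0.
by move=> x y; rewrite -mulrBr normrM -mulrA ler_wpM2l.
Qed.

Lemma lipschitz_sum I (s : seq I) (f : I -> ('I_d -> R) -> R) :
  (forall i, lipschitz_fun (f i)) -> lipschitz_fun (fun x => \sum_(i <- s) f i x).
Proof.
move=> Lf; elim: s => [|i s IH].
  by under eq_fun do rewrite big_nil; exact: lipschitz_cst.
by under eq_fun do rewrite big_cons; exact: lipschitzD.
Qed.

Lemma lipschitz_cos c (a : R) : lipschitz_fun (fun x => cos (lin c x + a)).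
Proof.
exists (\sum_i `|c i|); first exact: sumr_ge0.
move=> x y; apply: le_trans (dist_cos _ _) _.
by rewrite opprD addrACA subrr addr0 dist_lin.
Qed.

Lemma lipschitz_expi c z : lipschitz_fun (fun x => complex.Re (z * expi (lin c x))).
Proof.
have [a az] := Re_expi_phase z; under eq_fun do rewrite az.
exact/lipschitzZ/lipschitz_cos.
Qed.

Lemma lipschitz_shift F h : lipschitz_fun F -> lipschitz_fun (fun x => F (fun i => x i + h i)).
Proof.
case=> C C0 CF; exists C => // x y; apply: le_trans (CF _ _) _.
by apply: ler_wpM2l => //; apply: ler_sum => i _; rewrite opprD addrACA subrr addr0.
Qed.

Lemma lin_sqr_le c h : lin c h ^+ 2 <= d%:R * (\sum_i c i ^+ 2) * \sum_i h i ^+ 2.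
Proof.
have cs (n : nat) (u : 'I_n -> R) : (\sum_i u i) ^+ 2 <= n%:R * \sum_i u i ^+ 2.
  elim: n u => [|n IH] u; first by rewrite !big_ord0 expr0n mul0r.
  rewrite !big_ord_recr /=; set S := \sum_i _; set Q := \sum_i _.
  have H : S ^+ 2 <= n%:R * Q := IH (fun i => u (widen_ord (leqnSn n) i)).
  have Q0 : 0 <= Q by apply: sumr_ge0 => i _; exact: sqr_ge0.
  case: n {IH} u S Q H Q0 => [|n] u S Q H Q0.
    have -> : S = 0.
      by apply/eqP; rewrite -sqrf_eq0 eq_le sqr_ge0 andbT; rewrite mul0r in H.
    by rewrite mul1r add0r lerDr.
  rewrite -[n.+2]addn1 natrD mulrDl mul1r.
  set k := n.+1%:R in H *; have k0 : 0 < k by rewrite ltr0n.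
  set w := u ord_max.
  (* AM-GM with weight [k]: as [S ^+ 2 / k <= Q], the square of the sum is at most
     [k * Q + Q + k * w ^+ 2 + w ^+ 2], which is the claim at the next index. *)
  have : 2 * S * w <= S ^+ 2 / k + k * w ^+ 2.
    have -> : S ^+ 2 / k + k * w ^+ 2 = (S / k - w) ^+ 2 * k + 2 * S * w.
      by field; rewrite gt_eqF.
    by rewrite lerDr mulr_ge0 ?sqr_ge0 // ltW.
  have : S ^+ 2 / k <= Q by rewrite ler_pdivrMr // mulrC.
  have -> : (S + w) ^+ 2 = S ^+ 2 + 2 * S * w + w ^+ 2 by ring.
  by move: H k0; clearbody k w => H k0 h1 h2; move: (S ^+ 2 / k) h1 h2 => v h1 h2; nra.
apply: le_trans (cs _ _) _; rewrite -mulrA; apply: ler_wpM2l => //.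
rewrite mulr_suml; apply: ler_sum => i _; rewrite exprMn; apply: ler_wpM2l; first exact: sqr_ge0.
rewrite (bigD1 i) //= lerDl; by apply: sumr_ge0 => j _; exact: sqr_ge0.
Qed.

(** The linear part [l] depends on [x] and [z], the quadratic constant on neither; this uniformity
    is what survives an infimum over coefficients. *)
Lemma expi_semiconcave c z : cnorm z <= 1 -> forall x, exists l, forall h,
  complex.Re (z * expi (lin c (fun i => x i + h i)))
    <= complex.Re (z * expi (lin c x)) + lin l h + d%:R * (\sum_i c i ^+ 2) * \sum_i h i ^+ 2.
Proof.
move=> z1 x; have [a az] := Re_expi_phase z.
exists (fun i => - (cnorm z * sin (lin c x + a)) * c i) => h.
rewrite !az linDr addrAC.
have -> : lin (fun i => - (cnorm z * sin (lin c x + a)) * c i) h =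
  cnorm z * (- sin (lin c x + a) * lin c h).
  by rewrite mulrA mulrN mulr_sumr; apply: eq_bigr => i _; rewrite mulrA.
apply: (@le_trans _ _ (cnorm z * (cos (lin c x + a) - sin (lin c x + a) * lin c h + lin c h ^+ 2))).
  by apply: ler_wpM2l; [exact: cnorm_ge0|exact: cos_taylor1].
rewrite !mulrDr mulNr lerD2l; apply: le_trans (lin_sqr_le _ _).
by rewrite ler_piMl // sqr_ge0.
Qed.

Lemma dist_expi (u v : R) : cnorm (expi u - expi v) <= 2 * `|u - v|.
Proof.
apply: le_trans (cnorm_le_ReIm _) _; rewrite mulr_natl mulr2n ReD ImD ReN ImN /=.
by apply: lerD; [exact: dist_cos|exact: dist_sin].
Qed.

Lemma expi_lipschitz c z x y :
  `|complex.Re (z * expi (lin c x)) - complex.Re (z * expi (lin c y))|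
    <= cnorm z * (2 * ((\sum_i `|c i|) * dist1 x y)).
Proof.
rewrite -ReN -ReD -mulrBr; apply: le_trans (Re_le_cnorm _) _.
rewrite cnormM; apply: ler_wpM2l; first exact: cnorm_ge0.
by apply: le_trans (dist_expi _ _) _; apply: ler_wpM2l => //; exact: dist_lin.
Qed.

End TrigonometricFunctions.

(** * Orthogonality of characters on the torus *)

Section FourierIntegral.
Variables (R : realType) (d : nat).
Variable lam : {measure set (d.-tuple R) -> \bar R}.
Hypothesis Hlam : is_lebesgue_measure lam.
Local Notation T := (@torus R d).

(** A geometric sum of powers of a root of unity [w]. It vanishes because [w != 1]: the half angle
    [y] satisfies [0 < |y| < pi] when [0 < |k| <= M], so its sine is nonzero. *)
Lemma expi_root_sum (M : nat) (k : int) : k != 0 -> (`|k| <= M)%N ->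
  \sum_(j < M.+1) expi (2 * pi * k%:~R * (j%:R / M.+1%:R)) = 0 :> R[i].
Proof.
move=> k0 kM; have M0 : 0 < M.+1%:R :> R by rewrite ltr0n.
pose y : R := pi * (k%:~R / M.+1%:R); pose w : R[i] := expi (y *+ 2).
have -> : \sum_(j < M.+1) expi (2 * pi * k%:~R * (j%:R / M.+1%:R)) = \sum_(j < M.+1) w ^+ j.
  apply: eq_bigr => j _; rewrite -expiMn; congr expi.
  by rewrite /y -mulr_natl -[RHS]mulr_natl; ring.
have w1 : w != 1.
  apply/eqP => /(congr1 (@complex.Re R)); rewrite /= cos_mulr2n => /eqP.
  rewrite -subr_eq0 cos2sin2 => /eqP E.
  have /eqP : sin y ^+ 2 = 0 by lra.
  rewrite sqrf_eq0 => /eqP s0.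
  have ay : `|y| = pi * (`|k|%N%:R / M.+1%:R).
    by rewrite natr_absz intr_norm /y !normrM normfV (ger0_norm (pi_ge0 R)) (ger0_norm (ler0n _ _)).
  have : 0 < sin `|y|.
    apply: sin_gt0_pi; rewrite ay; apply/andP; split.
      by rewrite mulr_gt0 ?pi_gt0 // divr_gt0 // ltr0n absz_gt0.
    by rewrite gtr_pMr ?pi_gt0 // ltr_pdivrMr // mul1r ltr_nat ltnS.
  by case: (ler0P y) => _; rewrite ?sinN s0 ?oppr0 ltxx.
have wM : w ^+ M.+1 = 1.
  rewrite /w -expiMn -(expi_2pi_int R k); congr expi.
  rewrite -mulr_natl -(mulr_natl y 2) /y.
  by field; rewrite gt_eqF // addrC natr1.
have := subrX1 w M.+1; rewrite wM subrr => /esym/eqP; rewrite mulf_eq0 subr_eq0 (negbTE w1) /=.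
by move/eqP.
Qed.

(** The grid sum factorises over the coordinates, and the factor of a nonzero frequency is exactly
    zero once [M] reaches its absolute value, so the grid averages are eventually constant. *)
Lemma torus_fourier (z : R[i]) (k : 'I_d -> int) :
  (\int[lam]_(th in T) complex.Re (z * expi (2 * pi * \sum_i (k i)%:~R * tnth th i)) =
   if [forall i, k i == 0] then complex.Re z else 0)%R.
Proof.
have E : forall x : 'I_d -> R, 2 * pi * \sum_i (k i)%:~R * x i = lin (fun i => 2 * pi * (k i)%:~R) x.
  by move=> x; rewrite mulr_sumr; apply: eq_bigr => i _; rewrite mulrA.
under eq_Rintegral do rewrite E.
pose F x := complex.Re (z * expi (lin (fun i => 2 * pi * (k i)%:~R) x)).
rewrite -/(F _); case: ifPn => [/forallP k0|].
  under eq_Rintegral => th _.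
    rewrite /lin big1 => [|i _]; last by rewrite (eqP (k0 i)) mulr0 mul0r.
    rewrite expi0 mulr1; over.
  rewrite Rintegral_cst ?(lam_torus Hlam) /= ?mulr1 //; exact: measurable_torus.
rewrite negb_forall => /existsP[i0 ki0].
have LF : lipschitz_fun F := lipschitz_expi _ _.
have cF := cvg_grid_avg Hlam LF.
apply: (cvg_unique _ cF) => //=.
apply: cvg_near_cst; near=> M.
rewrite /grid_avg -Re_sum -mulr_sumr.
under eq_bigr do rewrite /lin expi_sum.
rewrite -(bigA_distr_bigA (fun i (j : 'I_M.+1) => expi (2 * pi * (k i)%:~R * (j%:R / M.+1%:R)))).
rewrite (bigD1 i0) //= expi_root_sum ?mul0r ?mulr0 //.
by near: M; exists `|k i0|%N.
Unshelve. all: by end_near.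
Qed.

End FourierIntegral.

(** * Spectral decompositions and Ky Fan's principle *)

Section HermitianMatrices.
Variable R : realType.

Definition adjmx m n (A : 'M[R[i]]_(m, n)) : 'M[R[i]]_(n, m) := map_mx Num.conj A^T.

Lemma adjmxM m n p (A : 'M[R[i]]_(m, n)) (B : 'M[R[i]]_(n, p)) :
  adjmx (A *m B) = adjmx B *m adjmx A.
Proof. by rewrite /adjmx trmx_mul map_mxM. Qed.

Lemma adjmxZ m n c (A : 'M[R[i]]_(m, n)) : adjmx (c *: A) = Num.conj c *: adjmx A.
Proof. by apply/matrixP => i j; rewrite !mxE rmorphM. Qed.

Lemma adjmx_sum m n I (r : seq I) (Q : pred I) (F : I -> 'M[R[i]]_(m, n)) :
  adjmx (\sum_(i <- r | Q i) F i) = \sum_(i <- r | Q i) adjmx (F i).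
Proof.
apply: (big_morph (@adjmx m n)) => [A B|]; apply/matrixP => i j; rewrite !mxE.
  by rewrite rmorphD.
by rewrite rmorph0.
Qed.

Variable nu : nat.
Implicit Types (x y : 'cV[R[i]]_nu) (A H : 'M[R[i]]_nu).

Definition dot x y : R[i] := (adjmx x *m y) 0 0.
Definition vn x : R := Num.sqrt (vnorm2 x).

Lemma dotE x y : dot x y = \sum_m Num.conj (x m 0) * y m 0.
Proof. by rewrite /dot mxE; apply: eq_bigr => m _; rewrite !mxE. Qed.

Lemma dotBr x y z : dot x (y - z) = dot x y - dot x z.
Proof. by rewrite /dot mulmxBr !mxE. Qed.

Lemma dotZr c x y : dot x (c *: y) = c * dot x y.
Proof. by rewrite /dot -scalemxAr mxE. Qed.

Lemma dotZl c x y : dot (c *: x) y = Num.conj c * dot x y.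
Proof. by rewrite /dot adjmxZ -scalemxAl mxE. Qed.

Lemma dot_sumr I (r : seq I) x (F : I -> 'cV[R[i]]_nu) :
  dot x (\sum_(i <- r) F i) = \sum_(i <- r) dot x (F i).
Proof. by rewrite /dot mulmx_sumr summxE. Qed.

Lemma dot_suml I (r : seq I) x (F : I -> 'cV[R[i]]_nu) :
  dot (\sum_(i <- r) F i) x = \sum_(i <- r) dot (F i) x.
Proof. by rewrite /dot adjmx_sum mulmx_suml summxE. Qed.

Lemma dot_adj A x y : dot (A *m x) y = dot x (adjmx A *m y).
Proof. by rewrite /dot adjmxM mulmxA. Qed.

Lemma dotxx x : dot x x = (vnorm2 x)%:C%C.
Proof.
rewrite dotE rmorph_sum; apply: eq_bigr => m _; exact: conjM_cabs2.
Qed.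

Lemma vnorm2_ge0 x : 0 <= vnorm2 x.
Proof. by apply: sumr_ge0 => m _; exact: cabs2_ge0. Qed.

Lemma vn_ge0 x : 0 <= vn x. Proof. exact: sqrtr_ge0. Qed.

Lemma vn_sqr x : vn x ^+ 2 = vnorm2 x.
Proof. by rewrite sqr_sqrtr ?vnorm2_ge0. Qed.

Lemma cnorm_le_vn x m : cnorm (x m 0) <= vn x.
Proof.
apply: ler_wsqrtr; rewrite /vnorm2 (bigD1 m) //= lerDl.
by apply: sumr_ge0 => ? _; exact: cabs2_ge0.
Qed.

Lemma vn_le_sum x : vn x <= \sum_m cnorm (x m 0).
Proof.
rewrite -(@ler_pXn2r _ 2) ?nnegrE ?vn_ge0 ?sumr_ge0 // => [|? _]; last exact: cnorm_ge0.
rewrite vn_sqr /vnorm2 -[leRHS]/(_ ^+ 2).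
apply: (@proj2 (0 <= \sum_m cnorm (x m 0))).
elim/big_ind2: _ => [|a b c e [a0 ab] [c0 ce]|m _]; first by rewrite expr0n.
  by split; [exact: addr_ge0|nra].
by rewrite cnorm_sqr cnorm_ge0.
Qed.

(** Cauchy-Schwarz up to the factor [nu], harmless because it serves only for boundedness and for
    limits equal to zero. *)
Lemma cnorm_dot x y : cnorm (dot x y) <= nu%:R * (vn x * vn y).
Proof.
rewrite dotE; apply: le_trans (ler_cnorm_sum _ _ _) _.
rewrite -[nu in leRHS]card_ord mulr_natl -sumr_const; apply: ler_sum => m _.
by rewrite cnormM cnorm_conj ler_pM ?cnorm_ge0 ?cnorm_le_vn.
Qed.

Lemma cnorm_dot_mx x A y :
  cnorm (dot x (A *m y)) <= (\sum_k \sum_l cnorm (A k l)) * (vn x * vn y).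
Proof.
rewrite dotE; apply: le_trans (ler_cnorm_sum _ _ _) _.
rewrite mulr_suml; apply: ler_sum => k _; rewrite cnormM cnorm_conj mxE.
apply: (le_trans (ler_wpM2l (cnorm_ge0 _) (ler_cnorm_sum _ _ _))).
rewrite mulr_sumr mulr_suml; apply: ler_sum => l _; rewrite cnormM mulrCA.
by apply: ler_wpM2l; [exact: cnorm_ge0|rewrite ler_pM ?cnorm_ge0 ?cnorm_le_vn].
Qed.

(** Rank factorisation [A = col_base A *m row_base A]: idempotence gives
    [row_base A *m col_base A = 1], and the trace is cyclic. *)
Lemma mxtrace_idempotent A : A *m A = A -> \tr A = (\rank A)%:R.
Proof.
move=> AA; have E := mulmx_base A.
have I1 : row_base A *m col_base A = 1%:M.
  apply: (row_free_inj (row_base_free A)); rewrite mul1mx.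
  have E2 : col_base A *m (row_base A *m col_base A *m row_base A) = col_base A *m row_base A.
    transitivity (col_base A *m row_base A *m (col_base A *m row_base A)).
      by rewrite !mulmxA.
    by rewrite E.
  have /row_fullP[B BC] := col_base_full A.
  by move: (congr1 (mulmx B) E2); rewrite mulmxA BC mul1mx mulmxA BC mul1mx.
by rewrite -{1}E mxtrace_mulC I1 mxtrace1.
Qed.

Lemma mxtrace_sum I (r : seq I) (Q : pred I) (F : I -> 'M[R[i]]_nu) :
  \tr (\sum_(i <- r | Q i) F i) = \sum_(i <- r | Q i) \tr (F i).
Proof. by apply: (big_morph mxtrace) => [A B|]; [exact: mxtraceD|exact: mxtrace0]. Qed.

(** A diagonal entry of an orthogonal projection equals the sum of squared moduli of its row. Hence
    its own square is at most itself, so it is at most 1, and it bounds the squared modulus of every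
    entry of the row. *)
Lemma projection_entry_le1 A i j : A *m A = A -> adjmx A = A -> cnorm (A i j) <= 1.
Proof.
move=> AA AH; have Aii : complex.Re (A i i) = \sum_j cabs2 (A i j).
  rewrite -{1}AA mxE Re_sum; apply: eq_bigr => l _.
  by rewrite -{2}AH !mxE mulrC -cabs2E.
have h1 l : cabs2 (A i l) <= complex.Re (A i i).
  by rewrite Aii (bigD1 l) //= lerDl; apply: sumr_ge0 => m _; exact: cabs2_ge0.
have h2 : complex.Re (A i i) <= 1.
  have := h1 i; have := sqr_ge0 (complex.Im (A i i)); rewrite /cabs2; nra.
by rewrite -sqrtr1; apply: ler_wsqrtr; exact: le_trans (h1 j) h2.
Qed.

Record spectral (E : 'I_nu -> R) (P : 'I_nu -> 'M[R[i]]_nu) H : Prop := Spectral {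
  spec_herm : forall n, adjmx (P n) = P n;
  spec_orth : forall n m, P n *m P m = if n == m then P n else 0;
  spec_sum : \sum_n P n = 1%:M;
  spec_rank : forall n, \rank (P n) = 1%N;
  spec_dec : H = \sum_n (E n)%:C%C *: P n }.

Section Spectral.
Variables (E : 'I_nu -> R) (P : 'I_nu -> 'M[R[i]]_nu) (H : 'M[R[i]]_nu).
Hypothesis EPH : spectral E P H.

Lemma spec_idem n : P n *m P n = P n.
Proof. by rewrite (spec_orth EPH) eqxx. Qed.

Lemma spec_mulP n : P n *m H = (E n)%:C%C *: P n.
Proof.
rewrite (spec_dec EPH) mulmx_sumr (bigD1 n) //= -scalemxAr spec_idem big1 ?addr0 //.
by move=> m mn; rewrite -scalemxAr (spec_orth EPH) eq_sym (negbTE mn) scaler0.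
Qed.

Lemma spec_Pmul n : H *m P n = (E n)%:C%C *: P n.
Proof.
rewrite (spec_dec EPH) mulmx_suml (bigD1 n) //= -scalemxAl spec_idem big1 ?addr0 //.
by move=> m mn; rewrite -scalemxAl (spec_orth EPH) (negbTE mn) scaler0.
Qed.

Lemma dotP n x y : dot (P n *m x) y = dot (P n *m x) (P n *m y).
Proof. by rewrite [RHS]dot_adj (spec_herm EPH) mulmxA spec_idem dot_adj (spec_herm EPH). Qed.

Lemma dotPP n m x y : n != m -> dot (P n *m x) (P m *m y) = 0.
Proof.
move=> nm; rewrite dot_adj (spec_herm EPH) mulmxA (spec_orth EPH) (negbTE nm) mul0mx.
by rewrite /dot mulmx0 mxE.
Qed.

Lemma spec_resolution x : x = \sum_n P n *m x.
Proof. by rewrite -mulmx_suml (spec_sum EPH) mul1mx. Qed.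

Definition spec_fun (c : 'I_nu -> R[i]) x : 'cV[R[i]]_nu := \sum_n c n *: (P n *m x).

Lemma vnorm2_spec_fun c x : vnorm2 (spec_fun c x) = \sum_n cabs2 (c n) * vnorm2 (P n *m x).
Proof.
apply: (@complexI R); rewrite -dotxx rmorph_sum /= /spec_fun dot_suml; apply: eq_bigr => n _.
rewrite dot_sumr (bigD1 n) //= big1 ?addr0 => [|m mn]; rewrite dotZl dotZr.
  by rewrite mulrA conjM_cabs2 dotxx -rmorphM.
by rewrite dotPP ?mulr0 // eq_sym.
Qed.

Lemma vnorm2_resolution x : vnorm2 x = \sum_n vnorm2 (P n *m x).
Proof.
have -> : vnorm2 x = vnorm2 (spec_fun (fun=> 1) x).
  by congr vnorm2; rewrite {1}[x]spec_resolution; apply: eq_bigr => n _; rewrite scale1r.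
by rewrite vnorm2_spec_fun; apply: eq_bigr => n _; rewrite /cabs2 /= expr1n expr0n addr0 mul1r.
Qed.

Lemma vnorm2P_le n x : vnorm2 (P n *m x) <= vnorm2 x.
Proof.
rewrite [leRHS]vnorm2_resolution (bigD1 n) //= lerDl; apply: sumr_ge0 => m _.
exact: vnorm2_ge0.
Qed.

Lemma vnP_le n x : vn (P n *m x) <= vn x.
Proof. exact/ler_wsqrtr/vnorm2P_le. Qed.

Lemma spec_fun_mul c x : H *m spec_fun c x = spec_fun (fun n => (E n)%:C%C * c n) x.
Proof.
rewrite mulmx_sumr; apply: eq_bigr => n _.
by rewrite -scalemxAr mulmxA spec_Pmul -scalemxAl scalerA mulrC.
Qed.

End Spectral.

Lemma trace_adj_ge0 A : 0 <= complex.Re (\tr (A *m adjmx A)).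
Proof.
rewrite Re_sum; apply: sumr_ge0 => i _; rewrite mxE Re_sum; apply: sumr_ge0 => j _.
by rewrite !mxE mulrC -cabs2E cabs2_ge0.
Qed.

(** Bathtub principle: mass [k] spread with density at most 1 has least energy when it fills the
    lowest levels. *)
Lemma weighted_sum_ge (E w : 'I_nu -> R) (k : nat) : (k <= nu)%N ->
  (forall n m : 'I_nu, (n <= m)%N -> E n <= E m) ->
  (forall n, 0 <= w n <= 1) -> \sum_n w n = k%:R ->
  \sum_(n < nu | (n < k)%N) E n <= \sum_n w n * E n.
Proof.
case: k => [|k] kn Einc w01 wk.
  rewrite big_pred0 // sumr_ge0 // => n _.
  suff -> : w n = 0 by rewrite mul0r.
  apply/eqP; rewrite eq_le; have /andP[-> _] := w01 n; rewrite andbT -[leRHS]wk.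
  rewrite (bigD1 n) //= lerDl; apply: sumr_ge0 => m _; by have /andP[] := w01 m.
(* The threshold is the highest filled level. Both sides carry the same total mass, so subtracting
   [c] from every energy reduces the claim to a comparison of signs term by term. *)
pose c := E (Ordinal kn).
have cardk : \sum_(n < nu | (n < k.+1)%N) 1 = k.+1%:R :> R.
  rewrite (eq_bigl (fun n : 'I_nu => (n < k.+1)%N)) // -(big_ord_widen nu (fun=> 1)) //.
  by rewrite sumr_const card_ord.
have -> : \sum_n w n * E n = \sum_n w n * (E n - c) + k.+1%:R * c.
  by rewrite -wk mulr_suml -big_split; apply: eq_bigr => n _; rewrite /= -mulrDr subrK.
have -> : \sum_(n < nu | (n < k.+1)%N) E n =
    \sum_(n < nu | (n < k.+1)%N) (E n - c) + k.+1%:R * c.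
  by rewrite -cardk mulr_suml -big_split; apply: eq_bigr => n _; rewrite /= mul1r subrK.
rewrite lerD2r [leLHS]big_mkcond; apply: ler_sum => n _.
have /andP[w0 w1] := w01 n; case: ltnP => nk.
  have : E n <= c by exact: Einc.
  by nra.
have : c <= E n by apply: Einc; exact: ltnW.
by nra.
Qed.

(** * Ky Fan's variational principle *)

Section KyFan.
Variables (E : 'I_nu -> R) (P : 'I_nu -> 'M[R[i]]_nu) (H : 'M[R[i]]_nu).
Variables (E' : 'I_nu -> R) (P' : 'I_nu -> 'M[R[i]]_nu) (H' : 'M[R[i]]_nu).
Hypotheses (EPH : spectral E P H) (EPH' : spectral E' P' H').
Implicit Type k : nat.

Definition eigsum (F : 'I_nu -> R) k : R := \sum_(n < nu | (n < k)%N) F n.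
Definition low_proj (S : 'I_nu -> 'M[R[i]]_nu) k : 'M[R[i]]_nu :=
  \sum_(n < nu | (n < k)%N) S n.

(** With [X = P n *m P' m], idempotence and cyclicity turn this trace into that of
    [X *m adjmx X]. *)
Lemma trace_PP_ge0 n m : 0 <= complex.Re (\tr (P n *m P' m)).
Proof.
have := trace_adj_ge0 (P n *m P' m); rewrite adjmxM (spec_herm EPH) (spec_herm EPH').
by rewrite -mulmxA (mulmxA (P' m)) (spec_idem EPH') mxtrace_mulC -mulmxA (spec_idem EPH) mxtrace_mulC.
Qed.

Lemma trace_spec (S : 'I_nu -> 'M[R[i]]_nu) F B n : spectral F S B -> \tr (S n) = 1.
Proof. by move=> FSB; rewrite mxtrace_idempotent ?(spec_idem FSB) // (spec_rank FSB). Qed.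

Lemma trace_low_proj k : (k <= nu)%N -> \tr (low_proj P k) = k%:R.
Proof.
move=> kn; rewrite mxtrace_sum /=; under eq_bigr do rewrite (trace_spec _ EPH).
rewrite -(big_ord_widen nu (fun=> 1)) // sumr_const card_ord //.
Qed.

(** In the eigenbasis of [H'] the right-hand side is a weighted sum of eigenvalues. The weights
    [tr (low_proj P k *m P' m)] lie in [0, 1] and add up to [k], so the bathtub principle
    applies. *)
Lemma ky_fan k : (k <= nu)%N -> (forall n m : 'I_nu, (n <= m)%N -> E' n <= E' m) ->
  eigsum E' k <= complex.Re (\tr (low_proj P k *m H')).
Proof.
move=> kn Einc.
have -> : complex.Re (\tr (low_proj P k *m H')) =
    \sum_m complex.Re (\tr (low_proj P k *m P' m)) * E' m.
  rewrite (spec_dec EPH') mulmx_sumr mxtrace_sum Re_sum; apply: eq_bigr => m _ /=.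
  by rewrite -scalemxAr mxtraceZ ReMr mulrC.
have wE m : complex.Re (\tr (low_proj P k *m P' m)) =
    \sum_(n < nu | (n < k)%N) complex.Re (\tr (P n *m P' m)).
  by rewrite mulmx_suml mxtrace_sum Re_sum.
apply: weighted_sum_ge => //.
  move=> m; rewrite wE sumr_ge0 => [/=|n _]; last exact: trace_PP_ge0.
  apply: (@le_trans _ _ (\sum_n complex.Re (\tr (P n *m P' m)))).
    by rewrite [leLHS]big_mkcond; apply: ler_sum => n _; case: ifP => // _; exact: trace_PP_ge0.
  rewrite -Re_sum -mxtrace_sum -mulmx_suml (spec_sum EPH) mul1mx.
  by rewrite (trace_spec _ EPH').
rewrite -Re_sum -mxtrace_sum -mulmx_sumr (spec_sum EPH') mulmx1 trace_low_proj //.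
by rewrite -(rmorph_nat (real_complex R)).
Qed.

Lemma trace_low_proj_mul k : complex.Re (\tr (low_proj P k *m H)) = eigsum E k.
Proof.
rewrite mulmx_suml mxtrace_sum Re_sum; apply: eq_bigr => n _ /=.
by rewrite (spec_mulP EPH) mxtraceZ (trace_spec _ EPH) mulr1.
Qed.

Lemma low_proj_projection k :
  low_proj P k *m low_proj P k = low_proj P k /\ adjmx (low_proj P k) = low_proj P k.
Proof.
split; last by rewrite adjmx_sum; apply: eq_bigr => n _; rewrite (spec_herm EPH).
rewrite mulmx_suml; apply: eq_bigr => n nk; rewrite mulmx_sumr (bigD1 n) //=.
rewrite (spec_idem EPH) big1 ?addr0 // => m /andP[_ mn].
by rewrite (spec_orth EPH) eq_sym (negbTE mn).
Qed.

End KyFan.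

End HermitianMatrices.

(** * Regularity of the band functions *)

Section UniformFamilies.
Variables (R : realType) (d : nat) (Z : Type) (D : Z -> Prop).
Implicit Types F G : Z -> ('I_d -> R) -> R.

(** The quadratic constant is uniform in the index [z], while the supergradient [l] may depend on
    it: the form of semiconcavity that passes to infima. *)
Definition semiconcave_family F := exists2 K : R, 0 <= K &
  forall z, D z -> forall x, exists l, forall h,
    F z (fun i => x i + h i) <= F z x + lin l h + K * \sum_i h i ^+ 2.

Definition lipschitz_family F := exists2 C : R, 0 <= C &
  forall z, D z -> forall x y, `|F z x - F z y| <= C * dist1 x y.

Lemma semiconcave_familyD F G : semiconcave_family F -> semiconcave_family G ->
  semiconcave_family (fun z x => F z x + G z x).
Proof.
move=> [K K0 FK] [L L0 GL]; exists (K + L); first exact: addr_ge0.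
move=> z Dz x; have [l lP] := FK _ Dz x; have [m mP] := GL _ Dz x.
exists (fun i => l i + m i) => h.
have -> : lin (fun i => l i + m i) h = lin l h + lin m h.
  by rewrite -big_split; apply: eq_bigr => i _; rewrite mulrDl.
by have := lP h; have := mP h; lra.
Qed.

Lemma semiconcave_family_cst (f : Z -> R) : semiconcave_family (fun z _ => f z).
Proof.
exists 0 => // z _ x; exists (fun=> 0) => h; rewrite mul0r addr0 /lin big1 ?addr0 //.
by move=> i _; rewrite mul0r.
Qed.

Lemma semiconcave_family_sum I (s : seq I) (F : I -> Z -> ('I_d -> R) -> R) :
  (forall i, semiconcave_family (F i)) ->
  semiconcave_family (fun z x => \sum_(i <- s) F i z x).
Proof.
move=> H; elim: s => [|i s IH].
  rewrite (_ : (fun _ => _) = fun z (x : 'I_d -> R) => 0); first exact: semiconcave_family_cst.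
  by apply/funext => z; apply/funext => x; rewrite big_nil.
rewrite (_ : (fun _ => _) = fun z (x : 'I_d -> R) => F i z x + \sum_(i <- s) F i z x).
  exact: semiconcave_familyD.
by apply/funext => z; apply/funext => x; rewrite big_cons.
Qed.

Lemma lipschitz_family_sum I (s : seq I) (F : I -> Z -> ('I_d -> R) -> R) :
  (forall i, lipschitz_family (F i)) ->
  lipschitz_family (fun z x => \sum_(i <- s) F i z x).
Proof.
move=> H; elim: s => [|i s [C C0 CF]].
  by exists 0 => // z _ x y; rewrite !big_nil subrr normr0 mul0r.
have [K K0 KF] := H i; exists (K + C); first exact: addr_ge0.
move=> z Dz x y; rewrite !big_cons opprD addrACA mulrDl; apply: le_trans (ler_normD _ _) _.
by apply: lerD; [exact: KF|exact: CF].
Qed.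

End UniformFamilies.

Definition semiconcave (R : realType) d (f : ('I_d -> R) -> R) := exists2 K : R, 0 <= K &
  forall x, exists l, forall h,
    f (fun i => x i + h i) <= f x + lin l h + K * \sum_i h i ^+ 2.

(** * Eigenvalue sums of a trigonometric matrix *)

Section TrigonometricMatrix.
Variables (R : realType) (d nu : nat).
Variables (A : 'I_nu -> 'I_nu -> seq ('I_d -> R)) (C : 'M[R[i]]_nu).
Variable H : ('I_d -> R) -> 'M[R[i]]_nu.
Hypothesis HE : forall x n m, H x n m = \sum_(c <- A n m) expi (lin c x) + C n m.
Variables (E : ('I_d -> R) -> 'I_nu -> R) (P : ('I_d -> R) -> 'I_nu -> 'M[R[i]]_nu).
Hypothesis EPH : forall x, spectral (E x) (P x) (H x).
Hypothesis Einc : forall x (n m : 'I_nu), (n <= m)%N -> E x n <= E x m.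

(** Contains every orthogonal projection; the bound on the entries makes the constants uniform over
    all test matrices. *)
Let D (Q : 'M[R[i]]_nu) := forall i j, cnorm (Q i j) <= 1.

Lemma Re_trace_trig Q x : complex.Re (\tr (Q *m H x)) =
  \sum_i \sum_j ((\sum_(c <- A j i) complex.Re (Q i j * expi (lin c x))) + complex.Re (Q i j * C j i)).
Proof.
rewrite Re_sum; apply: eq_bigr => i _; rewrite mxE Re_sum; apply: eq_bigr => j _.
by rewrite HE mulrDr ReD mulr_sumr Re_sum.
Qed.

Lemma trace_semiconcave : semiconcave_family D (fun Q x => complex.Re (\tr (Q *m H x))).
Proof.
have -> : (fun (Q : 'M[R[i]]_nu) x => complex.Re (\tr (Q *m H x))) =
    fun (Q : 'M[R[i]]_nu) x => \sum_i \sum_j ((\sum_(c <- A j i)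
      complex.Re (Q i j * expi (lin c x))) + complex.Re (Q i j * C j i)).
  by apply/funext => Q; apply/funext => x; rewrite Re_trace_trig.
apply: semiconcave_family_sum => i; apply: semiconcave_family_sum => j.
apply: semiconcave_familyD; last exact: semiconcave_family_cst.
apply: semiconcave_family_sum => c; exists (d%:R * \sum_i c i ^+ 2).
  by rewrite mulr_ge0 ?sumr_ge0 // => k _; exact: sqr_ge0.
by move=> Q DQ x; apply: expi_semiconcave; exact: DQ.
Qed.

Lemma trace_lipschitz : lipschitz_family D (fun Q x => complex.Re (\tr (Q *m H x))).
Proof.
have -> : (fun (Q : 'M[R[i]]_nu) x => complex.Re (\tr (Q *m H x))) =
    fun (Q : 'M[R[i]]_nu) x => \sum_i \sum_j ((\sum_(c <- A j i)
      complex.Re (Q i j * expi (lin c x))) + complex.Re (Q i j * C j i)).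
  by apply/funext => Q; apply/funext => x; rewrite Re_trace_trig.
apply: lipschitz_family_sum => i; apply: lipschitz_family_sum => j.
suff [K K0 KF] : lipschitz_family D (fun (Q : 'M[R[i]]_nu) x => \sum_(c <- A j i) complex.Re (Q i j * expi (lin c x))).
  by exists K => // Q DQ x y; rewrite opprD addrACA subrr addr0; exact: KF.
apply: lipschitz_family_sum => c; exists (2 * \sum_i `|c i|); first by rewrite mulr_ge0 // sumr_ge0.
move=> Q DQ x y; apply: le_trans (expi_lipschitz _ _ _ _) _.
by rewrite mulrA ler_piMl ?mulr_ge0 ?dist1_ge0 ?sumr_ge0.
Qed.

Lemma low_proj_D x k : D (low_proj (P x) k).
Proof.
by move=> i j; have [QQ QH] := low_proj_projection (EPH x) k; exact: projection_entry_le1.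
Qed.

(* Ky Fan, with the spectral projection at [x] as a test projection at [y]; equality at [y = x]. *)
Lemma eigsum_le k x y : (k <= nu)%N ->
  eigsum (E y) k <= complex.Re (\tr (low_proj (P x) k *m H y)).
Proof. by move=> kn; apply: ky_fan (Einc y). Qed.

(** The trace against the projection frozen at [x] lies above the eigenvalue sum and touches it at
    [x], so its supergradient at [x] is inherited. *)
Lemma eigsum_semiconcave k : (k <= nu)%N -> semiconcave (fun x => eigsum (E x) k).
Proof.
move=> kn; have [K K0 KT] := trace_semiconcave; exists K => // x.
have [l lP] := KT _ (low_proj_D x k) x; exists l => h.
apply: le_trans (eigsum_le x _ kn) _.
by rewrite -(trace_low_proj_mul (EPH x) k).
Qed.

Lemma eigsum_lipschitz k : (k <= nu)%N -> lipschitz_fun (fun x => eigsum (E x) k).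
Proof.
move=> kn; have [K K0 KT] := trace_lipschitz; exists K => //.
have half x y : eigsum (E x) k - eigsum (E y) k <= K * dist1 x y.
  rewrite -(trace_low_proj_mul (EPH y) k).
  have := KT _ (low_proj_D y k) x y; rewrite ler_norml => /andP[_].
  by apply: le_trans; rewrite lerD2r eigsum_le.
move=> x y; rewrite ler_norml half andbT lerNl opprB; apply: le_trans (half y x) _.
rewrite ler_wpM2l //; apply: ler_sum => i _; by rewrite distrC.
Qed.

Lemma H_lipschitz : exists2 K : R, 0 <= K &
  forall x y n m, cnorm (H x n m - H y n m) <= K * dist1 x y.
Proof.
pose K : R := \sum_n \sum_m \sum_(c <- A n m) 2 * \sum_i `|c i|.
have K2 n m : 0 <= \sum_(c <- A n m) 2 * \sum_i `|c i|.
  by apply: sumr_ge0 => c _; rewrite mulr_ge0 // sumr_ge0.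
have K1 n : 0 <= \sum_m \sum_(c <- A n m) 2 * \sum_i `|c i| by apply: sumr_ge0.
exists K; first exact: sumr_ge0.
move=> x y n m; rewrite !HE opprD addrACA subrr addr0 -sumrB.
apply: le_trans (ler_cnorm_sum _ _ _) _.
apply: (@le_trans _ _ ((\sum_(c <- A n m) 2 * \sum_i `|c i|) * dist1 x y)).
  rewrite mulr_suml; apply: ler_sum => c _; apply: le_trans (dist_expi _ _) _.
  by rewrite -mulrA ler_wpM2l // dist_lin.
rewrite ler_wpM2r ?dist1_ge0 // /K (bigD1 n) //= (bigD1 m) //= -addrA lerDl addr_ge0 ?sumr_ge0 //.
Qed.

Lemma E_bounded : exists2 K : R, 0 <= K & forall x n, `|E x n| <= K.
Proof.
pose K : R := \sum_i \sum_j ((size (A j i))%:R + cnorm (C j i)).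
have K0 i j : 0 <= (size (A j i))%:R + cnorm (C j i) :> R by rewrite addr_ge0 ?cnorm_ge0.
exists K; first by apply: sumr_ge0 => i _; apply: sumr_ge0.
move=> x n.
have -> : E x n = complex.Re (\tr (P x n *m H x)).
  by rewrite (spec_mulP (EPH x)) mxtraceZ (trace_spec _ (EPH x)) mulr1.
rewrite Re_trace_trig; apply: le_trans (ler_norm_sum _ _ _) _; apply: ler_sum => i _.
apply: le_trans (ler_norm_sum _ _ _) _; apply: ler_sum => j _.
have P1 : cnorm (P x n i j) <= 1.
  by apply: projection_entry_le1; [exact: (spec_idem (EPH x))|exact: (spec_herm (EPH x))].
apply: le_trans (ler_normD _ _) _; apply: lerD; last first.
  by apply: le_trans (Re_le_cnorm _) _; rewrite cnormM ler_piMl // cnorm_ge0.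
apply: le_trans (ler_norm_sum _ _ _) _.
rewrite -sum1_size natr_sum; apply: ler_sum => c _.
by apply: le_trans (Re_le_cnorm _) _; rewrite cnormM cnorm_expi mulr1.
Qed.

(** A single band need not be semiconcave; as a difference of two semiconcave functions it is still
    differentiable almost everywhere. *)
Lemma E_eigsum x (n : 'I_nu) : E x n = eigsum (E x) n.+1 - eigsum (E x) n.
Proof.
rewrite /eigsum (bigD1 n) ?ltnS //= [X in _ + X - _](_ : _ = \sum_(i < nu | (i < n)%N) E x i).
  by rewrite addrK.
by apply: eq_bigl => i; rewrite ltnS -val_eqE ltn_neqAle andbC.
Qed.

Lemma E_lipschitz n : lipschitz_fun (fun x => E x n).
Proof.
under eq_fun do rewrite E_eigsum -[- _]mulN1r.
apply: lipschitzD; first exact: eigsum_lipschitz.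
by apply: lipschitzZ; apply: eigsum_lipschitz; exact: ltnW.
Qed.

End TrigonometricMatrix.

(** * Perturbation of spectral projections *)

Section PerturbationLimit.
Variables (R : realType) (nu : nat).
Variables (E : 'I_nu -> R) (P : 'I_nu -> 'M[R[i]]_nu) (H : 'M[R[i]]_nu).
Variables (Ej : nat -> 'I_nu -> R) (Pj : nat -> 'I_nu -> 'M[R[i]]_nu) (Hj : nat -> 'M[R[i]]_nu).
Hypotheses (EPH : spectral E P H) (EPHj : forall j, spectral (Ej j) (Pj j) (Hj j)).
Variables (U : 'cV[R[i]]_nu) (Uj : nat -> 'cV[R[i]]_nu) (t : nat -> R) (lb : 'I_nu -> R).
Hypothesis cvgH : forall k l, cnorm (Hj j k l - H k l) @[j --> \oo] --> 0.
Hypothesis cvgU : forall k, cnorm (Uj j k 0 - U k 0) @[j --> \oo] --> 0.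
Hypothesis cvgE : forall n, Ej j n @[j --> \oo] --> E n.
Hypothesis cvgt : forall n, t j * (E n - Ej j n) @[j --> \oo] --> lb n.
Hypothesis lb_eq : forall n m, E n = E m -> lb n = lb m.

Definition phase (s : R) (F : 'I_nu -> R) (n : 'I_nu) : R[i] := expi (- (s * F n)).

Lemma vn_phase s F Q B x : spectral F Q B -> vn (spec_fun Q (phase s F) x) = vn x.
Proof.
move=> FQB; rewrite /vn (vnorm2_spec_fun FQB) [in RHS](vnorm2_resolution FQB).
by congr Num.sqrt; apply: eq_bigr => n _; rewrite cabs2_expi mul1r.
Qed.

Lemma cvg0_le (f g : nat -> R) : (forall j, `|f j| <= g j) ->
  g j @[j --> \oo] --> 0 -> f j @[j --> \oo] --> 0.
Proof.
move=> fg g0; apply/norm_cvg0P; apply: (@squeeze_cvgr _ _ _ _ (fun=> 0) g) => //.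
  by apply: nearW => j; rewrite normr_ge0 fg.
exact: cvg_cst.
Qed.

Lemma cvg0_sum (I : Type) (s : seq I) (f : I -> nat -> R) :
  (forall i, f i j @[j --> \oo] --> 0) -> \sum_(i <- s) f i j @[j --> \oo] --> 0.
Proof.
move=> f0; elim: s => [|i s IH].
  by under eq_fun do rewrite big_nil; exact: cvg_cst.
under eq_fun do rewrite big_cons.
by have := cvgD (f0 i) IH; rewrite addr0; exact.
Qed.

Lemma cvg_vnU : vn (Uj j - U) @[j --> \oo] --> 0.
Proof.
apply: (@cvg0_le _ (fun j => \sum_m cnorm (Uj j m 0 - U m 0))); last exact: cvg0_sum.
move=> j; rewrite ger0_norm ?vn_ge0 //; apply: le_trans (vn_le_sum _) _.
by apply: ler_sum => m _; rewrite !mxE.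
Qed.

(** Inserting [Hj j - H] between the two eigenvectors produces the factor [Ej j m - E n], which
    stays away from zero, while [Hj j - H] tends to zero. *)
Lemma perturbation_dot_cvg0 n m : E n != E m ->
  cnorm (dot (P n *m U) (Pj j m *m U)) @[j --> \oo] --> 0.
Proof.
move=> Enm.
pose g j := (\sum_k \sum_l cnorm ((Hj j - H) k l)) * (vn U * vn U).
have g0 : g j @[j --> \oo] --> 0.
  rewrite -[X in _ --> X](mul0r (vn U * vn U)); apply: cvgM; last exact: cvg_cst.
  apply: cvg0_sum => k; apply: cvg0_sum => l.
  by under eq_fun do rewrite !mxE; exact: cvgH.
have key j : `|Ej j m - E n| * cnorm (dot (P n *m U) (Pj j m *m U)) <= g j.
  rewrite -cnormr -cnormM.
  have -> : (Ej j m - E n)%:C%C * dot (P n *m U) (Pj j m *m U) =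
      dot (P n *m U) ((Hj j - H) *m (Pj j m *m U)).
    rewrite mulmxBl dotBr [Hj j *m _]mulmxA (spec_Pmul (EPHj j)) -scalemxAl dotZr.
    rewrite rmorphB mulrBl; congr (_ - _).
    have HH : adjmx H = H.
      rewrite (spec_dec EPH) adjmx_sum; apply: eq_bigr => k _; rewrite adjmxZ (spec_herm EPH).
      by congr (_ *: _); apply: complex_inj; rewrite ?Re_conj ?Im_conj /= ?oppr0.
    rewrite -{1}HH -dot_adj mulmxA (spec_Pmul EPH) -scalemxAl dotZl; congr (_ * _).
    by apply: complex_inj; rewrite ?Re_conj ?Im_conj /= ?oppr0.
  apply: le_trans (cnorm_dot_mx _ _ _) _; apply: ler_wpM2l.
    by apply: sumr_ge0 => k _; apply: sumr_ge0 => l _; exact: cnorm_ge0.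
  by rewrite ler_pM ?vn_ge0 ?(vnP_le EPH) ?(vnP_le (EPHj j)).
(* Half the gap: once [Ej j m] is within [e] of [E m], its distance to [E n] exceeds [e]. *)
pose e : R := `|E m - E n| / 2.
have e0 : 0 < e by rewrite divr_gt0 // normr_gt0 subr_eq0 eq_sym.
have eE : `|E m - E n| = 2 * e by rewrite /e; field.
have ev : \forall j \near \oo, `|E m - Ej j m| < e.
  by have /cvgrPdist_lt := @cvgE m; apply.
apply/norm_cvg0P; apply: (@squeeze_cvgr _ _ _ _ (fun=> 0) (fun j => e^-1 * g j)).
- near=> j; rewrite normr_ge0 /= ger0_norm ?cnorm_ge0 // -ler_pdivrMl ?invr_gt0 // invrK.
  apply: le_trans (key j); apply: ler_wpM2r; first exact: cnorm_ge0.
  have : `|E m - Ej j m| < e by near: j; exact: ev.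
  have := ler_normD (E m - Ej j m) (Ej j m - E n).
  rewrite addrA subrK eE; lra.
- exact: cvg_cst.
- by rewrite -[X in _ --> X](mulr0 e^-1); apply: cvgM => //; exact: cvg_cst.
Unshelve. all: by end_near.
Qed.

(** Expand in pairs [(n, m)]. If [E n != E m] the overlap vanishes. If they are equal, the phase
    [t j * (E n - Ej j m)] tends to [lb m = lb n], whatever the individual projections inside the
    cluster do; summing over [m] then restores the identity. *)
Lemma perturbation_limit :
  cnorm (dot (spec_fun P (phase (t j) E) U) (spec_fun (Pj j) (phase (t j) (Ej j)) (Uj j))
     - \sum_n expi (lb n) * (vnorm2 (P n *m U))%:C%C) @[j --> \oo] --> 0.
Proof.
pose F j := spec_fun P (phase (t j) E) U.
(* The limiting phase is subtracted before the sum over [m], so that the subtracted part adds up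
   through [\sum_m Pj j m = 1]. *)
pose term j n m := (expi (t j * (E n - Ej j m)) - expi (lb n)) * dot (P n *m U) (Pj j m *m U).
have split_dot j : dot (F j) (spec_fun (Pj j) (phase (t j) (Ej j)) (Uj j))
     - \sum_n expi (lb n) * (vnorm2 (P n *m U))%:C%C =
   dot (F j) (spec_fun (Pj j) (phase (t j) (Ej j)) (Uj j - U)) + \sum_n \sum_m term j n m.
  have -> : spec_fun (Pj j) (phase (t j) (Ej j)) (Uj j - U) =
      spec_fun (Pj j) (phase (t j) (Ej j)) (Uj j) - spec_fun (Pj j) (phase (t j) (Ej j)) U.
    by rewrite -sumrB; apply: eq_bigr => n _; rewrite mulmxBr scalerBr.
  rewrite dotBr -addrA; congr (_ + _).
  have -> : \sum_n \sum_m term j n m =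
     dot (F j) (spec_fun (Pj j) (phase (t j) (Ej j)) U) -
       \sum_n expi (lb n) * dot (P n *m U) U.
    rewrite /F dot_suml -sumrB; apply: eq_bigr => n _.
    rewrite dotZl [spec_fun (Pj j) _ _]/spec_fun dot_sumr mulr_sumr [X in _ - _ * dot _ X](spec_resolution (EPHj j) U) dot_sumr mulr_sumr -sumrB.
    apply: eq_bigr => m _; rewrite dotZr /term mulrBl; congr (_ - _).
    rewrite mulrA; congr (_ * _); rewrite /phase -expiN -expiD; congr expi; ring.
  rewrite addrA addNr add0r; congr (- _); apply: eq_bigr => n _; congr (_ * _).
  by rewrite (dotP EPH) dotxx.
under eq_fun do rewrite split_dot.
apply: (@cvg0_le _ (fun j => nu%:R * (vn U * vn (Uj j - U)) + \sum_n \sum_m cnorm (term j n m))).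
  move=> j; rewrite ger0_norm ?cnorm_ge0 //; apply: le_trans (ler_cnormD _ _) _; apply: lerD.
    by apply: le_trans (cnorm_dot _ _) _; rewrite (vn_phase _ _ EPH) (vn_phase _ _ (EPHj j)).
  apply: le_trans (ler_cnorm_sum _ _ _) _; apply: ler_sum => n _; exact: ler_cnorm_sum.
rewrite -[X in _ --> X]addr0; apply: cvgD.
  rewrite -[X in _ --> X](mulr0 nu%:R) -[X in _ * X](mulr0 (vn U)).
  by do 2!(apply: cvgM; first exact: cvg_cst); exact: cvg_vnU.
apply: cvg0_sum => n; apply: cvg0_sum => m.
have [Enm|Enm] := eqVneq (E n) (E m).
  apply: (@cvg0_le _ (fun j => 2 * `|t j * (E m - Ej j m) - lb m| * (nu%:R * (vn U * vn U)))).
    move=> j; rewrite ger0_norm ?cnorm_ge0 // /term cnormM Enm (lb_eq Enm).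
    apply: ler_pM; rewrite ?cnorm_ge0 ?dist_expi //.
    apply: le_trans (cnorm_dot _ _) _; apply: ler_wpM2l => //.
    by rewrite ler_pM ?vn_ge0 ?(vnP_le EPH) ?(vnP_le (EPHj j)).
  rewrite -[X in _ --> X](mul0r (nu%:R * (vn U * vn U))); apply: cvgM; last exact: cvg_cst.
  rewrite -[X in _ --> X](mulr0 2); apply: cvgM; first exact: cvg_cst.
  by apply/norm_cvg0P/subr_cvg0; exact: cvgt.
apply: (@cvg0_le _ (fun j => 2 * cnorm (dot (P n *m U) (Pj j m *m U)))).
  move=> j; rewrite ger0_norm ?cnorm_ge0 // /term cnormM; apply: ler_wpM2r; first exact: cnorm_ge0.
  by apply: le_trans (ler_cnormD _ _) _; rewrite cnormN !cnorm_expi.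
by rewrite -[X in _ --> X](mulr0 2); apply: cvgM; [exact: cvg_cst|exact: perturbation_dot_cvg0].
Qed.

End PerturbationLimit.

(** * Almost everywhere differentiability of semiconcave functions *)

Section DirectionalDerivatives.
Variables (R : realType) (d : nat).
Implicit Types (f : ('I_d -> R) -> R) (x g h v : 'I_d -> R).

Definition axis (i : 'I_d) (s : R) : 'I_d -> R := fun j => if j == i then s else 0.
Definition shift x v (s : R) : 'I_d -> R := fun j => x j + s * v j.

(** Differentiability along lines: the radius may depend on the direction [v], but the derivative is
    linear in [v]. It matches the use, where the base point moves by [- (t j)^-1] along one fixed
    direction. *)
Definition dir_differentiable f x g := forall v (e : R), 0 < e ->
  exists2 r : R, 0 < r & forall s, `|s| < r ->
    `|f (shift x v s) - f x - s * lin g v| <= e * `|s|.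

Lemma lin_axis g i s : lin g (axis i s) = g i * s.
Proof.
rewrite /lin (bigD1 i) //= /axis eqxx big1 ?addr0 // => j ji.
by rewrite (negbTE ji) mulr0.
Qed.

Lemma axis_sqr i (s : R) : \sum_j axis i s j ^+ 2 = s ^+ 2.
Proof.
rewrite (bigD1 i) //= /axis eqxx big1 ?addr0 // => j ji.
by rewrite (negbTE ji) expr0n.
Qed.

Lemma shift_axis x i s : shift x (axis i 1) s = fun j => x j + axis i s j.
Proof. by apply/funext => j; rewrite /shift /axis; case: eqP; rewrite ?mulr1 ?mulr0. Qed.

Lemma shift0 x v : shift x v 0 = x.
Proof. by apply/funext => j; rewrite /shift mul0r addr0. Qed.

Lemma dir_differentiableB f1 f2 x g1 g2 :
  dir_differentiable f1 x g1 -> dir_differentiable f2 x g2 ->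
  dir_differentiable (fun y => f1 y - f2 y) x (fun i => g1 i - g2 i).
Proof.
move=> D1 D2 v e e0; have e20 : 0 < e / 2 by rewrite divr_gt0.
have [r1 r10 H1] := D1 v _ e20; have [r2 r20 H2] := D2 v _ e20.
exists (Num.min r1 r2); first by rewrite lt_min r10.
move=> s; rewrite lt_min => /andP[/H1 h1 /H2 h2].
have -> : lin (fun i => g1 i - g2 i) v = lin g1 v - lin g2 v.
  by rewrite -sumrB; apply: eq_bigr => i _; rewrite mulrBl.
have -> : f1 (shift x v s) - f2 (shift x v s) - (f1 x - f2 x) - s * (lin g1 v - lin g2 v) =
  (f1 (shift x v s) - f1 x - s * lin g1 v) - (f2 (shift x v s) - f2 x - s * lin g2 v) by ring.
apply: le_trans (ler_normB _ _) _.
by rewrite [e]splitr mulrDl; apply: lerD.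
Qed.

Lemma dir_differentiable_cvg f x g v (t : nat -> R) : dir_differentiable f x g ->
  t j @[j --> \oo] --> +oo ->
  t j * (f x - f (shift x v (- (t j)^-1))) @[j --> \oo] --> lin g v.
Proof.
move=> D tj; apply/cvgrPdist_le => e e0.
have [r r0 H] := D v _ e0.
near=> j.
have t0 : 0 < t j by near: j; move/cvgryPgt : tj; exact.
have tr : `|- (t j)^-1| < r.
  rewrite normrN gtr0_norm ?invr_gt0 // -[r]invrK ltf_pV2 ?posrE ?invr_gt0 //.
  by near: j; move/cvgryPgt : tj; exact.
have := H _ tr; rewrite normrN (@gtr0_norm _ (t j)^-1) ?invr_gt0 // => {}H.
have -> : lin g v - t j * (f x - f (shift x v (- (t j)^-1))) =
   t j * (f (shift x v (- (t j)^-1)) - f x - (- (t j)^-1) * lin g v).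
  by field; rewrite gt_eqF.
rewrite normrM (gtr0_norm t0) -ler_pdivlMl // [leRHS]mulrC; exact: H.
Unshelve. all: by end_near.
Qed.

Lemma dir_differentiable_derive1 f x g i : dir_differentiable f x g ->
  derive1 (fun s : R => f (fun j => x j + (if j == i then s else 0))) 0 = g i.
Proof.
move=> D; rewrite /derive1; apply/cvg_lim => //.
apply/cvgrPdist_le => e e0; have [r r0 H] := D (axis i 1) _ e0.
near=> h; rewrite /= addr0.
have h0 : h != 0 by near: h; exact: nbhs_dnbhs_neq.
have hr : `|h| < r.
  near: h; apply: nbhs_dnbhs; exists r => // y /=; by rewrite sub0r normrN.
have := H _ hr; rewrite lin_axis mulr1 shift_axis.
have -> : (fun j => x j + (if j == i then 0 else 0)) = x.
  by apply/funext => j; rewrite if_same addr0.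
rewrite -/(axis i h) => {}H.
have -> : g i - h^-1 *: (f (fun j => x j + axis i h j) - f x) =
    - (h^-1 * (f (fun j => x j + axis i h j) - f x - h * g i)).
  by rewrite /GRing.scale /=; field.
rewrite normrN normrM normfV ler_pdivrMl ?normr_gt0 // [leRHS]mulrC; exact: H.
Unshelve. all: by end_near.
Qed.

Lemma dir_differentiable_extremum f x g v : dir_differentiable f x g ->
  (forall y, f x <= f y) -> lin g v = 0.
Proof.
move=> D fmin; have half (u : 'I_d -> R) : 0 <= lin g u.
  rewrite leNgt; apply/negP => l0; have e0 : 0 < - lin g u / 2 by rewrite divr_gt0 // oppr_gt0.
  have [r r0 H] := D u _ e0; have r2 : 0 < r / 2 by rewrite divr_gt0.
  have := H (r / 2); rewrite gtr0_norm // ltr_pdivrMr // ltr_pMr // ltr1n => /(_ isT).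
  rewrite ler_norml => /andP[_]; have := fmin (shift x u (r / 2)); nra.
apply/eqP; rewrite eq_le half andbT; have := half (fun i => - v i).
by rewrite /lin; under eq_bigr do rewrite mulrN; rewrite sumrN oppr_ge0.
Qed.

End DirectionalDerivatives.

(** * A pointwise criterion for differentiability of semiconcave functions *)

Section SemiconcaveFunctions.
Variables (R : realType) (d : nat) (f : ('I_d -> R) -> R) (K : R).
Hypothesis K0 : 0 <= K.
Hypothesis fK : forall x, exists l, forall h,
  f (fun i => x i + h i) <= f x + lin l h + K * \sum_i h i ^+ 2.
Implicit Types (x v : 'I_d -> R) (i : 'I_d) (s : R).

(** Backward minus forward difference quotient; the correction [2 * K * s] makes it nonnegative when
    [f] is semiconcave. *)
Definition second_diff i s x : R :=
  (2 * f x - f (shift x (axis i 1) s) - f (shift x (axis i 1) (- s))) / s + 2 * K * s.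

(** Difference quotients decrease in the step up to the error [K * (s - s')]. The supergradient at
    the intermediate point is tested against both ends; weighting the two inequalities by [s'] and
    [s - s'] eliminates it. *)
Lemma semiconcave_slope x v s s' : 0 < s' -> s' <= s -> \sum_i v i ^+ 2 = 1 ->
  (f (shift x v s) - f x) / s - K * (s - s') <= (f (shift x v s') - f x) / s'.
Proof.
move=> s'0 s's v1; have s0 : 0 < s := lt_le_trans s'0 s's.
have [l lP] := fK (shift x v s').
have H r : f (shift x v (s' + r)) <= f (shift x v s') + r * lin l v + K * r ^+ 2.
  have := lP (fun i => r * v i); rewrite linZr.
  have -> : (fun i => shift x v s' i + r * v i) = shift x v (s' + r).
    by apply/funext => j; rewrite /shift mulrDl addrA.
  by under eq_bigr do rewrite exprMn; rewrite -mulr_sumr v1 mulr1.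
have := H (- s'); rewrite subrr shift0 sqrrN.
have := H (s - s'); rewrite addrC subrK.
set A := f (shift x v s); set B := f (shift x v s'); set C := lin l v; set D := f x => h1 h2.
rewrite ler_pdivlMr // mulrBl [_ / s * s']mulrAC lerBlDr ler_pdivrMr //.
have h1' := ler_wpM2l (ltW s'0) h1.
have ss0 : 0 <= s - s' by rewrite subr_ge0.
have h2' := ler_wpM2l ss0 h2.
nra.
Qed.

Lemma shift_neg_axis x i s : shift x (fun j => - axis i 1 j) s = shift x (axis i 1) (- s).
Proof. by apply/funext => j; rewrite /shift mulrN mulNr. Qed.

Lemma neg_axis_sqr i : \sum_j (- axis i 1 j) ^+ 2 = 1 :> R.
Proof. by under eq_bigr do rewrite sqrrN; rewrite axis_sqr expr1n. Qed.

Lemma semiconcave_super x : exists l, forall i s,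
  f (shift x (axis i 1) s) <= f x + l i * s + K * s ^+ 2.
Proof.
have [l lP] := fK x; exists l => i s; have := lP (axis i s).
by rewrite lin_axis axis_sqr shift_axis.
Qed.

Lemma second_diff_ge0 i s x : 0 < s -> 0 <= second_diff i s x.
Proof.
move=> s0; have [l lP] := semiconcave_super x.
have := lP i s; have := lP i (- s); rewrite sqrrN mulrN /second_diff.
set A := f _; set B := f (shift _ _ s); set C := f x => h1 h2.
have -> : (2 * C - B - A) / s + 2 * K * s = (2 * C - B - A + 2 * K * s ^+ 2) / s.
  by field; rewrite gt_eqF.
by apply: divr_ge0; [lra|exact: ltW].
Qed.

(** One step with a small value is enough: slope monotonicity propagates the bound to all shorter
    steps. *)
Definition good_point x := forall i (e : R), 0 < e -> exists2 s, 0 < s & second_diff i s x < e.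

(** The supergradient [l] is the candidate and gives the upper bound. For the lower bound, the slope
    at a shorter step [u] is at least the slope at [s] minus [K * (s - u)], and a small
    [second_diff] keeps the slope at [s] from falling below [l] by more than [e]. The correction
    [2 * K * s] absorbs both quadratic errors. *)
Lemma good_partial x : good_point x -> exists l, forall i (e : R), 0 < e ->
  exists2 r : R, 0 < r & forall s, `|s| < r ->
    `|f (shift x (axis i 1) s) - f x - s * l i| <= e * `|s|.
Proof.
move=> gx; have [l lP] := semiconcave_super x; exists l => i e e0.
have [s s0 qs] := gx i e e0.
(* The second bound on the radius serves the upper estimate: it makes [K * u ^+ 2] at most
   [e * |u|]. *)
have rpos : 0 < Num.min s (e / (K + 1)).
  by rewrite lt_min s0 divr_gt0 // ltr_wpDl.
exists (Num.min s (e / (K + 1))) => // u; rewrite lt_min => /andP[us].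
rewrite ltr_pdivlMr ?ltr_wpDl // => uK.
have [->|u0] := eqVneq u 0; first by rewrite shift0 subrr mul0r subrr normr0 mulr0.
have lps := lP i s; have lms := lP i (- s); rewrite sqrrN mulrN in lms.
have slP := @semiconcave_slope x (axis i 1) s.
have slN := @semiconcave_slope x (fun j => - axis i 1 j) s.
move: qs lps lms; rewrite /second_diff.
have b1 : \sum_j (axis i 1 j) ^+ 2 = 1 :> R by rewrite axis_sqr expr1n.
set A := f (shift x (axis i 1) s); set B := f (shift x (axis i 1) (- s)); set C := f x.
move=> qs lps lms.
have qs' : 2 * C - A - B + 2 * K * s ^+ 2 < e * s.
  rewrite -ltr_pdivrMr //.
  by have -> : (2 * C - A - B + 2 * K * s ^+ 2) / s = (2 * C - A - B) / s + 2 * K * s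
    by field; rewrite gt_eqF.
have [ugt|ule] := ltP 0 u.
  have uleq : u <= s by rewrite ltW // -(gtr0_norm ugt).
  have := slP u ugt uleq b1.
  rewrite -/A -/C ler_pdivlMr // mulrBl mulrAC lerBlDr ler_pdivrMr //.
  have := lP i u; set X := f _ => hX hS; rewrite -/C in hX.
  rewrite (gtr0_norm ugt) in us uK *.
  have h5 : u * (u * (K + 1)) <= u * e by rewrite ler_wpM2l ?ltW.
  have h6 : u * (C + l i * s + K * s ^+ 2 - e * s) <= u * A by rewrite ler_wpM2l ?ltW //; lra.
  have h7 : 0 <= K * (u ^+ 2 * s) by rewrite mulr_ge0 // mulr_ge0 ?sqr_ge0 // ltW.
  have h8 := sqr_ge0 u.
  rewrite ler_norml; apply/andP; split; last by lra.
  have : s * (X - C - u * l i) >= - (s * (e * u)) by lra.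
  by rewrite -mulrN ler_pM2l.
have ult : u < 0 by rewrite lt_neqAle u0.
have vgt : 0 < - u by rewrite oppr_gt0.
have uleq : - u <= s by rewrite ltW // -(ltr0_norm ult).
have := slN (- u) vgt uleq (neg_axis_sqr i).
rewrite !shift_neg_axis opprK -/B -/C ler_pdivlMr // mulrBl mulrAC lerBlDr ler_pdivrMr //.
have := lP i u; set X := f _ => hX hS; rewrite -/C in hX.
rewrite (ltr0_norm ult) in us uK *.
have h5 : - u * (- u * (K + 1)) <= - u * e by rewrite ler_wpM2l ?ltW.
have h6 : - u * (C - l i * s + K * s ^+ 2 - e * s) <= - u * B by rewrite ler_wpM2l ?ltW //; lra.
have h7 : 0 <= K * (u ^+ 2 * s) by rewrite mulr_ge0 // mulr_ge0 ?sqr_ge0 // ltW.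
have h8 := sqr_ge0 u.
rewrite ler_norml; apply/andP; split; last by lra.
have : s * (X - C - u * l i) >= - (s * (e * - u)) by lra.
by rewrite -mulrN ler_pM2l.
Qed.

(** The upper bound is semiconcavity at [x], whose supergradient must agree with the partial
    derivatives. For the lower bound, semiconcavity at [shift x v s] is applied towards the [d] axis
    points [x + s * d * v_i e_i], whose mean is that very point; averaging cancels the unknown
    supergradient there. *)
Lemma good_dir_differentiable x : good_point x -> exists g, dir_differentiable f x g.
Proof.
move=> /good_partial[g gP]; have [l lP] := fK x.
have [d0|dpos] := posnP d.
  exists g => v e e0; exists 1 => // s _.
  have -> : shift x v s = x by apply/funext => -[m lt]; exfalso; rewrite d0 in lt.
  have -> : lin g v = 0 by apply: big1 => -[m lt]; exfalso; rewrite d0 in lt.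
  by rewrite subrr mulr0 subrr normr0 mulr_ge0 // ltW.
have lg : l = g.
  apply/funext => i; apply/eqP; rewrite -subr_eq0 -normr_eq0 eq_le normr_ge0 andbT.
  apply/ler_addgt0Pr => e e0; rewrite add0r.
  have [r r0 H] := gP i _ (divr_gt0 e0 (ltr0n R 2)).
  pose s := Num.min (r / 2) (e / (2 * (K + 1))).
  have K1 : 0 < K + 1 by rewrite ltr_wpDl.
  have s0 : 0 < s by rewrite lt_min !divr_gt0 // mulr_gt0.
  have sr : s < r by rewrite gt_min ltr_pdivrMr // ltr_pMr // ltr1n.
  have sK : K * s <= e / 2.
    have : s <= e / (2 * (K + 1)) by rewrite ge_min lexx orbT.
    rewrite ler_pdivlMr ?mulr_gt0 // => h; nra.
  have := H s; have := H (- s); rewrite normrN gtr0_norm // => /(_ sr) h1 /(_ sr) h2.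
  have := lP (axis i s); have := lP (axis i (- s)).
  rewrite !lin_axis !axis_sqr -!shift_axis sqrrN.
  move: h1 h2; rewrite !ler_norml => /andP[a1 a2] /andP[b1 b2] c1 c2.
  have u1 : s * (l i - g i) <= s * e by nra.
  have u2 : s * (g i - l i) <= s * e by nra.
  rewrite ler_pM2l // in u1; rewrite ler_pM2l // in u2.
  by rewrite u1 andbT; lra.
exists g => v e e0.
(* Sum of squared distances from [v] to the axis vectors [d * v_i e_i], which governs the quadratic
   error of the averaging. *)
pose B := \sum_i \sum_j (d%:R * axis i (v i) j - v j) ^+ 2.
pose V := \sum_i `|v i|.
have B0 : 0 <= B by apply: sumr_ge0 => i _; apply: sumr_ge0 => j _; exact: sqr_ge0.
have V0 : 0 <= V by apply: sumr_ge0.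
have dR : 0 < d%:R :> R by rewrite ltr0n.
pose e1 := e / (2 * (V + 1)).
have V1 : 0 < V + 1 by rewrite ltr_wpDl.
have e10 : 0 < e1 by rewrite divr_gt0 // mulr_gt0.
have [r rP] : exists r : 'I_d -> R, forall i, 0 < r i /\ forall s, `|s| < r i ->
    `|f (shift x (axis i 1) s) - f x - s * g i| <= e1 * `|s|.
  have ex i : exists r : R, 0 < r /\ forall s, `|s| < r ->
    `|f (shift x (axis i 1) s) - f x - s * g i| <= e1 * `|s|.
    by have [r r0 H] := gP i _ e10; exists r.
  by have [r rP] := choice ex; exists r.
pose r0 := \big[Num.min/1]_i (r i / (d%:R * (V + 1))).
have r00 : 0 < r0.
  rewrite /r0; elim/big_rec: _ => [|i y _ y0]; first exact: ltr01.
  by rewrite lt_min y0 andbT divr_gt0 ?mulr_gt0 //; have [] := rP i.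
have r0i i : r0 <= r i / (d%:R * (V + 1)) by rewrite /r0 (bigD1 i) //= ge_min lexx.
pose W := \sum_i v i ^+ 2.
have W0 : 0 <= W by apply: sumr_ge0 => j _; exact: sqr_ge0.
(* Collects the quadratic errors of the lower bound ([B]) and of the upper bound ([W]); the summand
   1 keeps it positive. *)
pose Q := K * (B + W) + 1.
have Q0 : 0 < Q by rewrite ltr_wpDl // mulr_ge0 // addr_ge0.
exists (Num.min r0 (e / (2 * Q))); first by rewrite lt_min r00 divr_gt0 // mulr_gt0.
move=> s; rewrite lt_min => /andP[sr0]; rewrite ltr_pdivlMr ?mulr_gt0 // => sQ.
have ss : s ^+ 2 = `|s| * `|s| by rewrite -expr2 real_normK // num_real.
have vV i : `|v i| <= V by rewrite /V (bigD1 i) //= lerDl sumr_ge0.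
have sv i : `|s * (d%:R * v i)| < r i.
  rewrite !normrM (gtr0_norm dR).
  apply: (@le_lt_trans _ _ (`|s| * (d%:R * (V + 1)))).
    rewrite !ler_wpM2l // ?ler0n //; apply: le_trans (vV i) _; by rewrite lerDl.
  by rewrite -ltr_pdivlMr ?mulr_gt0 //; apply: lt_le_trans sr0 _.
rewrite ler_norml; apply/andP; split; last first.
  have := lP (fun i => s * v i); rewrite linZr -/(shift x v s) lg.
  under eq_bigr do rewrite exprMn; rewrite -mulr_sumr -/W.
  move=> h; rewrite ss in h.
  have : K * (`|s| * `|s| * W) <= e * `|s|.
    have := normr_ge0 s => n0.
    have : `|s| * (K * W) <= e / 2 by rewrite /Q in sQ; have := mulr_ge0 K0 B0; nra.
    by move=> h3; nra.
  lra.
have [l' l'P] := fK (shift x v s).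
(* Displacement from [shift x v s] to the [i]-th axis point; these displacements add up to zero. *)
pose hh i := fun j => s * (d%:R * axis i (v i) j - v j).
have hsum : \sum_i lin l' (hh i) = 0.
  under eq_bigr do rewrite linZr.
  rewrite -mulr_sumr exchange_big /=.
  under eq_bigr => j _.
    rewrite -mulr_sumr sumrB sumr_const card_ord (bigD1 j) //= big1 => [|i ij].
      rewrite /axis eqxx addr0 mulr_natl subrr mulr0; over.
    by rewrite /axis eq_sym (negbTE ij) mulr0.
  by rewrite big1 ?mulr0.
have hsq : \sum_i \sum_j hh i j ^+ 2 = s ^+ 2 * B.
  rewrite mulr_sumr; apply: eq_bigr => i _; rewrite mulr_sumr; apply: eq_bigr => j _.
  by rewrite exprMn.
have hpt i : f (shift x (axis i 1) (s * (d%:R * v i))) <=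
    f (shift x v s) + lin l' (hh i) + K * \sum_j hh i j ^+ 2.
  have := l'P (hh i); congr (f _ <= _); apply/funext => j; rewrite /shift /hh /axis.
  by case: (j == i); ring.
have lowi i : f x + s * (d%:R * v i) * g i - e1 * `|s * (d%:R * v i)| <=
    f (shift x (axis i 1) (s * (d%:R * v i))).
  have [_ /(_ _ (sv i))] := rP i; rewrite ler_norml => /andP[+ _]; lra.
have : \sum_(i < d) (f x + s * (d%:R * v i) * g i - e1 * `|s * (d%:R * v i)|) <=
   \sum_(i < d) (f (shift x v s) + lin l' (hh i) + K * \sum_j hh i j ^+ 2).
  by apply: ler_sum => i _; apply: le_trans (lowi i) (hpt i).
rewrite sumrB !big_split /= hsum addr0 !sumr_const card_ord.
have -> : \sum_(i < d) K * (\sum_j hh i j ^+ 2) = K * (s ^+ 2 * B) by rewrite -mulr_sumr hsq.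
have -> : \sum_(i < d) s * (d%:R * v i) * g i = d%:R * (s * lin g v).
  by rewrite /lin !mulr_sumr; apply: eq_bigr => i _; ring.
have -> : \sum_(i < d) e1 * `|s * (d%:R * v i)| = d%:R * (e1 * `|s| * V).
  by rewrite /V !mulr_sumr; apply: eq_bigr => i _; rewrite !normrM (gtr0_norm dR); ring.
rewrite -[f x *+ d]mulr_natl -[f (shift x v s) *+ d]mulr_natl => H.
have KB : K * (s ^+ 2 * B) <= d%:R * (K * (s ^+ 2 * B)).
  by rewrite ler_peMl ?ler1n // mulr_ge0 // mulr_ge0 // sqr_ge0.
have H2 : d%:R * (f x + s * lin g v - e1 * `|s| * V) <=
    d%:R * (f (shift x v s) + K * (s ^+ 2 * B)) by lra.
rewrite ler_pM2l // in H2.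
have h3 : K * (s ^+ 2 * B) <= e / 2 * `|s|.
  rewrite ss; have n0 := normr_ge0 s.
  have : `|s| * (K * B) <= e / 2 by rewrite /Q in sQ; have := mulr_ge0 K0 W0; nra.
  by move=> h3; nra.
have h4 : e1 * `|s| * V <= e / 2 * `|s|.
  have : e1 * V <= e / 2.
    rewrite /e1 mulrAC ler_pdivrMr ?mulr_gt0 //; nra.
  by have := normr_ge0 s; nra.
lra.
Qed.

End SemiconcaveFunctions.

(** * Almost every point satisfies the criterion *)

Section AlmostEverywhere.
Variables (R : realType) (d : nat).
Variable lam : {measure set (d.-tuple R) -> \bar R}.
Hypothesis Hlam : is_lebesgue_measure lam.
Variables (f : ('I_d -> R) -> R) (K C : R).
Hypotheses (K0 : 0 <= K) (C0 : 0 <= C).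
Hypothesis fK : forall x, exists l, forall h,
  f (fun i => x i + h i) <= f x + lin l h + K * \sum_i h i ^+ 2.
Hypothesis fC : forall x y, `|f x - f y| <= C * dist1 x y.
Local Notation T := (@torus R d).

Definition upd (x : 'I_d -> R) i r : 'I_d -> R := fun j => if j == i then r else x j.

Lemma shift_upd x i r s : shift (upd x i r) (axis i 1) s = upd x i (r + s).
Proof.
by apply/funext => j; rewrite /shift /axis /upd; case: eqP; rewrite ?mulr1 // mulr0 addr0.
Qed.

Lemma dist1_upd x i r s : dist1 (upd x i r) (upd x i s) = `|r - s|.
Proof.
rewrite /dist1 (bigD1 i) //= /upd eqxx big1 ?addr0 // => j ji.
by rewrite (negbTE ji) subrr normr0.
Qed.

(** Replacing one coordinate by a fresh value leaves the average unchanged: the map [sw], which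
    exchanges the old and the fresh value, is an involution. This isolates one axis of a grid
    sum. *)
Lemma sum_resample (I J : finType) (i : I) (F : {ffun I -> J} -> R) :
  \sum_(j : {ffun I -> J}) \sum_(k : J) F [ffun l => if l == i then k else j l] =
  #|J|%:R * \sum_(j : {ffun I -> J}) F j.
Proof.
pose sw (p : {ffun I -> J} * J) : {ffun I -> J} * J :=
  ([ffun l => if l == i then p.2 else p.1 l], p.1 i).
have swK : involutive sw.
  move=> [j k]; rewrite /sw /=; congr pair; last by rewrite ffunE eqxx.
  by apply/ffunP => l; rewrite !ffunE; case: eqP => [->|//].
rewrite pair_big /= (reindex sw) /=; last by apply: onW_bij; exact: inv_bij.
rewrite mulr_natl -sumr_const exchange_big pair_big /= [RHS](reindex (fun p => (p.1, p.2))) /=; last first.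
  by exists (fun p => (p.1, p.2)) => -[].
apply: eq_bigr => -[j k] _ /=; congr F; apply/ffunP => l; rewrite !ffunE.
by case: eqP => [->|//].
Qed.

(** Both sides equal [S (n + p) - S n - S p] for the partial sums [S] of [a]; only [p] boundary
    differences remain, however large [n] is. *)
Lemma sum_shift_diff (a : nat -> R) n p :
  \sum_(k < n) (a (k + p)%N - a k) = \sum_(k < p) (a (n + k)%N - a k).
Proof.
elim: p => [|p IH].
  by rewrite [RHS]big_ord0 big1 // => k _; rewrite addn0 subrr.
rewrite [RHS]big_ord_recr -IH /= -[LHS](subrK (\sum_(k < n) (a (k + p)%N - a k))) addrC.
congr (_ + _); rewrite -sumrB.
have := @telescope_sumr R 0 n (fun k => a (k + p)%N) (leq0n n); rewrite big_mkord => <-.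
by apply: eq_bigr => k _; rewrite opprB addrA subrK addnS addSn.
Qed.

(* The left-hand side telescopes up to boundary terms. *)
Lemma second_diff_sum (g : R -> R) (n p : nat) (s : R) :
  (forall u v, `|g u - g v| <= C * `|u - v|) -> 0 <= s -> s = p%:R / n.+1%:R ->
  \sum_(k < n.+1) (2 * g (k%:R / n.+1%:R) - g (k%:R / n.+1%:R + s) - g (k%:R / n.+1%:R - s))
    <= p%:R * (2 * C * s).
Proof.
move=> gC s0 sE; have n0 : n.+1%:R != 0 :> R by rewrite pnatr_eq0.
pose a k := g (k%:R / n.+1%:R); pose b k := g (k%:R / n.+1%:R - s).
have aS k : g (k%:R / n.+1%:R + s) = a (k + p)%N by rewrite /a natrD mulrDl sE.
have bS k : a k = b (k + p)%N by rewrite /b natrD mulrDl sE addrK.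
rewrite (eq_bigr (fun k : 'I_n.+1 => (b (k + p)%N - b k) - (a (k + p)%N - a k))); last first.
  by move=> k _; rewrite aS -bS -/(a k) -/(b k); ring.
rewrite sumrB !sum_shift_diff -sumrB.
rewrite -[p in leRHS]card_ord mulr_natl -sumr_const; apply: ler_sum => k _.
have ab l : `|a l - b l| <= C * s.
  by apply: le_trans (gC _ _) _; rewrite opprB addrCA subrr addr0 ger0_norm.
have := ab k; have := ab (n.+1 + k)%N; rewrite !ler_norml => /andP[h1 h2] /andP[h3 h4].
lra.
Qed.

Definition second_diff0 i s x :=
  2 * f x - f (shift x (axis i 1) s) - f (shift x (axis i 1) (- s)).

(** With [(m + 1) * (j + 1)] points per axis the step [s] is exactly [j + 1] mesh widths, so lines
    parallel to axis [i] telescope. The predecessor compensates for the [M.+1] built into [grid]. *)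
Lemma grid_avg_second_diff i m j (s : R) : s = m.+1%:R^-1 ->
  grid_avg (second_diff0 i s) (m.+1 * j.+1).-1 <= 2 * C * s ^+ 2.
Proof.
move=> sE; set n := (m.+1 * j.+1).-1.
have nE : n.+1 = (m.+1 * j.+1)%N by rewrite prednK // muln_gt0.
have n0 : 0 < n.+1%:R :> R by rewrite ltr0n.
have sn : s = j.+1%:R / n.+1%:R.
  by rewrite nE natrM sE invfM mulrCA divff ?mulr1 // pnatr_eq0.
have s0 : 0 <= s by rewrite sE invr_ge0 ler0n.
rewrite /grid_avg -(@ler_pM2l _ n.+1%:R) // mulrCA.
have := sum_resample i (fun h : {ffun 'I_d -> 'I_n.+1} => second_diff0 i s (grid h)).
rewrite card_ord => <-.
rewrite ler_pdivrMl ?exprn_gt0 //.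
have -> : n.+1%:R ^+ d * (n.+1%:R * (2 * C * s ^+ 2)) =
    #|{ffun 'I_d -> 'I_n.+1}|%:R * (j.+1%:R * (2 * C * s)).
  rewrite card_ffun !card_ord natrX; congr (_ * _).
  have -> : j.+1%:R = n.+1%:R * s by rewrite sn mulrCA divff ?gt_eqF // mulr1.
  by move: n0; set N : R := n.+1%:R; clearbody N => _; ring.
rewrite mulr_natl -sumr_const; apply: ler_sum => h _.
have gridE (k : 'I_n.+1) : @grid R d n [ffun l => if l == i then k else h l] =
    upd (@grid R d n h) i (k%:R / n.+1%:R).
  by apply/funext => l; rewrite /grid /upd ffunE; case: eqP.
under eq_bigr do rewrite /second_diff0 gridE !shift_upd.
apply: (@second_diff_sum (fun r => f (upd (@grid R d n h) i r))) => // u v.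
by apply: le_trans (fC _ _) _; rewrite dist1_upd.
Qed.

Lemma lipschitz_f : lipschitz_fun f. Proof. by exists C. Qed.

Lemma lipschitz_second_diff0 i s : lipschitz_fun (second_diff0 i s).
Proof.
have shf u : lipschitz_fun (fun x => -1 * f (shift x (axis i 1) u)).
  apply: lipschitzZ; exact: (lipschitz_shift (fun j => u * axis i 1 j) lipschitz_f).
have := lipschitzD (lipschitzD (lipschitzZ 2 lipschitz_f) (shf s)) (shf (- s)).
by congr lipschitz_fun; apply/funext => x; rewrite !mulN1r.
Qed.

Lemma Rintegral_second_diff0 i m (s : R) : s = m.+1%:R^-1 ->
  (\int[lam]_(th in T) second_diff0 i s (tnth th) <= 2 * C * s ^+ 2)%R.
Proof.
move=> sE; have [D D0 FD] := lipschitz_second_diff0 i s.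
have cv : D * (d%:R / j.+1%:R) @[j --> \oo] --> (0 : R).
  rewrite -[X in _ --> X](mulr0 D) -[X in _ * X](mulr0 d%:R).
  by do 2!(apply: cvgM; first exact: cvg_cst); exact: cvg_invS.
apply/ler_addgt0Pr => e e0.
have /cvgrPdist_le/(_ _ e0)[j _ /(_ j (leqnn j))] := cv.
rewrite /= sub0r normrN => je.
have := grid_avg_second_diff i j sE; have := grid_avg_dist Hlam (m.+1 * j.+1).-1 D0 FD.
set I := (\int[lam]_(th in T) _)%R; set A := grid_avg _ _.
have : D * (d%:R / (m.+1 * j.+1).-1.+1%:R) <= e.
  apply: le_trans je; apply: le_trans (ler_norm _); apply: ler_wpM2l => //.
  apply: ler_wpM2l => //; rewrite prednK ?muln_gt0 // lef_pV2 ?posrE ?ltr0n ?muln_gt0 //.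
  by rewrite ler_nat leq_pmull.
move: (D * (d%:R / (m.+1 * j.+1).-1.+1%:R)) => X.
rewrite ler_norml => h1 /andP[h2 h3] h4; lra.
Qed.

Lemma second_diffE i s x : second_diff f K i s x = s^-1 * second_diff0 i s x + 2 * K * s.
Proof. by rewrite /second_diff mulrC. Qed.

Lemma lipschitz_second_diff i s : lipschitz_fun (second_diff f K i s).
Proof.
rewrite (_ : second_diff f K i s = fun x => s^-1 * second_diff0 i s x + 2 * K * s); last first.
  by apply/funext => x; exact: second_diffE.
apply: lipschitzD; last exact: lipschitz_cst.
by apply: lipschitzZ; exact: lipschitz_second_diff0.
Qed.

(** Testing only the steps [1 / (m + 1)] keeps the set measurable, and a torus point lying in no
    [bad_set] is still a [good_point]. *)
Definition bad_set i k : set (d.-tuple R) := T `&` \bigcap_m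
  [set th | k.+1%:R^-1 <= second_diff f K i m.+1%:R^-1 (tnth th)].

(* The integral of a second difference is [O(s ^+ 2)], since its Riemann sums telescope;
   after division by [s] it vanishes in the limit, and the integrand is nonnegative. *)
Lemma bad_set_null i k : measurable (bad_set i k) /\ lam (bad_set i k) = 0%E.
Proof.
have mT := @measurable_torus R d.
have mq m := lipschitz_measurable (lipschitz_second_diff i m.+1%:R^-1).
have mB : measurable (bad_set i k).
  rewrite /bad_set -bigcapIr; last by exists 0.
  apply: bigcap_measurable => [|m _]; first by exists 0.
  have := measurable_fun_ler (measurable_cst (k.+1%:R^-1 : R)) (mq m).
  by move=> /(_ mT [set true] I); congr measurable.
split=> //.
have k0 : 0 < k.+1%:R^-1 :> R by rewrite invr_gt0.
have fB : lam (bad_set i k) \is a fin_num.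
  rewrite ge0_fin_numE //; apply: (@le_lt_trans _ _ 1%E); last by rewrite ltry.
  by rewrite -(lam_torus Hlam); apply: le_measure; rewrite ?inE // => x [].
have ind_int : lam.-integrable T (EFin \o (\1_(bad_set i k) : d.-tuple R -> R)).
  apply: (@bounded_integrable _ _ _ Hlam _ _ 1) => //.
  by move=> th _; rewrite indicE; case: (_ \in _); rewrite ?normr1 ?normr0.
have iB : (\int[lam]_(x in T) (k.+1%:R^-1 * \1_(bad_set i k) x) =
    k.+1%:R^-1 * fine (lam (bad_set i k)))%R.
  rewrite RintegralZl //; congr (_ * _).
  by rewrite /Rintegral integral_indic // setIidl // => x [].
have bound m : k.+1%:R^-1 * fine (lam (bad_set i k)) <= (2 * C + 2 * K) / m.+1%:R.
  have m0 : 0 < m.+1%:R^-1 :> R by rewrite invr_gt0.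
  have i0 : lam.-integrable T (EFin \o (fun th => second_diff0 i m.+1%:R^-1 (tnth th))).
    by apply: lipschitz_integrable => //; exact: lipschitz_second_diff0.
  have ic (c : R) : lam.-integrable T (EFin \o (fun=> c)).
    by apply: (@bounded_integrable _ _ _ Hlam _ _ `|c|).
  rewrite -iB.
  apply: (@le_trans _ _ (\int[lam]_(x in T) second_diff f K i m.+1%:R^-1 (tnth x))%R).
    apply: le_Rintegral => //.
    - exact: integrableZl_EFin.
    - by apply: lipschitz_integrable => //; exact: lipschitz_second_diff.
    - move=> th Tth; rewrite indicE; case: (boolP (th \in bad_set i k)) => [/set_mem[_ /(_ m I)]|_].
        by rewrite mulr1.
      by rewrite mulr0; exact: second_diff_ge0.
  under eq_Rintegral do rewrite second_diffE.
  rewrite RintegralD //; last exact: integrableZl_EFin.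
  rewrite [X in X + _ <= _]RintegralZl // [X in _ + X <= _]Rintegral_cst // (lam_torus Hlam) /= mulr1.
  rewrite [leRHS]mulrDl; apply: lerD => //.
  rewrite ler_pdivrMl ?invr_gt0 //; apply: le_trans (Rintegral_second_diff0 i (erefl _)) _.
  by rewrite expr2 mulrCA mulrA.
suff : fine (lam (bad_set i k)) = 0 by move=> h; rewrite -(fineK fB) h.
apply/eqP; rewrite eq_le fine_ge0 ?andbT //.
rewrite -(ler_pM2l k0) mulr0; apply/ler_addgt0Pr => e e0; rewrite add0r.
have cv : (2 * C + 2 * K) / j.+1%:R @[j --> \oo] --> (0 : R).
  by rewrite -[X in _ --> X](mulr0 (2 * C + 2 * K)); apply: cvgM; [exact: cvg_cst|exact: cvg_invS].
have /cvgrPdist_le/(_ _ e0)[j _ /(_ j (leqnn j))] := cv.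
rewrite /= sub0r normrN => je; apply: le_trans (bound j) _.
by apply: le_trans (ler_norm _) je.
Qed.

Lemma ae_good_point :
  lam.-negligible [set th | T th /\ ~ good_point f K (tnth th)].
Proof.
(* The axis is indexed by a natural number to fit a countable union; the set is empty for
   [m >= d]. *)
pose F m := \bigcup_k [set th | exists i : 'I_d, i = m :> nat /\ bad_set i k th].
apply: (@negligibleS _ _ _ _ (\bigcup_m F m)); last first.
  apply: negligible_bigcup => m; apply: negligible_bigcup => k.
  case: (ltnP m d) => md; last first.
    by exists set0; split=> // th [i [im _]]; move: (ltn_ord i); rewrite im ltnNge md.
  exists (bad_set (Ordinal md) k); have [mB B0] := bad_set_null (Ordinal md) k; split=> //.
  by move=> th [i [im]]; rewrite (_ : i = Ordinal md) //; exact: val_inj.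
move=> th [Tth] /existsNP[i /existsNP[e /not_implyP[e0 /forall2NP H]]].
have cv := @cvg_invS R; have /cvgrPdist_lt/(_ _ e0)[k _ /(_ k (leqnn k))] := cv.
rewrite /= sub0r normrN gtr0_norm ?invr_gt0 // => ke.
exists (nat_of_ord i) => //; exists k => //; exists i; split=> //; split=> // m _ /=.
have [] := H m.+1%:R^-1; first by rewrite invr_gt0 ltr0n.
by move/negP; rewrite -leNgt; apply: le_trans; exact: ltW.
Qed.

End AlmostEverywhere.

(** * Approximation by trigonometric polynomials *)

Section TrigonometricPolynomials.
Variables (R : realType) (d : nat).
Implicit Types (T U : ('I_d -> R) -> R) (y : 'I_d -> R).

Definition trig_eval (s : seq (R * ('I_d -> R) * R)) y : R :=
  \sum_(p <- s) p.1.1 * cos (lin p.1.2 y + p.2).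

Definition trigpoly T := exists s, forall y, T y = trig_eval s y.

Lemma trigpolyD T U : trigpoly T -> trigpoly U -> trigpoly (fun y => T y + U y).
Proof.
move=> [s sP] [r rP]; exists (s ++ r) => y.
by rewrite /trig_eval big_cat sP rP.
Qed.

Lemma trigpoly_cos (c : 'I_d -> R) (a r : R) : trigpoly (fun y => r * cos (lin c y + a)).
Proof. by exists [:: (r, c, a)] => y; rewrite /trig_eval big_seq1. Qed.

Lemma trigpoly_cst (r : R) : trigpoly (fun=> r).
Proof.
have [s sP] := trigpoly_cos (fun=> 0) 0 r; exists s => y; rewrite -sP.
by rewrite /lin big1 ?addr0 ?cos0 ?mulr1 // => i _; rewrite mul0r.
Qed.

Lemma trigpoly_sum I (s : seq I) (F : I -> ('I_d -> R) -> R) :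
  (forall i, trigpoly (F i)) -> trigpoly (fun y => \sum_(i <- s) F i y).
Proof.
move=> H; elim: s => [|i s IH].
  by under eq_fun do rewrite big_nil; exact: trigpoly_cst.
by under eq_fun do rewrite big_cons; exact: trigpolyD.
Qed.

(** Product-to-sum formula. Cosines with a phase are stable under it, so sines require no separate
    terms. *)
Lemma trigpolyM T U : trigpoly T -> trigpoly U -> trigpoly (fun y => T y * U y).
Proof.
move=> [s sP] [r rP]; rewrite (_ : (fun y => _) = fun y =>
  \sum_(p <- s) \sum_(q <- r) (p.1.1 * cos (lin p.1.2 y + p.2)) * (q.1.1 * cos (lin q.1.2 y + q.2))).
  apply: trigpoly_sum => -[[u c] a]; apply: trigpoly_sum => -[[v e] b] /=.
  rewrite (_ : (fun y => _) = fun y =>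
     (u * v / 2) * cos (lin (fun i => c i + e i) y + (a + b)) +
     (u * v / 2) * cos (lin (fun i => c i - e i) y + (a - b))).
    by apply: trigpolyD; exact: trigpoly_cos.
  apply/funext => y.
  have -> : lin (fun i => c i + e i) y = lin c y + lin e y.
    by rewrite -big_split; apply: eq_bigr => i _; rewrite mulrDl.
  have -> : lin (fun i => c i - e i) y = lin c y - lin e y.
    by rewrite -sumrB; apply: eq_bigr => i _; rewrite mulrBl.
  have -> : lin c y + lin e y + (a + b) = (lin c y + a) + (lin e y + b) by ring.
  have -> : lin c y - lin e y + (a - b) = (lin c y + a) - (lin e y + b) by ring.
  by move: (lin c y + a) (lin e y + b) => A B; rewrite cosD cosB; field.
apply/funext => y; rewrite sP rP /trig_eval mulr_suml; apply: eq_bigr => p _.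
by rewrite mulr_sumr.
Qed.

Lemma trigpoly_bounded T : trigpoly T -> exists2 K, 0 <= K & forall y, `|T y| <= K.
Proof.
move=> [s sP]; exists (\sum_(p <- s) `|p.1.1|); first exact: sumr_ge0.
move=> y; rewrite sP; apply: le_trans (ler_norm_sum _ _ _) _; apply: ler_sum => p _.
by rewrite normrM ler_piMr // cos_max.
Qed.

(** * Bernstein operators as random walks *)

Implicit Types (l : seq 'I_d) (z : 'I_d -> R) (F : ('I_d -> nat) -> R) (k : 'I_d -> nat).

Definition incr k i : 'I_d -> nat := fun j => if j == i then (k j).+1 else k j.

(* The expectation of [F] after a walk from [k] whose steps increment the coordinates
   listed in [l], each with probability [z i]; with every coordinate listed [N] times
   this is the multivariate Bernstein operator of degree [N] *)
Fixpoint walk l z F k : R :=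
  if l is i :: l' then z i * walk l' z F (incr k i) + (1 - z i) * walk l' z F k else F k.

Lemma walk_le l z F G k : (forall i, 0 <= z i <= 1) -> (forall k, F k <= G k) ->
  walk l z F k <= walk l z G k.
Proof.
move=> z01 FG; elim: l k => [|i l IH] k //=; have /andP[z0 z1] := z01 i.
by apply: lerD; apply: ler_wpM2l => //; rewrite subr_ge0.
Qed.

Lemma walk_cst l z r k : walk l z (fun=> r) k = r.
Proof. by elim: l k => //= i l IH k; rewrite !IH -mulrDl addrC subrK mul1r. Qed.

Lemma walkD l z F G k : walk l z (fun k => F k + G k) k = walk l z F k + walk l z G k.
Proof. by elim: l k => //= i l IH k; rewrite !IH; ring. Qed.

Lemma walkZ l z r F k : walk l z (fun k => r * F k) k = r * walk l z F k.
Proof. by elim: l k => //= i l IH k; rewrite !IH; ring. Qed.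

Lemma walk_sum I (s : seq I) l z (F : I -> ('I_d -> nat) -> R) k :
  walk l z (fun k => \sum_(i <- s) F i k) k = \sum_(i <- s) walk l z (F i) k.
Proof.
elim: s => [|i s IH].
  by rewrite big_nil; under eq_fun do rewrite big_nil; exact: walk_cst.
by rewrite big_cons -IH -walkD; under eq_fun do rewrite big_cons.
Qed.

(** Bias-variance decomposition; an arbitrary centre [c] and start [k] are what lets the induction
    on the steps go through. *)
Lemma walk_variance l z j (c : R) k :
  walk l z (fun k => ((k j)%:R - c) ^+ 2) k =
  (count_mem j l)%:R * (z j * (1 - z j)) + ((k j)%:R + (count_mem j l)%:R * z j - c) ^+ 2.
Proof.
elim: l k => [|i l IH] k /=; first by rewrite !mul0r add0r addr0.
rewrite !IH natrD /incr eq_sym; case: eqP => [->|_] /=; last by ring.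
by rewrite -natr1; ring.
Qed.

Lemma trigpoly_walk l (z : ('I_d -> R) -> 'I_d -> R) F k :
  (forall i, trigpoly (fun y => z y i)) -> trigpoly (fun y => walk l (z y) F k).
Proof.
move=> zt; elim: l k => [|i l IH] k /=; first exact: trigpoly_cst.
have t1 : trigpoly (fun y => 1 - z y i).
  under eq_fun do rewrite -mulN1r; apply: trigpolyD; first exact: trigpoly_cst.
  by apply: trigpolyM => //; exact: trigpoly_cst.
by apply: trigpolyD; exact: trigpolyM.
Qed.

Definition all_steps N : seq 'I_d := flatten (nseq N (enum 'I_d)).

Lemma count_all_steps N j : count_mem j (all_steps N) = N.
Proof.
rewrite count_flatten map_nseq sumn_nseq count_uniq_mem ?enum_uniq // mem_enum mul1n //.
Qed.

(** The walk is a positive operator that preserves constants, so the pointwise bound may be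
    averaged. Each coordinate then contributes its variance [N * z i * (1 - z i)] divided by
    [N ^ 2], at most [1 / N]. *)
Lemma walk_approx N z F (x0 e K : R) : (forall i, 0 <= z i <= 1) -> 0 <= K -> (0 < N)%N ->
  (forall k, `|x0 - F k| <= e + K * \sum_i ((k i)%:R - N%:R * z i) ^+ 2 / N%:R ^+ 2) ->
  `|x0 - walk (all_steps N) z F (fun=> 0%N)| <= e + K * d%:R / N%:R.
Proof.
move=> z01 K0 N0 H; have NR : 0 < N%:R :> R by rewrite ltr0n.
pose B k := e + K * \sum_i ((k i)%:R - N%:R * z i) ^+ 2 / N%:R ^+ 2.
have wB : walk (all_steps N) z B (fun=> 0%N) <= e + K * d%:R / N%:R.
  rewrite /B walkD walk_cst walkZ walk_sum lerD2l -mulrA; apply: ler_wpM2l => //.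
  rewrite -[d in leRHS]card_ord mulr_natl -sumr_const; apply: ler_sum => i _.
  under [X in walk _ _ X]eq_fun do rewrite mulrC.
  rewrite walkZ walk_variance count_all_steps add0r subrr expr0n addr0.
  have -> : N%:R ^- 2 * (N%:R * (z i * (1 - z i))) = N%:R^-1 * (z i * (1 - z i)).
    by field; rewrite gt_eqF.
  rewrite ler_piMr ?invr_ge0 //.
  by have /andP[z0 z1] := z01 i; nra.
rewrite ler_norml; apply/andP; split.
  apply: (@le_trans _ _ (- walk (all_steps N) z B (fun=> 0%N))); first by rewrite lerN2.
  rewrite lerNl opprB lerBlDr -(walk_cst (all_steps N) z x0 (fun=> 0%N)) -walkD.
  apply: walk_le => // k; have := H k; rewrite -/(B k) ler_norml => /andP[h1 _]; lra.
apply: le_trans wB; rewrite lerBlDr -walkD -[leLHS](walk_cst (all_steps N) z x0 (fun=> 0%N)).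
by apply: walk_le => // k; have := H k; rewrite -/(B k) ler_norml => /andP[_ h1]; lra.
Qed.

End TrigonometricPolynomials.

(** * Uniform approximation on a box *)

Section TrigonometricApproximation.
Variables (R : realType) (d : nat).

Lemma uniformly_continuous_box (g : 'rV[R]_d -> R) (L e : R) : continuous g -> 0 < e ->
  exists2 r : R, 0 < r & forall x x' : 'rV[R]_d, (forall i, `|x 0 i| <= L) ->
    (forall i, `|x 0 i - x' 0 i| < r) -> `|g x - g x'| < e.
Proof.
move=> gc e0; pose K := [set v : 'rV[R]_d | forall i, `[- L, L] (v ord0 i)].
have cK : compact K by apply: (@rV_compact _ _ (fun=> `[- L, L])) => i; exact: segment_compact.
pose P (r : R) (x : 'rV[R]_d) := forall x' : 'rV[R]_d,
  (forall i, `|x 0 i - x' 0 i| < r) -> `|g x - g x'| < e.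
have : \forall r \near 0^'+, K `<=` P r.
  have /compact_near_coveringP nc := cK; apply: nc => x Kx.
  have /cvgrPdist_lt/(_ (e / 2)) := gc x; rewrite divr_gt0 // => /(_ isT).
  move=> /nbhs_ballP[r /= r0 H].
  have r20 : 0 < r / 2 by rewrite divr_gt0.
  exists (ball x (r / 2), [set s : R | s < r / 2]).
    by split; [exact: nbhsx_ballx|exact: nbhs_right_lt].
  move=> [y s] /= [[_ bxy] sr] x' yx'.
  have hr : r / 2 + r / 2 = r by rewrite -splitr.
  have h1 : `|g x - g y| < e / 2.
    by apply: H; split=> // i j; apply: lt_le_trans (bxy i j) _; lra.
  have h2 : `|g x - g x'| < e / 2.
    apply: H; split=> // i j; rewrite /ball /= !ord1.
    have := bxy i j; rewrite /ball /= !ord1 => b1; have b2 := yx' j.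
    have := ler_distD (y 0 j) (x 0 j) (x' 0 j); lra.
  have := ler_distD (g x) (g y) (g x'); rewrite (distrC (g y) (g x)); lra.
move=> near_r; have [r r0 Pr] : exists2 r : R, 0 < r & K `<=` P r.
  near (0 : R)^'+ => r; exists r; first by near: r; exact: nbhs_right_gt.
  by near: r.
exists r => // x x' xL xx'; apply: (Pr x) => // i /=.
by rewrite in_itv /= -ler_norml; exact: xL.
Unshelve. all: by end_near.
Qed.

Lemma sin_expanding (u v : R) : `|u| <= 1 -> `|v| <= 1 ->
  cos 1 * `|u - v| <= `|sin u - sin v|.
Proof.
wlog uv : u v / v <= u.
  move=> H; case: (leP v u) => [|/ltW] h u1 v1; first exact: H.
  by rewrite distrC (distrC (sin u)); exact: H.
move=> u1 v1.
have H1 c : c \in `]v, u[%R -> is_derive c 1 (@sin R) (cos c).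
  by move=> _; exact: is_derive_sin.
have H2 : {within `[v, u], continuous (@sin R)}.
  by apply: continuous_subspaceT; exact: continuous_sin.
have [c cuv ->] := MVT_segment uv H1 H2.
rewrite normrM ler_wpM2r //; apply: le_trans (ler_norm _).
move: cuv; rewrite in_itv /= => /andP[vc cu].
move: u1 v1; rewrite !ler_norml => /andP[_ u1] /andP[v1 _].
have c1 : `|c| <= 1 by rewrite ler_norml (le_trans v1 vc) (le_trans cu u1).
have p1 : 1 <= pi :> R by have := @pi_ge2 R; lra.
rewrite -(cos_norm c) leNgt ltr_cos ?in_itv /= ?ler01 ?normr_ge0 ?(le_trans c1) //.
by rewrite -leNgt.
Qed.

(** Each [z (y i)] is both a trigonometric polynomial in [y] and a bijective coordinate on [-L, L],
    so a Bernstein polynomial in these variables is a trigonometric polynomial. Since the sine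
    expands distances on [-1, 1] by at least [cos 1], continuity of [g] carries over to the new
    variables. *)
Lemma trig_approximation (g : 'rV[R]_d -> R) (a : 'I_d -> 'rV[R]_d) (M L e : R) :
  continuous g -> (forall x, `|g x| <= M) -> 0 < L -> 0 < e ->
  exists2 T, trigpoly T & forall y : 'I_d -> R, (forall i, `|y i| <= L) ->
    `|g (\sum_i y i *: a i) - T y| <= e.
Proof.
move=> gc gM L0 e0; have M0 : 0 <= M := le_trans (normr_ge0 _) (gM 0).
have s1 : 0 < sin 1 :> R.
  by apply: sin_gt0_pi; rewrite ltr01 /=; have := @pi_ge2 R; lra.
have c1 : 0 < cos 1 :> R := @cos1_gt0 R.
(* Dividing by [L] keeps the argument where the sine increases; [sin 1] normalises the ends to
   [z (- L) = 0] and [z L = 1]. *)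
pose z (v : R) := (1 + sin (v / L) / sin 1) / 2.
have zB u v : z u - z v = (sin (u / L) - sin (v / L)) / (2 * sin 1).
  by rewrite /z; field; rewrite gt_eqF.
have vL v : `|v| <= L -> `|v / L| <= 1.
  by move=> h; rewrite normrM normfV (gtr0_norm L0) ler_pdivrMr // mul1r.
have z_exp u v : `|u| <= L -> `|v| <= L ->
    cos 1 / (2 * sin 1 * L) * `|u - v| <= `|z u - z v|.
  move=> /vL uL /vL vL'; rewrite zB normrM normfV (gtr0_norm (_ : 0 < 2 * sin 1)) ?mulr_gt0 //.
  rewrite ler_pdivlMr ?mulr_gt0 //; apply: le_trans (sin_expanding uL vL').
  rewrite -mulrBl normrM normfV (gtr0_norm L0) le_eqVlt; apply/orP; left; apply/eqP.
  by field; rewrite !gt_eqF.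
have z1 : z L = 1 by rewrite /z divff ?gt_eqF // divff ?gt_eqF //; field.
have z0 : z (- L) = 0.
  by rewrite /z mulNr divff ?gt_eqF // sinN mulNr divff ?gt_eqF // subrr mul0r.
have z_mono u v : `|u| <= L -> `|v| <= L -> u <= v -> z u <= z v.
  move=> /vL uL /vL vL' uv; rewrite -subr_ge0 zB divr_ge0 //; last by rewrite mulr_ge0 // ltW.
  have uv' : u / L <= v / L by rewrite ler_pM2r ?invr_gt0.
  rewrite subr_ge0 leNgt ltr_sin; first by rewrite -leNgt.
    by have := pihalf_ge1 R; move: vL'; rewrite in_itv /= ler_norml => /andP[? ?] ?; apply/andP; split; lra.
  by have := pihalf_ge1 R; move: uL; rewrite in_itv /= ler_norml => /andP[? ?] ?; apply/andP; split; lra.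
have LL : `|L| <= L by rewrite gtr0_norm.
have z01 u : `|u| <= L -> 0 <= z u <= 1.
  move=> uL; have := uL; rewrite ler_norml => /andP[u1 u2].
  by rewrite -{1}z0 -z1 !z_mono // normrN.
have zc : continuous z.
  move=> v; rewrite /z; apply: cvgM; last exact: cvg_cst.
  apply: cvgD; first exact: cvg_cst.
  apply: cvgM; last exact: cvg_cst.
  apply: (@continuous_comp _ _ _ (fun v : R => v / L) (@sin R)); last exact: continuous_sin.
  by apply: cvgM; [exact: cvg_id|exact: cvg_cst].
have [node nodeP] : exists node : R -> R, forall u, 0 <= u <= 1 -> `|node u| <= L /\ z (node u) = u.
  have ex u : exists x, 0 <= u <= 1 -> `|x| <= L /\ z x = u.
    case: (boolP (0 <= u <= 1)) => [u01|_]; last by exists 0.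
    have LmL : - L <= L by rewrite ge0_cp // ltW.
    have [||x xL zx] := @IVT R z (- L) L u LmL.
    - by apply: continuous_subspaceT; exact: zc.
    - by rewrite z0 z1 (min_idPl ler01) (max_idPr ler01).
    by exists x => _; split => //; rewrite ler_norml; move: xL; rewrite in_itv.
  by have [node nP] := choice ex; exists node.
pose pt (y : 'I_d -> R) := \sum_i y i *: a i.
have ptE (y : 'I_d -> R) j : pt y 0 j = \sum_i y i * a i 0 j.
  by rewrite /pt summxE; apply: eq_bigr => i _; rewrite mxE.
pose A : R := \sum_i \sum_j `|a i 0 j|.
have A0 : 0 <= A by apply: sumr_ge0 => i _; apply: sumr_ge0.
have Aj j : \sum_i `|a i 0 j| <= A.
  by apply: ler_sum => i _; rewrite (bigD1 j) //= lerDl sumr_ge0.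
have e20 : 0 < e / 2 by rewrite divr_gt0.
have [r r0 rP] := uniformly_continuous_box (L * A) gc e20.
pose dl := r / (A + 1); have A1 : 0 < A + 1 by rewrite ltr_wpDl.
have dl0 : 0 < dl by rewrite divr_gt0.
(* Points [dl] apart in some coordinate have [z]-values at least [et] apart there; the trivial bound
   [2 * M] is then at most [K] times the squared [z]-distance. *)
pose et := cos 1 / (2 * sin 1 * L) * dl.
have cc0 : 0 < cos 1 / (2 * sin 1 * L) by rewrite divr_gt0 // !mulr_gt0.
have et0 : 0 < et by rewrite mulr_gt0.
pose K := 2 * M / et ^+ 2.
have K0 : 0 <= K by apply: divr_ge0; [exact: mulr_ge0|exact: sqr_ge0].
have main (y y' : 'I_d -> R) : (forall i, `|y i| <= L) -> (forall i, `|y' i| <= L) ->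
    `|g (pt y) - g (pt y')| <= e / 2 + K * \sum_i (z (y' i) - z (y i)) ^+ 2.
  move=> yL y'L.
  have S0 : 0 <= \sum_i (z (y' i) - z (y i)) ^+ 2 by apply: sumr_ge0 => i _; exact: sqr_ge0.
  have [close|/existsNP[i /negP]] := pselect (forall i, `|y i - y' i| < dl).
    apply: (@le_trans _ _ (e / 2)); last by rewrite lerDl mulr_ge0.
    apply/ltW/rP => j; rewrite !ptE.
      apply: le_trans (ler_norm_sum _ _ _) _.
      apply: le_trans (ler_wpM2l (ltW L0) (Aj j)).
      by rewrite mulr_sumr; apply: ler_sum => i _; rewrite normrM ler_wpM2r.
    rewrite -sumrB; apply: le_lt_trans (ler_norm_sum _ _ _) _.
    apply: (@le_lt_trans _ _ (dl * A)).
      apply: le_trans (ler_wpM2l (ltW dl0) (Aj j)).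
      rewrite mulr_sumr; apply: ler_sum => i _; rewrite -mulrBl normrM ler_wpM2r //.
      exact: ltW.
    by rewrite /dl mulrAC ltr_pdivrMr // ltr_pM2l // ltrDl.
  rewrite -leNgt => far.
  have h1 : et <= `|z (y i) - z (y' i)|.
    apply: le_trans (z_exp _ _ (yL i) (y'L i)); rewrite ler_wpM2l //.
    exact: ltW.
  have h2 : et ^+ 2 <= \sum_i (z (y' i) - z (y i)) ^+ 2.
    apply: (@le_trans _ _ ((z (y' i) - z (y i)) ^+ 2)); last first.
      by rewrite (bigD1 i) //= lerDl sumr_ge0 // => k _; exact: sqr_ge0.
    rewrite -[leRHS]real_normK ?num_real // distrC.
    by rewrite ler_pXn2r // nnegrE ?normr_ge0 // ltW.
  apply: (@le_trans _ _ (2 * M)).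
    apply: le_trans (ler_normB _ _) _; rewrite mulr_natl mulr2n; exact: lerD.
  apply: (@le_trans _ _ (K * et ^+ 2)).
    by rewrite /K divfK // expf_neq0 // gt_eqF.
  by apply: (le_trans (ler_wpM2l K0 h2)); rewrite lerDr ltW.
have [N N0 NP] : exists2 N, (0 < N)%N & K * d%:R / N%:R <= e / 2.
  have cv : K * d%:R * m.+1%:R^-1 @[m --> \oo] --> (0 : R).
    by rewrite -[X in _ --> X](mulr0 (K * d%:R)); apply: cvgM; [exact: cvg_cst|exact: cvg_invS].
  have /cvgrPdist_le/(_ _ e20)[m _ /(_ m (leqnn m))] := cv.
  by rewrite /= sub0r normrN => h; exists m.+1 => //; apply: le_trans (ler_norm _) h.
(* [walk_approx] quantifies over all [k], also beyond [N], hence the cap at 1. Capping only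
   decreases the distance to a point of [0, 1]. *)
pose kn (k : 'I_d -> nat) i := node (Num.min ((k i)%:R / N%:R : R) 1).
exists (fun y => walk (all_steps d N) (fun i => z (y i)) (fun k => g (pt (kn k))) (fun=> 0%N)).
  apply: trigpoly_walk => i; rewrite /z.
  rewrite (_ : (fun y : 'I_d -> R => _) = fun y : 'I_d -> R => 2^-1 +
     (2 * sin 1)^-1 * cos (lin (fun j => if j == i then L^-1 else 0) y + - (pi / 2))).
    by apply: trigpolyD; [exact: trigpoly_cst|exact: trigpoly_cos].
  apply/funext => y; rewrite /lin (bigD1 i) //= eqxx big1 => [|j /negbTE ->]; last by rewrite mul0r.
  by rewrite addr0 -sin_cos_shift [_^-1 * y i]mulrC; field; rewrite gt_eqF.
move=> y yL; rewrite -/(pt y).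
apply: le_trans (_ : e / 2 + K * d%:R / N%:R <= _); last by rewrite [leRHS]splitr lerD2l.
apply: walk_approx => // [i|k]; first exact: z01.
have NR : 0 < N%:R :> R by rewrite ltr0n.
have m01 i : 0 <= Num.min ((k i)%:R / N%:R : R) 1 <= 1.
  by case: (leP ((k i)%:R / N%:R : R) 1) => h; rewrite ?ler01 ?lexx // h divr_ge0.
apply: le_trans (main y (kn k) yL _) _; first by move=> i; have [] := nodeP _ (m01 i).
rewrite lerD2l; apply: ler_wpM2l => //; apply: ler_sum => i _.
have [_ ->] := nodeP _ (m01 i); have /andP[y0 y1] := z01 _ (yL i).
have -> : ((k i)%:R - N%:R * z (y i)) ^+ 2 / N%:R ^+ 2 = ((k i)%:R / N%:R - z (y i)) ^+ 2.
  by field; rewrite gt_eqF.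
by case: (leP ((k i)%:R / N%:R) 1) => h //; nra.
Qed.

End TrigonometricApproximation.

(** * Unconditional sums *)

Section UnconditionalSums.
Variables (R : realType) (T : choiceType) (V : set T).
Implicit Types (f g : T -> R) (B : seq T).

Definition seq_in B := uniq B /\ forall v, v \in B -> V v.

Definition summable f := exists K : R, forall B, seq_in B -> \sum_(v <- B) `|f v| <= K.

(** Convergence along finite subsets of [V] ordered by inclusion. It is visibly linear, unlike
    [ssum], which separates positive and negative parts. *)
Definition netlim f (l : R) := forall e : R, 0 < e -> exists2 B0, seq_in B0 &
  forall B, seq_in B -> {subset B0 <= B} -> `|\sum_(v <- B) f v - l| <= e.

Lemma seq_in_nil : seq_in [::]. Proof. by split. Qed.

Lemma seq_inU B B' : seq_in B -> seq_in B' -> seq_in (undup (B ++ B')).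
Proof.
move=> [_ BV] [_ B'V]; split; first exact: undup_uniq.
by move=> v; rewrite mem_undup mem_cat => /orP[/BV|/B'V].
Qed.

Lemma netlim_unique f l l' : netlim f l -> netlim f l' -> l = l'.
Proof.
move=> H H'; apply/eqP; rewrite -subr_eq0 -normr_eq0 eq_le normr_ge0 andbT.
apply/ler_addgt0Pr => e e0; rewrite add0r.
have e20 : 0 < e / 2 by rewrite divr_gt0.
have [B Bin BP] := H _ e20; have [B' B'in B'P] := H' _ e20.
have Uin := seq_inU Bin B'in.
have h1 : {subset B <= undup (B ++ B')} by move=> v vB; rewrite mem_undup mem_cat vB.
have h2 : {subset B' <= undup (B ++ B')} by move=> v vB; rewrite mem_undup mem_cat vB orbT.
have := BP _ Uin h1; have := B'P _ Uin h2; move: (\sum_(v <- _) _) => s.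
rewrite !ler_norml => /andP[? ?] /andP[? ?]; apply/andP; split; lra.
Qed.

Lemma netlimD f g l m : netlim f l -> netlim g m -> netlim (fun v => f v + g v) (l + m).
Proof.
move=> H H' e e0; have e20 : 0 < e / 2 by rewrite divr_gt0.
have [B Bin BP] := H _ e20; have [B' B'in B'P] := H' _ e20.
exists (undup (B ++ B')); first exact: seq_inU.
move=> C Cin CB; rewrite big_split /=.
have h1 : {subset B <= C} by move=> v vB; apply: CB; rewrite mem_undup mem_cat vB.
have h2 : {subset B' <= C} by move=> v vB; apply: CB; rewrite mem_undup mem_cat vB orbT.
have := BP _ Cin h1; have := B'P _ Cin h2.
rewrite !ler_norml => /andP[? ?] /andP[? ?]; apply/andP; split; lra.
Qed.

Lemma netlimZ (r : R) f l : netlim f l -> netlim (fun v => r * f v) (r * l).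
Proof.
move=> H e e0; have r0 : 0 < `|r| + 1 by rewrite ltr_wpDl.
have [B Bin BP] := H _ (divr_gt0 e0 r0); exists B => // C Cin CB.
rewrite -mulr_sumr -mulrBr normrM; have := BP _ Cin CB; rewrite ler_pdivlMr // => h.
apply: le_trans h; rewrite mulrC ler_wpM2l // lerDl; lra.
Qed.

Lemma netlim_norm_le f l (K : R) : netlim f l ->
  (forall B, seq_in B -> `|\sum_(v <- B) f v| <= K) -> `|l| <= K.
Proof.
move=> H fK; apply/ler_addgt0Pr => e e0; have [B Bin BP] := H _ e0.
have := BP _ Bin (fun v h => h); have := fK _ Bin; move: (\sum_(v <- _) _) => s.
rewrite !ler_norml => /andP[? ?] /andP[? ?]; apply/andP; split; lra.
Qed.

Lemma esum_seq_le f B : (forall v, 0 <= f v) -> seq_in B ->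
  ((\sum_(v <- B) f v)%:E <= \esum_(v in V) (f v)%:E)%E.
Proof.
move=> f0 [Bu BV]; apply: ereal_sup_ubound; exists [set` B].
  by split; [exact: finite_seq|move=> v /= /BV].
by rewrite -fsbig_seq // sumEFin.
Qed.

Lemma esum_adherent f (p e : R) : (\esum_(v in V) (f v)%:E = p%:E)%E -> 0 < e ->
  exists2 B, seq_in B & p - e < \sum_(v <- B) f v.
Proof.
move=> Ep e0; have fin : (\esum_(v in V) (f v)%:E)%E \is a fin_num by rewrite Ep.
have [_ [A [finA AV] <-]] := ub_ereal_sup_adherent e0 fin.
rewrite -/(esum _ _) Ep fsbig_finite // sumEFin -EFinB lte_fin => h.
exists (finmap.enum_fset (fset_set A)) => //; split; first exact: finmap.fset_uniq.
move=> v; have -> : (v \in finmap.enum_fset (fset_set A)) = (v \in A) := in_fset_set finA v.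
by move=> /set_mem/AV.
Qed.

Lemma esum_le_seq f (K : R) : (forall B, seq_in B -> \sum_(v <- B) f v <= K) ->
  (\esum_(v in V) (f v)%:E <= K%:E)%E.
Proof.
move=> fK; apply: ub_ereal_sup => _ [A [finA AV] <-].
rewrite fsbig_finite // sumEFin lee_fin; apply: fK; split; first exact: finmap.fset_uniq.
move=> v; have -> : (v \in finmap.enum_fset (fset_set A)) = (v \in A) := in_fset_set finA v.
by move=> /set_mem/AV.
Qed.

Lemma netlim_esum f : (forall v, 0 <= f v) -> summable f ->
  exists2 p : R, (\esum_(v in V) (f v)%:E = p%:E)%E & netlim f p.
Proof.
move=> f0 [K fK].
have EK : (\esum_(v in V) (f v)%:E <= K%:E)%E.
  apply: esum_le_seq => B Bin; apply: le_trans (fK _ Bin).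
  by apply: ler_sum => v _; exact: ler_norm.
have E0 : (0 <= \esum_(v in V) (f v)%:E)%E by apply: esum_ge0 => v _; rewrite lee_fin.
have fin : (\esum_(v in V) (f v)%:E)%E \is a fin_num.
  by rewrite ge0_fin_numE //; apply: le_lt_trans EK _; rewrite ltry.
exists (fine (\esum_(v in V) (f v)%:E)%E); first by rewrite fineK.
move=> e e0; have [B0 B0in lt] := esum_adherent (esym (fineK fin)) e0.
exists B0 => // B Bin B0B.
have ub : \sum_(v <- B) f v <= fine (\esum_(v in V) (f v)%:E)%E.
  by rewrite -lee_fin fineK //; exact: esum_seq_le.
have lb : \sum_(v <- B0) f v <= \sum_(v <- B) f v.
  have [Bu _] := Bin; have [B0u _] := B0in.
  rewrite [leRHS](bigID (fun v => v \in B0)) /= -[X in _ <= X + _]big_filter.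
  have -> : \sum_(v <- [seq v <- B | v \in B0]) f v = \sum_(v <- B0) f v.
    apply: perm_big; apply: uniq_perm; rewrite ?filter_uniq //.
    by move=> v; rewrite mem_filter; case: (boolP (v \in B0)) => // /B0B ->.
  by rewrite lerDl sumr_ge0.
rewrite ler_norml; apply/andP; split; lra.
Qed.

Lemma netlim_ssum f : summable f -> netlim f (ssum V f).
Proof.
move=> [K fK].
have sp : summable (fun v => rpos (f v)).
  exists K => B Bin; apply: le_trans (fK _ Bin); apply: ler_sum => v _.
  by rewrite /rpos; case: (leP (f v) 0) => h; rewrite ?normr0.
have sn : summable (fun v => rneg (f v)).
  exists K => B Bin; apply: le_trans (fK _ Bin); apply: ler_sum => v _.
  by rewrite /rneg; case: (leP (- f v) 0) => h; rewrite ?normr0 ?normrN.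
have p0 v : 0 <= rpos (f v) by rewrite /rpos le_max lexx orbT.
have n0 v : 0 <= rneg (f v) by rewrite /rneg le_max lexx orbT.
have [p Ep Np] := netlim_esum p0 sp; have [n En Nn] := netlim_esum n0 sn.
rewrite /ssum Ep En /=.
have := netlimD Np (netlimZ (-1) Nn); rewrite !mulN1r.
congr netlim; apply/funext => v; rewrite mulN1r /rpos /rneg.
by case: (leP (f v) 0) => h1; case: (leP (- f v) 0) => h2; lra.
Qed.

Lemma summableD f g : summable f -> summable g -> summable (fun v => f v + g v).
Proof.
move=> [K fK] [L gL]; exists (K + L) => B Bin.
apply: (@le_trans _ _ (\sum_(v <- B) (`|f v| + `|g v|))).
  by apply: ler_sum => v _; exact: ler_normD.
by rewrite big_split lerD ?fK ?gL.
Qed.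

Lemma summableZ (r : R) f : summable f -> summable (fun v => r * f v).
Proof.
move=> [K fK]; exists (`|r| * K) => B Bin.
under eq_bigr do rewrite normrM.
by rewrite -mulr_sumr ler_wpM2l ?fK.
Qed.

Lemma ssumD f g : summable f -> summable g ->
  ssum V (fun v => f v + g v) = ssum V f + ssum V g.
Proof.
move=> sf sg; apply: (@netlim_unique (fun v => f v + g v)).
  by apply: netlim_ssum; exact: summableD.
by apply: netlimD; exact: netlim_ssum.
Qed.

Lemma ssumZ (r : R) f : summable f -> ssum V (fun v => r * f v) = r * ssum V f.
Proof.
move=> sf; apply: (@netlim_unique (fun v => r * f v)).
  by apply: netlim_ssum; exact: summableZ.
by apply: netlimZ; exact: netlim_ssum.
Qed.

Lemma ssum_norm_le f (K : R) : (forall B, seq_in B -> \sum_(v <- B) `|f v| <= K) ->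
  `|ssum V f| <= K.
Proof.
move=> fK; apply: (netlim_norm_le (netlim_ssum (ex_intro _ K fK))) => B Bin.
by apply: le_trans (ler_norm_sum _ _ _) (fK _ Bin).
Qed.

Lemma ssum_eq_netlim f l : summable f -> netlim f l -> ssum V f = l.
Proof. by move=> sf; apply: netlim_unique; exact: netlim_ssum. Qed.

End UnconditionalSums.

(** * Lattice coordinates and the Bloch transform *)

Section LatticeCoordinates.
Variables (R : realType) (d : nat) (a b : 'I_d -> 'rV[R]_d).
Hypothesis Ha_basis : basis_mx a \in unitmx.
Hypothesis Hdual : forall i j : 'I_d, dotp (a i) (b j) = 2 * pi * (i == j)%:R.
Implicit Types (u v w : 'rV[R]_d) (k l : 'I_d -> int) (th : 'I_d -> R).

Definition cd v : 'I_d -> R := fun i => coords a v 0 i.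

Lemma combE (y : 'I_d -> R) : \sum_i y i *: a i = (\row_i y i) *m basis_mx a.
Proof.
apply/rowP => j; rewrite summxE !mxE; apply: eq_bigr => i _; by rewrite !mxE.
Qed.

Lemma cdK v : \sum_i cd v i *: a i = v.
Proof.
rewrite combE /cd (_ : \row_i _ = coords a v); first by rewrite /coords mulmxKV.
by apply/rowP => j; rewrite mxE.
Qed.

Lemma cd_comb (y : 'I_d -> R) : cd (\sum_i y i *: a i) = y.
Proof. by apply/funext => i; rewrite /cd /coords combE mulmxK // mxE. Qed.

Lemma cd_inj u v : cd u = cd v -> u = v.
Proof. by move=> H; rewrite -(cdK u) -(cdK v) H. Qed.

Lemma cdD u v i : cd (u + v) i = cd u i + cd v i.
Proof. by rewrite /cd /coords mulmxDl mxE. Qed.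

Lemma cdB u v i : cd (u - v) i = cd u i - cd v i.
Proof. by rewrite /cd /coords mulmxBl !mxE. Qed.

Lemma cdZ (r : R) v i : cd (r *: v) i = r * cd v i.
Proof. by rewrite /cd /coords -scalemxAl mxE. Qed.

Lemma cd_lattice k i : cd (lattice_pt a k) i = (k i)%:~R.
Proof. by rewrite /lattice_pt cd_comb. Qed.

Lemma dotp_thb th v : dotp (thb b th) v = 2 * pi * lin th (cd v).
Proof.
rewrite -[v in LHS]cdK /dotp /thb.
have -> : \sum_(j < d) (\sum_i th i *: b i) 0 j * (\sum_i cd v i *: a i) 0 j =
    \sum_i \sum_l th i * cd v l * dotp (a l) (b i).
  under eq_bigr => j _.
    rewrite !summxE mulr_suml; under eq_bigr => i _ do rewrite mulr_sumr; over.
  rewrite exchange_big; apply: eq_bigr => i _; rewrite exchange_big; apply: eq_bigr => l _ /=.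
  by rewrite mulr_sumr; apply: eq_bigr => j _; rewrite !mxE; ring.
rewrite mulr_sumr; apply: eq_bigr => i _; rewrite (bigD1 i) //= big1 => [|l li].
  by rewrite addr0 Hdual eqxx mulr1; ring.
by rewrite Hdual (negbTE li) !mulr0.
Qed.

Lemma fracptE v : fracpt a v = v - lattice_pt a (fun i => Num.floor (cd v i)).
Proof.
apply: cd_inj; apply/funext => i; rewrite cdB cd_lattice /fracpt cd_comb //.
Qed.

Lemma cd_fracpt v i : cd (fracpt a v) i = cd v i - (Num.floor (cd v i))%:~R.
Proof. by rewrite fracptE cdB cd_lattice. Qed.

Lemma fracpt_lattice v k : fracpt a (v + lattice_pt a k) = fracpt a v.
Proof.
apply: cd_inj; apply/funext => i; rewrite !cd_fracpt !cdD cd_lattice.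
by rewrite floorDrz ?intr_int // intrKfloor intrD opprD addrACA subrr addr0.
Qed.

Lemma fracpt_cell v : cellA a v -> fracpt a v = v.
Proof.
move=> cv; apply: cd_inj; apply/funext => i; rewrite cd_fracpt.
rewrite (_ : Num.floor _ = 0) ?subr0 //; apply: floor_def; exact: cv.
Qed.

Lemma cell_fracpt v : cellA a (fracpt a v).
Proof.
move=> i; rewrite -/(cd _ i) cd_fracpt.
by have /andP[h1 h2] := floor_itv (cd v i); rewrite intrD in h2; apply/andP; split; lra.
Qed.

Lemma fracpt_eq u v : fracpt a u = fracpt a v -> exists k, v = u + lattice_pt a k.
Proof.
rewrite !fracptE => H; exists (fun i => Num.floor (cd v i) - Num.floor (cd u i)).
have -> : lattice_pt a (fun i => Num.floor (cd v i) - Num.floor (cd u i)) =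
    lattice_pt a (fun i => Num.floor (cd v i)) - lattice_pt a (fun i => Num.floor (cd u i)).
  by rewrite /lattice_pt -sumrB; apply: eq_bigr => i _; rewrite intrD rmorphN scalerBl.
by rewrite addrA addrAC H subrK.
Qed.

End LatticeCoordinates.

(** * The periodic graph and the Bloch transform of finite states *)

Section Crystal.
Variables (R : realType) (d : nat) (a b : 'I_d -> 'rV[R]_d).
Hypothesis Ha_basis : basis_mx a \in unitmx.
Hypothesis Hdual : forall i j : 'I_d, dotp (a i) (b j) = 2 * pi * (i == j)%:R.
Variables (V : set 'rV[R]_d) (adj : 'rV[R]_d -> 'rV[R]_d -> Prop).
Hypothesis Hadj_V : forall u v, adj u v -> V u /\ V v.
Hypothesis Hadj_sym : forall u v, adj u v -> adj v u.
Hypothesis Hlocfin : forall v, V v -> finite_set [set u | adj v u].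
Hypothesis HV_per : forall i v, V (v + a i) <-> V v.
Hypothesis Hadj_per : forall i u v, adj (u + a i) (v + a i) <-> adj u v.
Variable Q : 'rV[R]_d -> R.
Hypothesis HQ_per : forall i v, V v -> Q (v + a i) = Q v.
Variables (nu : nat) (vf : 'I_nu -> 'rV[R]_d).
Hypothesis Hvf_inj : injective vf.
Hypothesis Hvf : forall v, (V `&` cellA a) v <-> exists n, vf n = v.
Implicit Types (u v w : 'rV[R]_d) (k l : 'I_d -> int) (th : 'I_d -> R).
Implicit Types (s : seq ('rV[R]_d * R[i])) (f : 'rV[R]_d -> R[i]).

(** The step is an equivalence, so it can be walked in both directions and reaches negative
    coefficients. *)
Lemma lattice_ind (P : 'rV[R]_d -> Prop) : P 0 ->
  (forall i w, P w <-> P (w + a i)) -> forall k, P (lattice_pt a k).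
Proof.
move=> P0 PS k; rewrite /lattice_pt.
suff H (r : seq 'I_d) : P (\sum_(i <- r) (k i)%:~R *: a i) by exact: H.
elim: r => [|i r IH]; first by rewrite big_nil.
rewrite big_cons; move: (\sum_(j <- r) _) IH => w Pw.
have up n (x : 'rV[R]_d) : P x <-> P (x + n%:R *: a i).
  elim: n => [|n IH]; first by rewrite scale0r addr0.
  by rewrite -natr1 scalerDl scale1r addrA -PS.
case: (k i) => n; first by rewrite addrC -[Posz n]/(n%:Z) -up.
by rewrite addrC NegzE rmorphN scaleNr (up n.+1) /= subrK.
Qed.

Lemma V_lattice k v : V (v + lattice_pt a k) <-> V v.
Proof.
apply: (lattice_ind (P := fun w => V (v + w) <-> V v)); first by rewrite addr0.
by move=> i w; rewrite addrA HV_per.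
Qed.

Lemma adj_lattice k u v : adj (u + lattice_pt a k) (v + lattice_pt a k) <-> adj u v.
Proof.
apply: (lattice_ind (P := fun w => adj (u + w) (v + w) <-> adj u v)); first by rewrite !addr0.
by move=> i w; rewrite !addrA Hadj_per.
Qed.

Lemma Q_lattice k v : V v -> Q (v + lattice_pt a k) = Q v.
Proof.
move=> Vv; suff [_ //] : V (v + lattice_pt a k) /\ Q (v + lattice_pt a k) = Q v.
apply: (lattice_ind (P := fun w => V (v + w) /\ Q (v + w) = Q v)); first by rewrite addr0.
move=> i w; rewrite addrA; split=> [[Vw Qw]|[/HV_per Vw Qw]].
  by split; [exact/HV_per|rewrite HQ_per].
by split=> //; rewrite -Qw HQ_per.
Qed.

Lemma vf_VC n : V (vf n) /\ cellA a (vf n).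
Proof. by have [_ H] := Hvf (vf n); apply: H; exists n. Qed.

Lemma vf_fracpt n k : fracpt a (vf n + lattice_pt a k) = vf n.
Proof. by rewrite fracpt_lattice // fracpt_cell //; have [] := vf_VC n. Qed.

Lemma fracpt_vf n : fracpt a (vf n) = vf n.
Proof. by rewrite fracpt_cell //; have [] := vf_VC n. Qed.

Lemma V_fracpt v : V v -> exists n, fracpt a v = vf n.
Proof.
move=> Vv; have [H _] := Hvf (fracpt a v); case: H => [|n nP]; last by exists n.
split; last exact: cell_fracpt.
have [k ->] : exists k, fracpt a v = v + lattice_pt a k.
  by apply: fracpt_eq => //; rewrite [RHS]fracpt_cell //; exact: cell_fracpt.
exact/V_lattice.
Qed.

Lemma V_decomp v : V v -> exists n k, v = vf n + lattice_pt a k.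
Proof.
move=> /V_fracpt[n nP]; have [k kP] : exists k, v = vf n + lattice_pt a k.
  by apply: fracpt_eq => //; rewrite fracpt_vf.
by exists n, k.
Qed.

Definition nb v : seq 'rV[R]_d := finmap.enum_fset (fset_set [set u | adj v u]).

Lemma mem_nb v u : V v -> (u \in nb v) <-> adj v u.
Proof.
move=> Vv; have -> : (u \in nb v) = (u \in [set u | adj v u]) := in_fset_set (Hlocfin Vv) u.
by split=> [/set_mem|h]; [|exact: mem_set].
Qed.

Lemma uniq_nb v : uniq (nb v). Proof. exact: finmap.fset_uniq. Qed.

Lemma nb_lattice v k : V v ->
  perm_eq (nb (v + lattice_pt a k)) [seq w + lattice_pt a k | w <- nb v].
Proof.
move=> Vv; apply: uniq_perm; first exact: uniq_nb.
  by rewrite map_inj_uniq ?uniq_nb //; exact: addIr.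
have Vk : V (v + lattice_pt a k) by exact/V_lattice.
move=> u; apply/idP/idP => [/(mem_nb _ Vk) h|/mapP[w /(mem_nb _ Vv) h ->]].
  apply/mapP; exists (u - lattice_pt a k); last by rewrite subrK.
  by apply/(mem_nb _ Vv)/(adj_lattice k); rewrite subrK.
by apply/(mem_nb _ Vk)/adj_lattice.
Qed.

Lemma HopE f v : V v -> Hop adj Q f v = \sum_(u <- nb v) f u + (Q v)%:C%C * f v.
Proof. by move=> Vv; rewrite /Hop fsbig_finite //; exact: Hlocfin. Qed.

Lemma eq_Hop f g v : V v -> (forall u, V u -> f u = g u) -> Hop adj Q f v = Hop adj Q g v.
Proof.
move=> Vv fg; rewrite !HopE // fg //; congr (_ + _).
by apply: eq_big_seq => u /(mem_nb _ Vv)/Hadj_V[_ Vu]; exact: fg.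
Qed.

(** A list stands for a formal sum of weighted point masses, repeated vertices adding up. Such lists
    are stable under the Hamiltonian and have finite Bloch sums. *)
Definition lfun s v : R[i] := \sum_(p <- s) p.2 * (p.1 == v)%:R.

Definition fourier s th : 'cV[R[i]]_nu := \col_n
  \sum_(p <- s) p.2 * (if fracpt a p.1 == vf n then expi (- dotp (thb b th) p.1) else 0).

Definition Hlist s : seq ('rV[R]_d * R[i]) :=
  flatten [seq (p.1, (Q p.1)%:C%C * p.2) :: [seq (w, p.2) | w <- nb p.1] | p <- s].

Definition onV s := forall p, p \in s -> V p.1.

Lemma big_Hlist (T : nmodType) (F : 'rV[R]_d * R[i] -> T) s :
  \sum_(p <- Hlist s) F p =
  \sum_(p <- s) (F (p.1, (Q p.1)%:C%C * p.2) + \sum_(w <- nb p.1) F (w, p.2)).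
Proof.
rewrite /Hlist big_flatten big_map; apply: eq_bigr => p _.
by rewrite big_cons big_map.
Qed.

Lemma onV_Hlist s : onV s -> onV (Hlist s).
Proof.
move=> sV p /flattenP[r /mapP[q qs ->]]; rewrite inE => /orP[/eqP->|]; first exact: (sV q).
by move=> /mapP[w /(mem_nb _ (sV _ qs))/Hadj_V[_ Vw] ->].
Qed.

Lemma sum_eq_uniq (r : seq 'rV[R]_d) u : uniq r ->
  \sum_(w <- r) (w == u)%:R = (u \in r)%:R :> R[i].
Proof.
elim: r => [|x r IH] /=; first by rewrite big_nil.
move=> /andP[xr /IH]; rewrite big_cons inE => ->; rewrite eq_sym.
by case: eqP => [->|_]; rewrite ?(negbTE xr) ?addr0 ?add0r.
Qed.

(** [Hlist] pushes the mass of a vertex to its neighbours while [Hop] collects values from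
    neighbours; symmetry of [adj] makes the two agree. *)
Lemma Hop_lfun s v : onV s -> V v -> Hop adj Q (lfun s) v = lfun (Hlist s) v.
Proof.
move=> sV Vv; rewrite HopE // /lfun big_Hlist /= exchange_big /= mulr_sumr -big_split /=.
apply: eq_big_seq => p ps; have Vp := sV _ ps; rewrite addrC; congr (_ + _).
  by case: eqP => [->|_]; rewrite ?mulr1 // !mulr0.
rewrite -mulr_sumr -[RHS]mulr_sumr; congr (_ * _).
under eq_bigr do rewrite eq_sym.
rewrite !sum_eq_uniq ?uniq_nb //; congr (nat_of_bool _)%:R.
by apply/idP/idP => /mem_nb h; apply/mem_nb => //; apply: Hadj_sym; exact: h.
Qed.

Lemma bloch_mxE th n m : bloch_mx a adj Q vf (thb b th) n m =
  \sum_(u <- nb (vf n) | fracpt a u == vf m) expi (dotp (thb b th) (u - vf n)) +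
  (n == m)%:R * (Q (vf n))%:C%C.
Proof.
rewrite mxE; congr (_ + _); rewrite fsbig_finite; last by apply: Hlocfin; have [] := vf_VC n.
by rewrite [RHS]big_mkcond.
Qed.

Lemma dotpD x u v : dotp x (u + v) = dotp x u + dotp x v.
Proof. by rewrite -big_split; apply: eq_bigr => i _; rewrite mxE mulrDr. Qed.

Lemma dotpB x u v : dotp x (u - v) = dotp x u - dotp x v.
Proof. by rewrite -sumrB; apply: eq_bigr => i _; rewrite !mxE mulrBr. Qed.

(** The reflection [w |-> p + vf n - w] exchanges the neighbours of [p] in the class of [vf n] with
    the neighbours of [vf n] in the class of [p]: it amounts to translating the edge back to the
    fundamental cell. *)
Lemma neighbour_phase_sum th n p : V p ->
  \sum_(w <- nb p | fracpt a w == vf n) expi (- dotp (thb b th) w) =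
  \sum_(u <- nb (vf n) | fracpt a u == fracpt a p)
     expi (dotp (thb b th) (u - vf n)) * expi (- dotp (thb b th) p).
Proof.
move=> Vp; have [Vn _] := vf_VC n.
pose phi (w : 'rV[R]_d) := p + vf n - w.
have phiK : involutive phi by move=> w; rewrite /phi opprB addrC subrK.
rewrite -[LHS]big_filter -[RHS]big_filter.
have E : perm_eq [seq u <- nb (vf n) | fracpt a u == fracpt a p]
    [seq phi w | w <- nb p & fracpt a w == vf n].
  apply: uniq_perm; first by rewrite filter_uniq ?uniq_nb.
    by rewrite (map_inj_uniq (inv_inj phiK)) filter_uniq ?uniq_nb.
  move=> u; rewrite mem_filter; apply/idP/mapP => [/andP[/eqP fu /(mem_nb _ Vn) un]|[w]].
    exists (phi u); last by rewrite phiK.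
    have [k pk] := fracpt_eq Ha_basis fu.
    have -> : phi u = vf n + lattice_pt a k.
      by rewrite /phi pk; apply/rowP => j; rewrite !mxE; ring.
    rewrite mem_filter vf_fracpt eqxx /=; apply/(mem_nb _ Vp)/Hadj_sym.
    by rewrite pk; apply/adj_lattice.
  rewrite mem_filter => /andP[/eqP fw /(mem_nb _ Vp) pw] ->.
  have [k wk] : exists k, w = vf n + lattice_pt a k.
    by apply: fracpt_eq => //; rewrite fracpt_vf.
  have pu : p = phi w + lattice_pt a k.
    by rewrite /phi wk; apply/rowP => j; rewrite !mxE; ring.
  have -> : fracpt a p = fracpt a (phi w) by rewrite {1}pu fracpt_lattice.
  rewrite eqxx /=; apply/(mem_nb _ Vn)/(adj_lattice k).
  by rewrite -pu -wk; exact: Hadj_sym.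
rewrite (perm_big _ E) big_map; apply: eq_bigr => w _; rewrite -expiD; congr expi.
by rewrite /phi !dotpB dotpD; ring.
Qed.

(** The Bloch transform intertwines the two Hamiltonians, checked one point mass at a time; a point
    mass occupies a single column of the Bloch matrix. *)
Lemma fourier_Hlist s th : onV s ->
  fourier (Hlist s) th = bloch_mx a adj Q vf (thb b th) *m fourier s th.
Proof.
move=> sV; apply/colP => n; rewrite !mxE big_Hlist /=.
have fE j : fourier s th j 0 =
  \sum_(p <- s) p.2 * (if fracpt a p.1 == vf j then expi (- dotp (thb b th) p.1) else 0) by rewrite mxE.
under [RHS]eq_bigr do rewrite fE mulr_sumr.
rewrite exchange_big /=; apply: eq_big_seq => p ps; have Vp := sV _ ps.
have [m fm] := V_fracpt Vp.
rewrite [RHS](bigD1 m) //= [X in _ = _ + X]big1 ?addr0 => [|l lm]; last first.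
  by rewrite fm (inj_eq Hvf_inj) eq_sym (negbTE lm) !mulr0.
rewrite bloch_mxE fm eqxx mulrDl addrC; congr (_ + _).
  transitivity (p.2 * \sum_(w <- nb p.1 | fracpt a w == vf n) expi (- dotp (thb b th) w)).
    by rewrite mulr_sumr [RHS]big_mkcond; apply: eq_bigr => w _; case: ifP; rewrite ?mulr0.
  by rewrite neighbour_phase_sum // fm -mulr_suml mulrCA.
rewrite (inj_eq Hvf_inj) eq_sym; case: eqP => [nm|_]; last by rewrite mulr0 !mul0r.
have -> : Q p.1 = Q (vf n).
  have [k ->] : exists k, p.1 = vf n + lattice_pt a k.
    by apply: fracpt_eq => //; rewrite fracpt_vf fm nm.
  by rewrite Q_lattice //; have [] := vf_VC n.
by rewrite mul1r mulrA.
Qed.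

End Crystal.

(** * The exponential series *)

Section ExponentialSeries.
Variable R : realType.
Implicit Types (t x r : R) (c : nat -> R[i]) (k K N : nat).

Definition exp_coef t k : R[i] := (- 'i * t%:C%C) ^+ k / (k`!)%:R.

Definition exp_rem r K : R := expR r - \sum_(k < K) exp_coeff r k.

Lemma natrC (n : nat) : n%:R = (n%:R)%:C%C :> R[i].
Proof. by rewrite rmorph_nat. Qed.

Lemma exp_coef_real t k : exp_coef t k = (- 'i) ^+ k * (exp_coeff t k)%:C%C.
Proof.
by rewrite /exp_coef exprMn -mulrA /exp_coeff /= natrC -rmorphXn -fmorphV -rmorphM.
Qed.

Lemma cnormX z k : cnorm (z ^+ k) = cnorm z ^+ k :> R.
Proof.
elim: k => [|k IH]; first by rewrite !expr0 -expi0 cnorm_expi.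
by rewrite !exprS cnormM IH.
Qed.

Lemma cnorm_exp_coef t k : cnorm (exp_coef t k) = exp_coeff `|t| k.
Proof.
have i1 : cnorm (- 'i : R[i]) = 1.
  by rewrite cnormN -complexiE /cnorm /cabs2 /= expr0n add0r expr1n sqrtr1.
rewrite exp_coef_real cnormM cnormX i1 expr1n mul1r cnormr /exp_coeff /=.
by rewrite normrM normrX normfV normr_nat.
Qed.

Lemma exp_coefM t x k : exp_coef t k * x%:C%C ^+ k = exp_coef (t * x) k.
Proof. by rewrite /exp_coef mulrAC -exprMn rmorphM mulrA. Qed.

Lemma Re_Im_exp_coef t k :
  complex.Re (exp_coef t k) = cos_coeff t k /\ complex.Im (exp_coef t k) = - sin_coeff t k.
Proof.
have sqi : (- 'i) ^+ 2 = ((-1)%:C)%C :> R[i] by rewrite sqrrN sqrCi rmorphN1.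
have i1 : - 'i = (0 -i* 1)%C :> R[i].
    by rewrite -complexiE; apply: complex_inj; rewrite /= ?oppr0.
have E : exp_coef t k = (- 'i) ^+ odd k * ((-1) ^+ k./2 * exp_coeff t k)%:C%C.
  rewrite exp_coef_real -{1}(odd_double_half k) exprD -muln2 mulnC exprM sqi -rmorphXn.
  by rewrite -mulrA -rmorphM.
rewrite E mulrC ReMr ImMr /cos_coeff /sin_coeff /exp_coeff /=.
case: (boolP (odd k)) => ok /=.
  rewrite oppr0 mulr0 !mul0r mul1r mulrN1 -mulrA; split=> //.
  by congr (- (_ ^+ _ * _)); case: k ok {E} => //= k; rewrite uphalf_half => /negbTE->.
by rewrite !mulr0 !mul0r oppr0 mulr1 !mul1r mulrA.
Qed.

Lemma exp_rem_ge0 r K : 0 <= r -> 0 <= exp_rem r K.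
Proof.
move=> r0; rewrite /exp_rem subr_ge0 /expR.
have h := @is_cvg_series_exp_coeff R r.
rewrite -[leLHS](big_mkord predT (exp_coeff r)); apply: nondecreasing_cvgn_le => //.
apply: nondecreasing_series => n _ _; exact: exp_coeff_ge0.
Qed.

Lemma exp_rem_cvg0 r : exp_rem r K @[K --> \oo] --> 0.
Proof.
rewrite -[0](subrr (expR r)); apply: cvgB; first exact: cvg_cst.
have := @is_cvg_series_exp_coeff R r; rewrite /expR /series /=.
rewrite (_ : (fun n : nat => \sum_(0 <= k < n) _) = fun n => \sum_(k < n) exp_coeff r k) //.
by apply/funext => n; rewrite big_mkord.
Qed.

Lemma exp_rem_le r K : 0 <= r -> exp_rem r K <= expR r.
Proof.
move=> r0; rewrite /exp_rem gerBl sumr_ge0 // => k _; exact: exp_coeff_ge0.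
Qed.

(** Real and imaginary limits are separate, as in [evol]. Keeping the scalar remainder as the bound
    lets one estimate serve both the evolution and [expi]. *)
Lemma exp_dominated_series c (A r : R) : 0 <= A -> 0 <= r ->
  (forall k, cnorm (c k) <= A * exp_coeff r k) -> forall K,
  cnorm (\sum_(k < K) c k - (limn (fun N => complex.Re (\sum_(k < N) c k)) +i*
    limn (fun N => complex.Im (\sum_(k < N) c k)))%C) <= A * exp_rem r K.
Proof.
move=> A0 r0 cA K.
have cvgser (f : nat -> R) : (forall k, `|f k| <= A * exp_coeff r k) ->
    cvgn (fun N => \sum_(k < N) f k).
  move=> fA; have : cvgn (series f).
    apply: normed_cvg; apply: (series_le_cvg (v_ := fun k => A * exp_coeff r k)) => //.
      by move=> n /=.
      by move=> n; rewrite mulr_ge0 // exp_coeff_ge0.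
    apply: (@is_cvg_seriesZ _ _ A); exact: is_cvg_series_exp_coeff.
  by rewrite /series /=; under eq_fun do rewrite big_mkord.
have cRe : (fun N => complex.Re (\sum_(k < N) c k)) = fun N => \sum_(k < N) complex.Re (c k).
  by apply/funext => N; rewrite Re_sum.
have cIm : (fun N => complex.Im (\sum_(k < N) c k)) = fun N => \sum_(k < N) complex.Im (c k).
  by apply/funext => N; rewrite Im_sum.
have hRe : cvgn (fun N => complex.Re (\sum_(k < N) c k)).
  by rewrite cRe; apply: (cvgser (fun k => complex.Re (c k))) => k; apply: le_trans (Re_le_cnorm _) (cA k).
have hIm : cvgn (fun N => complex.Im (\sum_(k < N) c k)).
  by rewrite cIm; apply: (cvgser (fun k => complex.Im (c k))) => k; apply: le_trans (Im_le_cnorm _) (cA k).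
set l := (X in _ - X); apply/ler_addgt0Pr => e e0.
have e20 : 0 < e / 2 by rewrite divr_gt0.
have : \forall N \near \oo, [/\ `|complex.Re l - complex.Re (\sum_(k < N) c k)| < e / 2,
    `|complex.Im l - complex.Im (\sum_(k < N) c k)| < e / 2 & (K <= N)%N].
  near=> N; split.
  - by near: N; move/cvgrPdist_lt: hRe => /(_ _ e20).
  - by near: N; move/cvgrPdist_lt: hIm => /(_ _ e20).
  - by near: N; exact: nbhs_infty_ge.
move=> /filter_ex[N [h1 h2 KN]].
have -> : \sum_(k < K) c k - l = - \sum_(K <= k < N) c k - (l - \sum_(k < N) c k).
  have -> : \sum_(k < N) c k = \sum_(k < K) c k + \sum_(K <= k < N) c k.
    by rewrite -!(big_mkord predT c) (big_cat_nat _ KN).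
  by rewrite opprB addrA [_ + \sum_(K <= k < N) _]addrC addKr.
apply: le_trans (ler_cnormD _ _) _; rewrite !cnormN; apply: lerD; last first.
  apply: le_trans (cnorm_le_ReIm _) _; rewrite !ReD !ImD !ReN !ImN; move: h1 h2; lra.
apply: le_trans (ler_cnorm_sum _ _ _) _.
apply: (@le_trans _ _ (\sum_(K <= k < N) A * exp_coeff r k)); first by apply: ler_sum => k _.
rewrite -mulr_sumr ler_wpM2l //; have := exp_rem_ge0 N r0; rewrite /exp_rem.
rewrite -!(big_mkord predT (exp_coeff r)) (big_cat_nat _ KN) //=; lra.
Unshelve. all: by end_near. Qed.

Lemma exp_partial_dist t r K : `|t| <= r ->
  cnorm (\sum_(k < K) exp_coef t k - expi (- t)) <= exp_rem r K.
Proof.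
move=> tr; have r0 : 0 <= r by apply: le_trans tr.
have -> : expi (- t) = (limn (fun N => complex.Re (\sum_(k < N) exp_coef t k)) +i*
    limn (fun N => complex.Im (\sum_(k < N) exp_coef t k)))%C.
  rewrite /expi cosN sinN; congr (_ +i* _)%C.
    rewrite unlock; congr (limn _); apply/funext => N; rewrite Re_sum /series /= big_mkord.
    by apply: eq_bigr => k _; have [-> _] := Re_Im_exp_coef t k.
  rewrite unlock -limN; last exact: is_cvg_series_sin_coeff.
  congr (limn _); apply/funext => N; rewrite Im_sum fctE /series /= big_mkord -sumrN.
  by apply: eq_bigr => k _; have [_ ->] := Re_Im_exp_coef t k.
rewrite -[exp_rem r K]mul1r; apply: exp_dominated_series => // k.
rewrite mul1r cnorm_exp_coef /exp_coeff /= ler_wpM2r ?invr_ge0 //.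
by apply: lerXn2r; rewrite ?nnegrE.
Qed.

End ExponentialSeries.

(** * Exponential weights *)

Section Boxes.
Variables (R : realType) (d : nat) (a b : 'I_d -> 'rV[R]_d).
Hypothesis Ha_basis : basis_mx a \in unitmx.
Hypothesis Hdual : forall i j : 'I_d, dotp (a i) (b j) = 2 * pi * (i == j)%:R.
Variables (V : set 'rV[R]_d) (adj : 'rV[R]_d -> 'rV[R]_d -> Prop).
Hypothesis Hadj_V : forall u v, adj u v -> V u /\ V v.
Hypothesis Hadj_sym : forall u v, adj u v -> adj v u.
Hypothesis Hlocfin : forall v, V v -> finite_set [set u | adj v u].
Hypothesis HV_per : forall i v, V (v + a i) <-> V v.
Hypothesis Hadj_per : forall i u v, adj (u + a i) (v + a i) <-> adj u v.
Variable Q : 'rV[R]_d -> R.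
Hypothesis HQ_per : forall i v, V v -> Q (v + a i) = Q v.
Variables (nu : nat) (vf : 'I_nu -> 'rV[R]_d).
Hypothesis Hvf_inj : injective vf.
Hypothesis Hvf : forall v, (V `&` cellA a) v <-> exists n, vf n = v.
Implicit Types (u v w : 'rV[R]_d) (k l : 'I_d -> int) (N M : nat).

(** Enumerates exactly the points of the sums [Upartial], so the transform of a truncated state is
    such a partial sum. *)
Definition bx N : seq 'rV[R]_d :=
  [seq vf n + lattice_pt a (@boxpt d N j) | n <- enum 'I_nu,
     j <- enum {: {ffun 'I_d -> 'I_(2 * N).+1} }].

Lemma vf_lattice_inj n m k l :
  vf n + lattice_pt a k = vf m + lattice_pt a l -> n = m /\ k = l.
Proof.
move=> H; have nm : n = m.
  by apply: Hvf_inj; rewrite -(vf_fracpt Ha_basis Hvf n k) H (vf_fracpt Ha_basis Hvf).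
split=> //; move: H; rewrite nm => /addrI H; apply/funext => i.
by apply: (@intr_inj R); rewrite -!(cd_lattice Ha_basis) H.
Qed.

Lemma boxpt_inj N : injective (@boxpt d N).
Proof.
move=> k l H; apply/ffunP => i; apply/val_inj.
have := congr1 (fun f => f i) H; rewrite /boxpt => /addIr; by case.
Qed.

Lemma uniq_bx N : uniq (bx N).
Proof.
apply: allpairs_uniq; rewrite ?enum_uniq // => -[n k] [m l] _ _ /= /vf_lattice_inj[-> /boxpt_inj->].
by [].
Qed.

Lemma mem_bx N v : (v \in bx N) <->
  exists n k, v = vf n + lattice_pt a k /\ forall i, (`|k i| <= N)%N.
Proof.
split=> [/allpairsP[[n k] /= [_ _ ->]]|[n [k [-> kN]]]].
  exists n, (boxpt k); split=> // i; rewrite /boxpt; case: (k i) => j /= jN; lia.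
have lt i : (absz (k i + N%:Z)%R < (2 * N).+1)%N by have := kN i; lia.
pose h : {ffun 'I_d -> 'I_(2 * N).+1} := [ffun i => Ordinal (lt i)].
have -> : k = boxpt h.
  by apply/funext => i; rewrite /boxpt ffunE /=; have := kN i; lia.
by apply/allpairsP; exists (n, h); rewrite !mem_enum.
Qed.

Lemma bx_mono N M : (N <= M)%N -> {subset bx N <= bx M}.
Proof.
move=> NM v /mem_bx[n [k [-> kN]]]; apply/mem_bx; exists n, k; split=> // i.
exact: leq_trans (kN i) NM.
Qed.

Lemma bx_V N : seq_in V (bx N).
Proof.
split; first exact: uniq_bx.
move=> v /mem_bx[n [k [-> _]]]; apply/(V_lattice HV_per); exact: (vf_VC Hvf n).1.
Qed.

Lemma sub_bx B : seq_in V B -> exists N0, forall N, (N0 <= N)%N -> {subset B <= bx N}.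
Proof.
move=> [_]; elim: B => [|v B IH] BV; first by exists 0%N.
have [N1 N1P] := IH (fun u uB => BV u (mem_behead (s := v :: B) uB)).
have [n [k vE]] := V_decomp Ha_basis HV_per Hvf (BV v (mem_head _ _)).
exists (maxn N1 (\max_i `|k i|)%N) => N; rewrite geq_max => /andP[h1 h2] u.
rewrite inE => /orP[/eqP->|]; last exact: N1P.
apply/mem_bx; exists n, k; split=> // i; apply: leq_trans h2.
exact: (leq_bigmax (F := fun i => `|k i|%N)).
Qed.

Lemma big_bx (T : nmodType) N (F : 'rV[R]_d -> T) :
  \sum_(v <- bx N) F v = \sum_n \sum_(k : {ffun 'I_d -> 'I_(2 * N).+1}) F (vf n + lattice_pt a (boxpt k)).
Proof.
rewrite /bx big_allpairs_dep big_enum; apply: eq_bigr => n _; by rewrite big_enum.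
Qed.

(** Chosen to be summable over [V] and to change by a bounded factor along edges. *)
Definition weight v : R := expR (- \sum_i `|cd a v i|).

Lemma weight_ge0 v : 0 <= weight v. Proof. exact: expR_ge0. Qed.

(** In fact an equality; the subtracted term carries the induction. *)
Lemma geometric_box N : \sum_(j < (2 * N).+1) 2^-1 ^+ `|j%:Z - N%:Z|%N <= 3 - 2 * 2^-1 ^+ N :> R.
Proof.
elim: N => [|N IH].
  rewrite muln0 big_ord1 (_ : absz _ = 0%N) // !expr0; lra.
have -> : (2 * N.+1).+1 = (2 * N).+1.+2 by lia.
rewrite big_ord_recl big_ord_recr /=.
have -> : \sum_(i < (2 * N).+1) 2^-1 ^+ `|(lift ord0 (widen_ord (leqnSn (2 * N).+1) i))%:Z - N.+1%:Z|%N =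
    \sum_(j < (2 * N).+1) 2^-1 ^+ `|j%:Z - N%:Z|%N :> R.
  by apply: eq_bigr => j _; congr (_ ^+ _); rewrite /= /bump /=; lia.
rewrite subn0 (_ : absz _ = N.+1); last by rewrite /bump /=; lia.
by move: IH; rewrite exprS; lra.
Qed.

Lemma expR_int_le (c : R) (j : int) : 0 <= c < 1 ->
  expR (- `|c + j%:~R|) <= expR 1 * 2^-1 ^+ `|j|%N.
Proof.
move=> /andP[c0 c1].
apply: (@le_trans _ _ (expR 1 * expR (- `|j|%N%:R))).
  rewrite -expRD ler_expR natr_absz intr_norm.
  have : `|j%:~R| <= `|c + j%:~R| + `|c| :> R.
    by have := ler_normB (c + j%:~R) c; rewrite addrAC subrr add0r.
  rewrite (ger0_norm c0); lra.
apply: ler_wpM2l; first exact: expR_ge0.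
rewrite -mulN1r mulrC expRM_natl; apply: lerXn2r; rewrite ?nnegrE ?expR_ge0 ?invr_ge0 //.
rewrite expRN lef_pV2 ?posrE ?expR_gt0 //.
by have := expR_ge1Dx (1 : R); rewrite [1 + 1](_ : _ = 2) //.
Qed.

Lemma weight_sum : exists2 W : R, 0 <= W & forall B, seq_in V B -> \sum_(v <- B) weight v <= W.
Proof.
(* Per coordinate, [e >= 2] gives a two-sided geometric series with sum at most 3, and the offset of
   [vf n] inside the cell costs a factor [e]. *)
exists (nu%:R * (expR 1 * 3) ^+ d); first by rewrite mulr_ge0 ?exprn_ge0 ?mulr_ge0 ?expR_ge0.
move=> B Bin; have [N NP] := sub_bx Bin.
apply: (@le_trans _ _ (\sum_(v <- bx N) weight v)).
  have [Bu _] := Bin; rewrite [leRHS](bigID (fun v => v \in B)) /= -[X in _ <= X + _]big_filter.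
  have -> : \sum_(v <- [seq v <- bx N | v \in B]) weight v = \sum_(v <- B) weight v.
    apply: perm_big; apply: uniq_perm; rewrite ?filter_uniq ?uniq_bx //.
    by move=> v; rewrite mem_filter; case: (boolP (v \in B)) => // /(NP _ (leqnn N)) ->.
  by rewrite lerDl sumr_ge0 // => v _; exact: weight_ge0.
rewrite big_bx mulr_natl -[nu in leRHS]card_ord -sumr_const; apply: ler_sum => n _.
apply: (@le_trans _ _ (\sum_(k : {ffun 'I_d -> 'I_(2 * N).+1})
   \prod_i (expR 1 * 2^-1 ^+ `|(k i)%:Z - N%:Z|%N))).
  apply: ler_sum => k _; rewrite /weight -sumrN expR_sum; apply: ler_prod => i _.
  rewrite expR_ge0 /= cdD cd_lattice //; apply: expR_int_le.
  by have [_ /(_ i)] := vf_VC Hvf n.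
rewrite -(bigA_distr_bigA (fun i (j : 'I_(2 * N).+1) => expR 1 * 2^-1 ^+ `|j%:Z - N%:Z|%N)).
rewrite -[d in _ ^+ d]card_ord -prodr_const; apply: ler_prod => i _.
rewrite sumr_ge0 /= => [|j _]; last by rewrite mulr_ge0 ?expR_ge0 ?exprn_ge0 ?invr_ge0.
rewrite -mulr_sumr; apply: ler_wpM2l; first exact: expR_ge0.
apply: le_trans (geometric_box N) _; rewrite gerBl mulr_ge0 // exprn_ge0 // invr_ge0 //.
Qed.

(** By periodicity every edge is a translate of one starting in the cell, so finitely many
    displacements occur; [r] dominates the length of each. *)
Lemma neighbour_weight : exists2 be : R, 0 <= be & forall v u, V v -> adj v u -> weight u <= be * weight v.
Proof.
pose r : R := \sum_n \sum_(w <- nb adj (vf n)) \sum_i `|cd a (w - vf n) i|.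
exists (expR r); first exact: expR_ge0.
move=> v u Vv vu; rewrite /weight -expRD ler_expR.
have [n [k vE]] := V_decomp Ha_basis HV_per Hvf Vv.
pose w := u - lattice_pt a k.
have wn : adj (vf n) w by apply/(adj_lattice Hadj_per k); rewrite -vE subrK.
have Vn := (vf_VC Hvf n).1.
have wnb : w \in nb adj (vf n) by apply/(mem_nb Hlocfin).
have wv : w - vf n = u - v.
  by rewrite /w vE opprD addrA addrAC.
have rP : \sum_i `|cd a (u - v) i| <= r.
  rewrite /r (bigD1 n) //= (big_rem w) //= wv -addrA lerDl addr_ge0 ?sumr_ge0 // => m _.
    exact: sumr_ge0.
  by apply: sumr_ge0 => x _; apply: sumr_ge0.
rewrite lerNl opprB lerBlDl; apply: le_trans (_ : \sum_i `|cd a (u - v) i| + \sum_i `|cd a u i| <= _).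
  rewrite -big_split; apply: ler_sum => i _ /=; rewrite cdB.
  have := ler_normB (cd a u i) (cd a u i - cd a v i); rewrite opprB addrCA subrr addr0; lra.
by rewrite lerD2r.
Qed.

End Boxes.

(** * The evolution of finitely supported states *)

Section Evolution.
Variables (R : realType) (d : nat) (a b : 'I_d -> 'rV[R]_d).
Hypothesis Ha_basis : basis_mx a \in unitmx.
Hypothesis Hdual : forall i j : 'I_d, dotp (a i) (b j) = 2 * pi * (i == j)%:R.
Variables (V : set 'rV[R]_d) (adj : 'rV[R]_d -> 'rV[R]_d -> Prop).
Hypothesis Hadj_V : forall u v, adj u v -> V u /\ V v.
Hypothesis Hadj_sym : forall u v, adj u v -> adj v u.
Hypothesis Hlocfin : forall v, V v -> finite_set [set u | adj v u].
Hypothesis HV_per : forall i v, V (v + a i) <-> V v.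
Hypothesis Hadj_per : forall i u v, adj (u + a i) (v + a i) <-> adj u v.
Variable Q : 'rV[R]_d -> R.
Hypothesis HQ_per : forall i v, V v -> Q (v + a i) = Q v.
Variables (nu : nat) (vf : 'I_nu -> 'rV[R]_d).
Hypothesis Hvf_inj : injective vf.
Hypothesis Hvf : forall v, (V `&` cellA a) v <-> exists n, vf n = v.
Implicit Types (u v w : 'rV[R]_d) (s : seq ('rV[R]_d * R[i])) (N M K : nat) (t r : R).

Definition lscale (z : R[i]) s : seq ('rV[R]_d * R[i]) := [seq (p.1, z * p.2) | p <- s].

Definition lpartial t K s : seq ('rV[R]_d * R[i]) :=
  flatten [seq lscale (exp_coef t k) (iter k (Hlist adj Q) s) | k <- iota 0 K].

Lemma big_lpartial (T : nmodType) (F : 'rV[R]_d * R[i] -> T) t K s :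
  \sum_(p <- lpartial t K s) F p =
  \sum_(k < K) \sum_(p <- iter k (Hlist adj Q) s) F (p.1, exp_coef t k * p.2).
Proof.
rewrite big_flatten big_map -{1}[K]subn0 -/(index_iota 0 K) big_mkord.
by apply: eq_bigr => k _; rewrite big_map.
Qed.

Lemma onV_iter k s : onV V s -> onV V (iter k (Hlist adj Q) s).
Proof. by move=> sV; elim: k => //= k IH; exact: (onV_Hlist Hadj_V Hlocfin IH). Qed.

Lemma onV_lpartial t K s : onV V s -> onV V (lpartial t K s).
Proof.
move=> sV p /flattenP[_ /mapP[k _ ->] /mapP[q qs ->]] /=.
exact: onV_iter qs.
Qed.

Lemma iter_Hop_lfun k s v : onV V s -> V v ->
  iter k (Hop adj Q) (lfun s) v = lfun (iter k (Hlist adj Q) s) v.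
Proof.
move=> sV; elim: k v => [//|k IH] v Vv /=.
rewrite (eq_Hop Hadj_V Hlocfin Q Vv (g := lfun (iter k (Hlist adj Q) s))) //.
by apply: (Hop_lfun Hadj_sym Hlocfin) => //; exact: onV_iter.
Qed.

Lemma lfun_lpartial t K s v : onV V s -> V v ->
  lfun (lpartial t K s) v = evol_partial adj Q t (lfun s) v K.
Proof.
move=> sV Vv; rewrite /lfun big_lpartial; apply: eq_bigr => k _.
rewrite (iter_Hop_lfun k sV Vv) /lfun mulr_sumr.
by apply: eq_bigr => p _; rewrite mulrA.
Qed.

Lemma fourier_lpartial E P t K s th : onV V s ->
  spectral E P (bloch_mx a adj Q vf (thb b th)) ->
  fourier a b vf (lpartial t K s) th =
  spec_fun P (fun n => \sum_(k < K) exp_coef (t * E n) k) (fourier a b vf s th).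
Proof.
move=> sV EPH.
have it k : fourier a b vf (iter k (Hlist adj Q) s) th =
    spec_fun P (fun n => (E n)%:C%C ^+ k) (fourier a b vf s th).
  elim: k => [|k IH] /=.
    by rewrite /spec_fun {1}(spec_resolution EPH (fourier a b vf s th)); apply: eq_bigr => n _; rewrite expr0 scale1r.
  rewrite (fourier_Hlist b Ha_basis Hadj_sym Hlocfin HV_per Hadj_per HQ_per Hvf_inj Hvf) //; last exact: onV_iter.
  rewrite IH (spec_fun_mul EPH); congr (spec_fun P _ _).
  by apply/funext => n; rewrite exprS.
transitivity (\sum_(k < K) exp_coef t k *: fourier a b vf (iter k (Hlist adj Q) s) th).
  apply/matrixP => m j; rewrite ord1 summxE mxE big_lpartial; apply: eq_bigr => k _.
  by rewrite !mxE mulr_sumr; apply: eq_bigr => p _; rewrite mulrA.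
under eq_bigr do rewrite it /spec_fun scaler_sumr.
rewrite exchange_big; apply: eq_bigr => n _; rewrite scaler_suml; apply: eq_bigr => k _.
by rewrite scalerA; congr (_ *: _); exact: exp_coefM.
Qed.

(** Boundedness of the Hamiltonian in a weighted sup norm. The constant [D] is common to all
    weights: it is used with the constant weight for convergence of the series and with [weight] for
    spreading. *)
Lemma Hop_bound : exists2 D : R, 0 <= D & forall (om : 'rV[R]_d -> R) (be A : R) f,
  0 <= be -> 0 <= A -> (forall v, 0 <= om v) ->
  (forall v u, V v -> adj v u -> om u <= be * om v) ->
  (forall v, V v -> cnorm (f v) <= A * om v) ->
  forall v, V v -> cnorm (Hop adj Q f v) <= A * (D * (be + 1)) * om v.
Proof.
exists (\sum_n ((size (nb adj (vf n)))%:R + `|Q (vf n)|)).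
  by apply: sumr_ge0 => n _; rewrite addr_ge0.
move=> om be A f be0 A0 om0 omadj fA v Vv.
have [n [k vE]] := V_decomp Ha_basis HV_per Hvf Vv.
have Vn := (vf_VC Hvf n).1.
have sz : size (nb adj v) = size (nb adj (vf n)).
  by rewrite vE (perm_size (nb_lattice Hlocfin HV_per Hadj_per k Vn)) size_map.
have Qv : Q v = Q (vf n) by rewrite vE (Q_lattice HV_per HQ_per).
set D := \sum__ _; pose Dn : R := (size (nb adj (vf n)))%:R + `|Q (vf n)|.
have DD : Dn <= D.
  by rewrite /D (bigD1 n) //= lerDl; apply: sumr_ge0 => m _; rewrite addr_ge0.
rewrite (HopE Hlocfin) //; apply: le_trans (ler_cnormD _ _) _.
apply: (@le_trans _ _ ((size (nb adj (vf n)))%:R * (be * A * om v) + `|Q (vf n)| * (A * om v))).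
  apply: lerD; last by rewrite cnormM cnormr Qv ler_wpM2l // fA.
  apply: le_trans (ler_cnorm_sum _ _ _) _.
  have <- : \sum_(u <- nb adj v) be * A * om v = (size (nb adj (vf n)))%:R * (be * A * om v).
    by rewrite big_const_seq count_predT iter_addr_0 sz mulr_natl.
  rewrite big_seq [leRHS]big_seq; apply: ler_sum => u.
  move=> /(mem_nb Hlocfin _ Vv) vu; have [_ Vu] := Hadj_V vu.
  apply: le_trans (fA _ Vu) _; rewrite [be * A]mulrC -mulrA ler_wpM2l //.
  exact: omadj.
have h0 : 0 <= A * om v by rewrite mulr_ge0.
have h1 : 0 <= be * (A * om v) by rewrite mulr_ge0.
apply: (@le_trans _ _ (Dn * (be * (A * om v) + A * om v))).
  rewrite /Dn -!mulrA mulrDl !mulrDr.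
  have : 0 <= (size (nb adj (vf n)))%:R * (A * om v) :> R by rewrite mulr_ge0.
  have : 0 <= `|Q (vf n)| * (be * (A * om v)) by rewrite mulr_ge0.
  lra.
apply: (@le_trans _ _ (D * (be * (A * om v) + A * om v))); first by rewrite ler_wpM2r ?addr_ge0.
by rewrite le_eqVlt; apply/orP; left; apply/eqP; ring.
Qed.

(** Iterating [Hop_bound] bounds the [k]-th power by [c ^+ k], so the series is dominated by an
    exponential. With a decaying weight, the growth [exp (r * t)] against the decay in space gives
    linear spreading. *)
Lemma evol_bound : exists2 D : R, 0 <= D & forall (om : 'rV[R]_d -> R) (be A : R) f,
  0 <= be -> 0 <= A -> (forall v, 0 <= om v) ->
  (forall v u, V v -> adj v u -> om u <= be * om v) ->
  (forall v, V v -> cnorm (f v) <= A * om v) ->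
  forall t v, V v ->
  (forall K, cnorm (evol_partial adj Q t f v K - evol adj Q t f v)
     <= A * om v * exp_rem (`|t| * (D * (be + 1))) K) /\
  cnorm (evol adj Q t f v) <= A * om v * expR (`|t| * (D * (be + 1))).
Proof.
have [D D0 DP] := Hop_bound; exists D => // om be A f be0 A0 om0 omadj fA t v Vv.
pose c := D * (be + 1); have c0 : 0 <= c by rewrite mulr_ge0 ?addr_ge0.
have it k u : V u -> cnorm (iter k (Hop adj Q) f u) <= A * c ^+ k * om u.
  elim: k u => [|k IH] u Vu /=; first by rewrite expr0 mulr1 fA.
  by rewrite exprSr mulrA; apply: DP => //; rewrite mulr_ge0 ?exprn_ge0.
have main K : cnorm (evol_partial adj Q t f v K - evol adj Q t f v)
     <= A * om v * exp_rem (`|t| * c) K.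
  apply: (@exp_dominated_series _ (fun k => exp_coef t k * iter k (Hop adj Q) f v)).
  - by rewrite mulr_ge0.
  - by rewrite mulr_ge0.
  move=> k; rewrite cnormM cnorm_exp_coef.
  apply: le_trans (ler_wpM2l _ (it k v Vv)) _; first by rewrite exp_coeff_ge0.
  rewrite le_eqVlt; apply/orP; left; apply/eqP; rewrite /exp_coeff /= [(`|t| * c) ^+ k]exprMn.
  move: (k`!%:R^-1) (`|t| ^+ k) (c ^+ k) => x y z; ring.
split=> //; have := main 0%N.
by rewrite /evol_partial big_ord0 add0r cnormN /exp_rem big_ord0 subr0.
Qed.

(** * Parseval's identity with a shift in theta *)

Variable lam : {measure set (d.-tuple R) -> \bar R}.
Hypothesis Hlam : is_lebesgue_measure lam.
Local Notation T := (@torus R d).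
Local Notation F s th := (fourier a b vf s th).
Implicit Types (th ze : 'I_d -> R) (c : R).

(** The phase [c] lets a real integral see both parts of a complex one ([c = 0] and [c = - pi / 2]);
    it later becomes the phase of a cosine in a trigonometric polynomial. *)
Definition pair_coef ze c (p q : 'rV[R]_d * R[i]) : R[i] :=
  if fracpt a p.1 == fracpt a q.1
  then expi (2 * pi * lin ze (cd a q.1) + c) * (Num.conj p.2 * q.2) else 0.

(* An integer vector representing the difference of two points with the same fractional part. *)
Definition pair_int (p q : 'rV[R]_d * R[i]) (i : 'I_d) : int :=
  Num.floor (cd a p.1 i) - Num.floor (cd a q.1 i).

Lemma dot_fourier s th ze c : onV V s ->
  complex.Re (expi c * dot (F s th) (F s (fun i => th i - ze i))) =
  \sum_(p <- s) \sum_(q <- s) complex.Re (pair_coef ze c p q *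
    expi (2 * pi * \sum_i (pair_int p q i)%:~R * th i)).
Proof.
move=> sV; rewrite dotE.
have -> : \sum_m Num.conj (F s th m 0) * F s (fun i => th i - ze i) m 0 =
    \sum_(p <- s) \sum_(q <- s) \sum_m
     Num.conj (p.2 * (if fracpt a p.1 == vf m then expi (- dotp (thb b th) p.1) else 0)) *
     (q.2 * (if fracpt a q.1 == vf m then expi (- dotp (thb b (fun i => th i - ze i)) q.1) else 0)).
  under [RHS]eq_bigr do rewrite exchange_big.
  rewrite [RHS]exchange_big /=; apply: eq_bigr => m _; rewrite !mxE rmorph_sum mulr_suml.
  by apply: eq_bigr => p _; rewrite mulr_sumr.
rewrite mulr_sumr Re_sum !big_seq; apply: eq_bigr => p ps.
rewrite mulr_sumr Re_sum; apply: eq_bigr => q _; congr (complex.Re _).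
have [n pn] := V_fracpt Ha_basis HV_per Hvf (sV _ ps).
rewrite (bigD1 n) //= big1 ?addr0 => [|m mn]; last first.
  by rewrite pn (inj_eq Hvf_inj) eq_sym (negbTE mn) mulr0 rmorph0 mul0r.
rewrite pn eqxx /pair_coef pn eq_sym; case: eqVneq => [qn|_]; last by rewrite !mulr0 mul0r.
rewrite expiN rmorphM /= conjCK !(dotp_thb Ha_basis Hdual) /pair_int.
have -> : \sum_i (Num.floor (cd a p.1 i) - Num.floor (cd a q.1 i))%:~R * th i =
    lin th (cd a p.1) - lin th (cd a q.1).
  rewrite /lin -sumrB; apply: eq_bigr => i _; rewrite -mulrBr mulrC; congr (_ * _).
  have := congr1 (fun x => cd a x i) pn; rewrite qn !(cd_fracpt Ha_basis) rmorphB /=; lra.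
have -> : lin (fun i => th i - ze i) (cd a q.1) = lin th (cd a q.1) - lin ze (cd a q.1).
  by rewrite /lin -sumrB; apply: eq_bigr => i _; rewrite mulrBl.
rewrite [LHS](_ : _ = (expi c * expi (2 * pi * lin th (cd a p.1)) *
   expi (- (2 * pi * (lin th (cd a q.1) - lin ze (cd a q.1))))) * (Num.conj p.2 * q.2)); last by ring.
rewrite [RHS](_ : _ = (expi (2 * pi * lin ze (cd a q.1) + c) *
  expi (2 * pi * (lin th (cd a p.1) - lin th (cd a q.1)))) * (Num.conj p.2 * q.2)); last by ring.
by rewrite -!expiD; congr (expi _ * _); ring.
Qed.

(** Shifting one factor by [ze] multiplies the contribution of [v] by the phase
    [2 * pi * lin ze (cd a v)]: this is how a characteristic function in position arises.
    Integration keeps the pairs with equal fractional parts and equal integer parts, that is, equal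
    vertices. *)
Lemma parseval s B ze c : onV V s -> seq_in V B -> {subset [seq p.1 | p <- s] <= B} ->
  (\int[lam]_(th in T) complex.Re (expi c * dot (F s (tnth th)) (F s (fun i => tnth th i - ze i))))%R =
  \sum_(v <- B) cos (2 * pi * lin ze (cd a v) + c) * cabs2 (lfun s v).
Proof.
move=> sV [Bu BV] sB.
under eq_Rintegral do rewrite dot_fourier //.
have lip p q : lipschitz_fun (fun th : 'I_d -> R => complex.Re (pair_coef ze c p q *
    expi (2 * pi * \sum_i (pair_int p q i)%:~R * th i))).
  have := lipschitz_expi (fun i => 2 * pi * (pair_int p q i)%:~R) (pair_coef ze c p q).
  congr lipschitz_fun; apply/funext => th; congr (complex.Re (_ * expi _)).
  by rewrite mulr_sumr; apply: eq_bigr => i _; rewrite mulrA.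
have ig p q : lam.-integrable T (EFin \o (fun th : d.-tuple R => complex.Re (pair_coef ze c p q *
    expi (2 * pi * \sum_i (pair_int p q i)%:~R * tnth th i)))).
  exact: (lipschitz_integrable Hlam (@measurable_torus R d) (@subset_refl _ _) (lip p q)).
rewrite Rintegral_sum; [|exact: measurable_torus|]; last first.
  by move=> p; apply: integrable_sum_EFin => //; exact: measurable_torus.
transitivity (\sum_(p <- s) \sum_(q <- s) (p.1 == q.1)%:R *
    complex.Re (expi (2 * pi * lin ze (cd a q.1) + c) * (Num.conj p.2 * q.2))).
  apply: eq_bigr => p _; rewrite Rintegral_sum //; last exact: measurable_torus.
  apply: eq_bigr => q _; rewrite torus_fourier // /pair_coef.
  have [pq|pq] := eqVneq p.1 q.1.
    by rewrite pq eqxx mul1r; case: ifP => // /negP[]; apply/forallP => i; rewrite /pair_int pq subrr.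
  rewrite mul0r; case: ifP => // /forallP k0.
  case: eqP => // fpq; exfalso; move/eqP: pq; apply; apply: (cd_inj Ha_basis).
  apply/funext => i; have := congr1 (fun x => cd a x i) fpq; rewrite !(cd_fracpt Ha_basis).
  have /eqP/subr0_eq-> := k0 i; exact: addIr.
have ReE x z : cos x * cabs2 z = complex.Re (expi x * (Num.conj z * z)) :> R.
  by rewrite conjM_cabs2 [expi x * _]mulrC ReMr mulrC.
under [RHS]eq_bigr do rewrite ReE /lfun rmorph_sum mulr_suml mulr_sumr Re_sum.
rewrite [RHS]exchange_big !big_seq /=; apply: eq_bigr => p ps.
transitivity (\sum_(v <- B) (v == p.1)%:R * (\sum_(q <- s) (q.1 == v)%:R *
    complex.Re (expi (2 * pi * lin ze (cd a v) + c) * (Num.conj p.2 * q.2)))).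
  rewrite (bigD1_seq p.1) //=; last by apply: sB; apply: map_f.
  rewrite eqxx mul1r [X in _ = _ + X]big1 ?addr0; last by move=> v /negbTE vp; rewrite vp mul0r.
  apply: eq_bigr => q _; rewrite eq_sym; case: eqVneq => [->//|_]; by rewrite !mul0r.
apply: eq_bigr => v _; rewrite eq_sym; case: eqVneq => [_|_]; last first.
  by rewrite mul0r mulr0 rmorph0 mul0r mulr0.
rewrite mul1r mulr1 [X in expi _ * X]mulr_sumr [in RHS]mulr_sumr Re_sum; apply: eq_bigr => q _.
by case: eqVneq => _; rewrite ?mulr1 ?mul1r // !mulr0 mul0r.
Qed.
End Evolution.

(** * Integrals of possibly non-measurable functions *)

Section NullSets.
Local Open Scope ereal_scope.
Import HBNNSimple.
Variables (dX : measure_display) (X : measurableType dX) (R : realType).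
Variable mu : {measure set X -> \bar R}.
Implicit Types (f : X -> \bar R) (D Z : set X).

Definition lower_integral f : \bar R :=
  ereal_sup [set sintegral mu h | h in [set h : {nnsfun X >-> R} | forall x, (h x)%:E <= f x]].

(** Cutting a simple function below [f] to zero on [Z] keeps its integral, so both suprema coincide
    for any nonnegative [f]. *)
Lemma lower_integral_null f Z : (forall x, 0 <= f x) -> measurable Z -> mu Z = 0 ->
  lower_integral f = lower_integral (f \_ (~` Z)).
Proof.
move=> f0 mZ Z0; have mC : measurable (~` Z) by exact: measurableC.
apply/eqP; rewrite eq_le; apply/andP; split; last first.
  apply: ub_ereal_sup => _ [h hf <-]; apply: ereal_sup_ubound; exists h => // x.
  by apply: le_trans (hf x) _; rewrite patchE; case: ifP.
apply: ub_ereal_sup => _ [h hf <-]; apply: ereal_sup_ubound.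
exists (proj_nnsfun h mC).
  move=> x; rewrite -mrestrict !patchE; case: ifP => // _; exact: hf.
rewrite -!integralT_nnsfun.
have mh (g : {nnsfun X >-> R}) : measurable_fun setT (fun x => (g x)%:E).
  by apply/measurable_EFinP.
rewrite [RHS](ge0_negligible_integral mZ measurableT (mh _) _ Z0); last first.
  by move=> x _; rewrite lee_fin.
rewrite (ge0_negligible_integral mZ measurableT (mh _) _ Z0); last first.
  by move=> x _; rewrite lee_fin.
apply: eq_integral => x; rewrite inE => -[_ Zx].
by rewrite -mrestrict patchE mem_set.
Qed.

Lemma ge0_integral_null f D Z : (forall x, 0 <= f x) -> measurable Z -> mu Z = 0 ->
  \int[mu]_(x in D) f x = \int[mu]_(x in D `\` Z) f x.
Proof.
move=> f0 mZ Z0; rewrite !ge0_integralE //.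
rewrite -!/(lower_integral _) (@lower_integral_null _ Z) //; last first.
  by move=> x; rewrite patchE; case: ifP.
congr lower_integral; apply/funext => x; rewrite !patchE.
rewrite in_setD in_setC.
by case: (x \in D); case: (x \in Z).
Qed.

(* [f] may be non-measurable, in which case the integral is a mere supremum over simple
   functions; this is needed because [hmap] takes junk values where a band is not
   differentiable. *)
Lemma integral_null f D Z : measurable Z -> mu Z = 0 ->
  \int[mu]_(x in D) f x = \int[mu]_(x in D `\` Z) f x.
Proof.
move=> mZ Z0; rewrite integralE [RHS]integralE; congr (_ - _); exact: ge0_integral_null.
Qed.

End NullSets.

(** * The asymptotic velocity distribution *)

Section Propagation.
Variables (R : realType) (d : nat) (a b : 'I_d -> 'rV[R]_d).
Hypothesis Ha_basis : basis_mx a \in unitmx.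
Hypothesis Hdual : forall i j : 'I_d, dotp (a i) (b j) = 2 * pi * (i == j)%:R.
Variables (V : set 'rV[R]_d) (adj : 'rV[R]_d -> 'rV[R]_d -> Prop).
Hypothesis Hadj_V : forall u v, adj u v -> V u /\ V v.
Hypothesis Hadj_sym : forall u v, adj u v -> adj v u.
Hypothesis Hlocfin : forall v, V v -> finite_set [set u | adj v u].
Hypothesis HV_per : forall i v, V (v + a i) <-> V v.
Hypothesis Hadj_per : forall i u v, adj (u + a i) (v + a i) <-> adj u v.
Variable Q : 'rV[R]_d -> R.
Hypothesis HQ_per : forall i v, V v -> Q (v + a i) = Q v.
Variables (nu : nat) (vf : 'I_nu -> 'rV[R]_d).
Hypothesis Hvf_inj : injective vf.
Hypothesis Hvf : forall v, (V `&` cellA a) v <-> exists n, vf n = v.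
Variable lam : {measure set (d.-tuple R) -> \bar R}.
Hypothesis Hlam : is_lebesgue_measure lam.
Variables (E : ('I_d -> R) -> 'I_nu -> R) (P : ('I_d -> R) -> 'I_nu -> 'M[R[i]]_nu).
Hypothesis EPH : forall th, spectral (E th) (P th) (bloch_mx a adj Q vf (thb b th)).
Hypothesis Einc : forall th (n m : 'I_nu), (n <= m)%N -> E th n <= E th m.
Implicit Types (u v w : 'rV[R]_d) (s : seq ('rV[R]_d * R[i])) (N M K : nat) (t r c : R).
Implicit Types (th ze : 'I_d -> R).
Local Notation T := (@torus R d).
Local Notation F s th := (fourier a b vf s th).
Definition hop_freq (n m : 'I_nu) : seq ('I_d -> R) :=
  [seq (fun i => 2 * pi * cd a (u - vf n) i) | u <- nb adj (vf n) & fracpt a u == vf m].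

Definition onsite : 'M[R[i]]_nu := \matrix_(n, m) ((n == m)%:R * (Q (vf n))%:C%C).

Lemma bloch_trig th n m : bloch_mx a adj Q vf (thb b th) n m =
  \sum_(f <- hop_freq n m) expi (lin f th) + onsite n m.
Proof.
rewrite (bloch_mxE b Hlocfin Q Hvf) mxE big_map big_filter; congr (_ + _).
apply: eq_bigr => u _; rewrite (dotp_thb Ha_basis Hdual); congr (expi _).
by rewrite /lin mulr_sumr; apply: eq_bigr => i _; ring.
Qed.

Definition evol_symbol t s th : 'cV[R[i]]_nu := spec_fun (P th) (phase t (E th)) (F s th).

Definition list_norm s : R := (\int[lam]_(th in T) vnorm2 (F s (tnth th)))%R.

Lemma dot_fourier_lipschitz s ze c : onV V s ->
  lipschitz_fun (fun th => complex.Re (expi c * dot (F s th) (F s (fun i => th i - ze i)))).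
Proof.
move=> sV; pose G th := \sum_(p <- s) \sum_(q <- s) complex.Re (pair_coef a ze c p q *
    expi (2 * pi * \sum_i (pair_int a p q i)%:~R * th i)).
have : lipschitz_fun G.
  apply: lipschitz_sum => p; apply: lipschitz_sum => q.
  have := lipschitz_expi (fun i => 2 * pi * (pair_int a p q i)%:~R) (pair_coef a ze c p q).
  congr lipschitz_fun; apply/funext => th; congr (complex.Re (_ * expi _)).
  by rewrite mulr_sumr; apply: eq_bigr => i _; rewrite mulrA.
congr lipschitz_fun; apply/funext => th.
by rewrite (dot_fourier Ha_basis Hdual HV_per Hvf_inj Hvf).
Qed.

Lemma vnorm2_fourierE s th :
  vnorm2 (F s th) = complex.Re (expi 0 * dot (F s th) (F s (fun i => th i - 0))).
Proof.
have -> : (fun i => th i - 0) = th by apply/funext => i; rewrite subr0.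
by rewrite expi0 mul1r dotxx.
Qed.

Lemma vnorm2_fourier_lipschitz s : onV V s -> lipschitz_fun (fun th => vnorm2 (F s th)).
Proof.
move=> sV; have := dot_fourier_lipschitz (fun=> 0) 0 sV.
by congr lipschitz_fun; apply/funext => th; rewrite vnorm2_fourierE.
Qed.

Lemma vnorm2_fourier_integrable s : onV V s ->
  lam.-integrable T (EFin \o (fun th : d.-tuple R => vnorm2 (F s (tnth th)))).
Proof.
move=> sV; exact: (lipschitz_integrable Hlam (@measurable_torus R d) (@subset_refl _ _)
  (vnorm2_fourier_lipschitz sV)).
Qed.

Lemma plancherel s B : onV V s -> seq_in V B -> {subset [seq p.1 | p <- s] <= B} ->
  list_norm s = \sum_(v <- B) cabs2 (lfun s v).
Proof.
move=> sV Bin sB; rewrite /list_norm; under eq_Rintegral do rewrite vnorm2_fourierE.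
rewrite (parseval Ha_basis Hdual HV_per Hvf_inj Hvf Hlam (fun=> 0) 0 sV Bin sB).
apply: eq_bigr => v _; rewrite /lin big1 ?mulr0 ?addr0 ?cos0 ?mul1r // => i _.
by rewrite mul0r.
Qed.

Lemma lfun_l2 s B : onV V s -> seq_in V B -> \sum_(v <- B) cabs2 (lfun s v) <= list_norm s.
Proof.
move=> sV Bin; pose B' := undup (B ++ [seq p.1 | p <- s]).
have B'in : seq_in V B'.
  have [_ BV] := Bin; split; first exact: undup_uniq.
  by move=> v; rewrite mem_undup mem_cat => /orP[/BV//|/mapP[p /sV pV ->]].
have sB' : {subset [seq p.1 | p <- s] <= B'}.
  by move=> v vs; rewrite mem_undup mem_cat vs orbT.
have BB' : {subset B <= B'} by move=> v vB; rewrite mem_undup mem_cat vB.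
rewrite (plancherel sV B'in sB') [leRHS](bigID (fun v => v \in B)) /= -[X in _ <= X + _]big_filter.
have -> : \sum_(v <- [seq v <- B' | v \in B]) cabs2 (lfun s v) = \sum_(v <- B) cabs2 (lfun s v).
  have [Bu _] := Bin; have [B'u _] := B'in.
  apply: perm_big; apply: uniq_perm; rewrite ?filter_uniq //.
  by move=> v; rewrite mem_filter; case: (boolP (v \in B)) => // /BB' ->.
by rewrite lerDl sumr_ge0 // => v _; exact: cabs2_ge0.
Qed.

Lemma list_norm_ge0 s : 0 <= list_norm s.
Proof. by apply: Rintegral_ge0 => th _; exact: vnorm2_ge0. Qed.

Lemma vn_fourier_le s th : vn (F s th) <= nu%:R * \sum_(p <- s) cnorm p.2.
Proof.
apply: le_trans (vn_le_sum _) _; rewrite mulr_natl -[nu in leRHS]card_ord -sumr_const.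
apply: ler_sum => m _; rewrite mxE; apply: le_trans (ler_cnorm_sum _ _ _) _.
apply: ler_sum => p _; rewrite cnormM; case: ifP => _; rewrite ?cnorm_expi ?cnorm0 ?mulr1 //.
by rewrite mulr0 cnorm_ge0.
Qed.

(** Young's inequality with a free parameter: it turns l2-closeness of amplitudes into l1-closeness
    of probabilities without square roots of sums. *)
Lemma cabs2_dist x y (e : R) : 0 < e ->
  `|cabs2 x - cabs2 y| <= (1 + e^-1) * cabs2 (x - y) + e * cabs2 y :> R.
Proof.
move=> e0; rewrite /cabs2 !ReD !ImD !ReN !ImN.
move: (complex.Re x) (complex.Im x) (complex.Re y) (complex.Im y) => a1 a2 b1 b2.
have sq (u w : R) : `|u ^+ 2 - w ^+ 2| <= (1 + e^-1) * (u - w) ^+ 2 + e * w ^+ 2.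
  have -> : u ^+ 2 - w ^+ 2 = (u - w) ^+ 2 + 2 * ((u - w) * w) by ring.
  have h : `|2 * ((u - w) * w)| <= e^-1 * (u - w) ^+ 2 + e * w ^+ 2.
    have h1 : 0 <= e^-1 * ((u - w) - e * w) ^+ 2.
      by apply: mulr_ge0; [rewrite invr_ge0 ltW|exact: sqr_ge0].
    have h2 : 0 <= e^-1 * ((u - w) + e * w) ^+ 2.
      by apply: mulr_ge0; [rewrite invr_ge0 ltW|exact: sqr_ge0].
    have E1 : e^-1 * ((u - w) - e * w) ^+ 2 = e^-1 * (u - w) ^+ 2 + e * w ^+ 2 - 2 * ((u - w) * w).
      by field; rewrite gt_eqF.
    have E2 : e^-1 * ((u - w) + e * w) ^+ 2 = e^-1 * (u - w) ^+ 2 + e * w ^+ 2 + 2 * ((u - w) * w).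
      by field; rewrite gt_eqF.
    by rewrite ler_norml; apply/andP; split; lra.
  apply: le_trans (ler_normD _ _) _; rewrite (ger0_norm (sqr_ge0 _)); move: h; lra.
have := sq a1 b1; have := sq a2 b2; rewrite opprD addrACA => h1 h2.
apply: le_trans (ler_normD _ _) _; lra.
Qed.

Lemma iter_HopB f g k v : V v -> iter k (Hop adj Q) (fun v => f v - g v) v =
  iter k (Hop adj Q) f v - iter k (Hop adj Q) g v.
Proof.
elim: k v => [//|k IH] v Vv /=.
rewrite (eq_Hop Hadj_V Hlocfin Q Vv IH) !(HopE Hlocfin) //.
by rewrite sumrB mulrBr addrACA opprD.
Qed.

Lemma evol_partialB t f g K v : V v -> evol_partial adj Q t (fun v => f v - g v) v K =
  evol_partial adj Q t f v K - evol_partial adj Q t g v K.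
Proof.
move=> Vv; rewrite /evol_partial -sumrB; apply: eq_bigr => k _.
by rewrite iter_HopB // mulrBr.
Qed.

(** By local finiteness a power of the Hamiltonian at [v] sees finitely many vertices, so finitely
    many eventual equalities suffice. *)
Lemma iter_Hop_local (f : nat -> 'rV[R]_d -> R[i]) g k v :
  (forall u, V u -> \forall M \near \oo, f M u = g u) -> V v ->
  \forall M \near \oo, iter k (Hop adj Q) (f M) v = iter k (Hop adj Q) g v.
Proof.
move=> fg; elim: k v => [|k IH] v Vv /=; first exact: fg.
have nbr : \forall M \near \oo, forall u, u \in nb adj v ->
    iter k (Hop adj Q) (f M) u = iter k (Hop adj Q) g u.
  have : forall u, u \in nb adj v -> V u by move=> u /(mem_nb Hlocfin _ Vv)/Hadj_V[].
  elim: (nb adj v) => [|u r IHr] rV; first by near=> M.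
  have h1 := IH _ (rV u (mem_head _ _)).
  have h2 := IHr (fun w wr => rV w (mem_behead (s := u :: r) wr)).
  near=> M => w; rewrite inE => /orP[/eqP->|wr]; first by near: M.
  by have : forall w, w \in r -> iter k (Hop adj Q) (f M) w = iter k (Hop adj Q) g w; [near: M|apply].
have hv := IH _ Vv.
near=> M; rewrite !(HopE Hlocfin) //; congr (_ + _ * _); last by near: M.
rewrite big_seq [RHS]big_seq; apply: eq_bigr => u.
by have : forall u, u \in nb adj v -> iter k (Hop adj Q) (f M) u = iter k (Hop adj Q) g u; [near: M|apply].
Unshelve. all: by end_near. Qed.

Lemma evol_partial_local (f : nat -> 'rV[R]_d -> R[i]) g t K B :
  (forall u, V u -> \forall M \near \oo, f M u = g u) -> seq_in V B ->
  \forall M \near \oo, forall v, v \in B ->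
    evol_partial adj Q t (f M) v K = evol_partial adj Q t g v K.
Proof.
move=> fg [_]; elim: B => [|v B IH] BV; first by near=> M.
have hB := IH (fun w wr => BV w (mem_behead (s := v :: B) wr)).
have hv : \forall M \near \oo, evol_partial adj Q t (f M) v K = evol_partial adj Q t g v K.
  have : \forall M \near \oo, forall k, (k < K)%N ->
      iter k (Hop adj Q) (f M) v = iter k (Hop adj Q) g v.
    elim: (K) => [|K' IHK]; first by near=> M.
    have h := @iter_Hop_local f g K' v fg (BV v (mem_head _ _)).
    near=> M => k; rewrite ltnS leq_eqVlt => /orP[/eqP->|kK]; first by near: M.
    have : forall k, (k < K')%N -> iter k (Hop adj Q) (f M) v = iter k (Hop adj Q) g v by near: M.
    exact.
  apply: filterS => M h; apply: eq_bigr => k _; by rewrite h.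
near=> M => w; rewrite inE => /orP[/eqP->|wr]; first by near: M.
have : forall v, v \in B -> evol_partial adj Q t (f M) v K = evol_partial adj Q t g v K by near: M.
exact.
Unshelve. all: by end_near. Qed.

Lemma E_bound : exists2 Em, 0 <= Em & forall th n, `|E th n| <= Em.
Proof. exact: (E_bounded bloch_trig EPH). Qed.

Definition lsub s s' := s ++ lscale (-1) s'.

Lemma lfun_lsub s s' v : lfun (lsub s s') v = lfun s v - lfun s' v.
Proof.
rewrite /lfun big_cat /= big_map /=; congr (_ + _).
by rewrite -sumrN; apply: eq_bigr => p _; rewrite mulN1r mulNr.
Qed.

Lemma fourier_lsub s s' th : F (lsub s s') th = F s th - F s' th.
Proof.
apply/matrixP => m j; rewrite !mxE big_cat big_map; congr (_ + _).
by rewrite -sumrN; apply: eq_bigr => p _; rewrite mulN1r mulNr.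
Qed.

Lemma onV_lsub s s' : onV V s -> onV V s' -> onV V (lsub s s').
Proof.
move=> sV s'V p; rewrite mem_cat => /orP[/sV//|/mapP[q /s'V qV ->]]; exact: qV.
Qed.

Lemma vnorm2_spec_fun_le (f : 'I_nu -> R[i]) (x : 'cV[R[i]]_nu) m th :
  0 <= m -> (forall n, cnorm (f n) <= m) ->
  vnorm2 (spec_fun (P th) f x) <= m ^+ 2 * vnorm2 x.
Proof.
move=> m0 fm; rewrite (vnorm2_spec_fun (EPH th)) [in leRHS](vnorm2_resolution (EPH th)) mulr_sumr.
apply: ler_sum => n _; rewrite ler_wpM2r ?vnorm2_ge0 // -cnorm_sqr.
by rewrite ler_sqr ?nnegrE ?cnorm_ge0.
Qed.

Lemma symbol_bounds Em t K s th : onV V s -> 0 <= Em -> (forall th n, `|E th n| <= Em) ->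
  vnorm2 (F (lpartial adj Q t K s) th) <= (1 + exp_rem (`|t| * Em) K) ^+ 2 * vnorm2 (F s th) /\
  vnorm2 (F (lpartial adj Q t K s) th - evol_symbol t s th) <=
    exp_rem (`|t| * Em) K ^+ 2 * vnorm2 (F s th).
Proof.
move=> sV Em0 EEm; set rm := exp_rem _ _.
have rm0 : 0 <= rm by apply: exp_rem_ge0; rewrite mulr_ge0.
have cb n : cnorm (\sum_(k < K) exp_coef (t * E th n) k - expi (- (t * E th n))) <= rm.
  by apply: exp_partial_dist; rewrite normrM ler_wpM2l.
rewrite (fourier_lpartial Ha_basis Hadj_V Hadj_sym Hlocfin HV_per Hadj_per HQ_per Hvf_inj Hvf t K sV (EPH th)).
split.
  apply: vnorm2_spec_fun_le => [|n]; [by rewrite addr_ge0|]; have := cb n; set z := \sum_k _ => zb.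
  rewrite -[z](subrK (expi (- (t * E th n)))); apply: le_trans (ler_cnormD _ _) _.
  by rewrite cnorm_expi addrC lerD2l.
rewrite /evol_symbol /spec_fun -sumrB.
under eq_bigr do rewrite -scalerBl.
exact: (@vnorm2_spec_fun_le (fun n => \sum_(k < K) exp_coef (t * E th n) k - phase t (E th) n)).
Qed.

Lemma list_norm_lpartial Em t K s : onV V s -> 0 <= Em -> (forall th n, `|E th n| <= Em) ->
  list_norm (lpartial adj Q t K s) <= (1 + exp_rem (`|t| * Em) K) ^+ 2 * list_norm s.
Proof.
move=> sV Em0 EEm; have pV : onV V (lpartial adj Q t K s) by exact: onV_lpartial.
rewrite -RintegralZl //=; last 2 first.
- exact: measurable_torus.
- exact: vnorm2_fourier_integrable.
apply: le_Rintegral => /=.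
- exact: measurable_torus.
- exact: vnorm2_fourier_integrable.
- by apply: integrableZl_EFin; [exact: measurable_torus|exact: vnorm2_fourier_integrable].
by move=> th _; have [] := symbol_bounds t K (tnth th) sV Em0 EEm.
Qed.

Lemma cvg_dist_le (f g : nat -> R) (l : R) : (forall j, `|f j - l| <= g j) ->
  g j @[j --> \oo] --> 0 -> f j @[j --> \oo] --> l.
Proof.
move=> fg g0; apply/cvgrPdist_le => e e0; have /cvgrPdist_le/(_ _ e0) := g0.
apply: filterS => j; rewrite sub0r normrN => gj; rewrite distrC.
by apply: le_trans (fg j) _; apply: le_trans (ler_norm _) gj.
Qed.

Lemma cabs2_cvg (z : nat -> R[i]) l : cnorm (z K - l) @[K --> \oo] --> 0 ->
  cabs2 (z K) @[K --> \oo] --> cabs2 l.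
Proof.
move=> zl.
have cR : complex.Re (z K) @[K --> \oo] --> complex.Re l.
  apply: cvg_dist_le zl => K; rewrite -ReN -ReD; exact: Re_le_cnorm.
have cI : complex.Im (z K) @[K --> \oo] --> complex.Im l.
  apply: cvg_dist_le zl => K; rewrite -ImN -ImD; exact: Im_le_cnorm.
rewrite /cabs2 !expr2; under eq_fun do rewrite !expr2.
by apply: cvgD; apply: cvgM.
Qed.

Lemma cvg_big_seq (I : Type) (r : seq I) (p : pred I) (f : I -> nat -> R) (l : I -> R) :
  (forall i, p i -> f i K @[K --> \oo] --> l i) ->
  \sum_(i <- r | p i) f i K @[K --> \oo] --> \sum_(i <- r | p i) l i.
Proof.
move=> fl; elim: r => [|i r IH].
  by rewrite big_nil; under eq_fun do rewrite big_nil; exact: cvg_cst.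
rewrite big_cons; under eq_fun do rewrite big_cons.
by case: ifPn => // pi; apply: cvgD => //; exact: fl.
Qed.

Lemma evol_cvg f A t v : 0 <= A -> (forall u, V u -> cnorm (f u) <= A) -> V v ->
  cnorm (evol_partial adj Q t f v K - evol adj Q t f v) @[K --> \oo] --> 0.
Proof.
move=> A0 fA Vv.
have [D D0 DP] := evol_bound Ha_basis Hadj_V Hlocfin HV_per Hadj_per HQ_per Hvf.
have h1 : forall u, V u -> cnorm (f u) <= A * 1 by move=> u Vu; rewrite mulr1 fA.
have h2 : forall v u, V v -> adj v u -> 1 <= 1 * 1 :> R by move=> _ _ _ _; rewrite mulr1.
have [h _] := DP (fun=> 1) 1 A f ler01 A0 (fun=> ler01) h2 h1 t v Vv.
pose r := `|t| * (D * (1 + 1)).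
apply: (@cvg_dist_le _ (fun K => A * exp_rem r K)).
  by move=> K; rewrite subr0 ger0_norm ?cnorm_ge0 //; have := h K; rewrite mulr1.
by rewrite -[0](mulr0 A); apply: cvgM; [exact: cvg_cst|exact: exp_rem_cvg0].
Qed.

Lemma rem_sqr_cvg r m : (1 + exp_rem r K) ^+ 2 * m @[K --> \oo] --> m.
Proof.
have h : 1 + exp_rem r K @[K --> \oo] --> (1 + 0 : R).
  by apply: cvgD; [exact: cvg_cst|exact: exp_rem_cvg0].
rewrite addr0 in h; under eq_fun do rewrite expr2.
have hm : (fun _ : nat => m) @ \oo --> m by exact: cvg_cst.
have := cvgM (cvgM h h) hm; rewrite !mul1r; exact.
Qed.

Lemma lim_le_lim (f g : nat -> R) (l m : R) : f K @[K --> \oo] --> l -> g K @[K --> \oo] --> m ->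
  (forall K, f K <= g K) -> l <= m.
Proof.
move=> fl gm fg; rewrite -(cvg_lim (@Rhausdorff _) fl) -(cvg_lim (@Rhausdorff _) gm).
by apply: ler_lim; [exact: (cvgP _ fl)|exact: (cvgP _ gm)|near=> K].
Unshelve. all: by end_near. Qed.

Lemma evol_partial_l2 Em t K s B : onV V s -> 0 <= Em -> (forall th n, `|E th n| <= Em) -> seq_in V B ->
  \sum_(v <- B) cabs2 (evol_partial adj Q t (lfun s) v K) <=
    (1 + exp_rem (`|t| * Em) K) ^+ 2 * list_norm s.
Proof.
move=> sV Em0 EEm Bin; have [_ BV] := Bin.
have pV : onV V (lpartial adj Q t K s) by exact: onV_lpartial.
apply: le_trans (list_norm_lpartial t K sV Em0 EEm); apply: le_trans (lfun_l2 pV Bin).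
rewrite big_seq [leRHS]big_seq; apply: ler_sum => v /BV Vv.
by rewrite (lfun_lpartial Hadj_V Hadj_sym Hlocfin).
Qed.

Lemma lfun_le s v : cnorm (lfun s v) <= \sum_(p <- s) cnorm p.2.
Proof.
apply: le_trans (ler_cnorm_sum _ _ _) _; apply: ler_sum => p _; rewrite cnormM.
by case: eqVneq => _; rewrite ?cnorm0 ?mulr0 ?cnorm_ge0 // -expi0 cnorm_expi mulr1.
Qed.

(** Two partial sums are compared on the Bloch side, where their distance is at most the sum of two
    scalar remainders; then [K'] tends to infinity. *)
Lemma evol_remainder_l2 Em t K s B : onV V s -> 0 <= Em -> (forall th n, `|E th n| <= Em) ->
  seq_in V B ->
  \sum_(v <- B) cabs2 (evol adj Q t (lfun s) v - evol_partial adj Q t (lfun s) v K) <=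
    exp_rem (`|t| * Em) K ^+ 2 * list_norm s.
Proof.
move=> sV Em0 EEm Bin; have [_ BV] := Bin; set r := `|t| * Em.
have rm0 K' : 0 <= exp_rem r K' by apply: exp_rem_ge0; rewrite mulr_ge0.
apply: (@lim_le_lim (fun K' => \sum_(v <- B | v \in B)
    cabs2 (evol_partial adj Q t (lfun s) v K' - evol_partial adj Q t (lfun s) v K))
  (fun K' => (exp_rem r K' + exp_rem r K) ^+ 2 * list_norm s)).
- rewrite big_seq; apply: cvg_big_seq => v /BV Vv; apply: cabs2_cvg.
  under eq_fun do rewrite opprB addrA subrK.
  by apply: (evol_cvg _ (A := \sum_(p <- s) cnorm p.2)) => // [|u _];
    [apply: sumr_ge0 => p _; exact: cnorm_ge0|exact: lfun_le].
- have h : exp_rem r K' + exp_rem r K @[K' --> \oo] --> 0 + exp_rem r K.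
    by apply: cvgD; [exact: exp_rem_cvg0|exact: cvg_cst].
  rewrite add0r in h; under eq_fun do rewrite expr2.
  have hm : (fun _ : nat => list_norm s) @ \oo --> list_norm s by exact: cvg_cst.
  have := cvgM (cvgM h h) hm; rewrite -expr2; exact.
move=> K'; pose s' := lsub (lpartial adj Q t K' s) (lpartial adj Q t K s).
have s'V : onV V s' by apply: onV_lsub; exact: onV_lpartial.
apply: (@le_trans _ _ (list_norm s')).
  apply: le_trans (lfun_l2 s'V Bin); rewrite [leRHS]big_seq; apply: ler_sum => v /BV Vv.
  by rewrite lfun_lsub !(lfun_lpartial Hadj_V Hadj_sym Hlocfin).
rewrite -RintegralZl //=; last 2 first.
- exact: measurable_torus.
- exact: vnorm2_fourier_integrable.
apply: le_Rintegral => /=.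
- exact: measurable_torus.
- exact: vnorm2_fourier_integrable.
- by apply: integrableZl_EFin; [exact: measurable_torus|exact: vnorm2_fourier_integrable].
move=> th _; rewrite fourier_lsub.
rewrite !(fourier_lpartial Ha_basis Hadj_V Hadj_sym Hlocfin HV_per Hadj_per HQ_per Hvf_inj Hvf t _ sV (EPH _)).
rewrite /spec_fun -sumrB; under eq_bigr do rewrite -scalerBl.
apply: (@vnorm2_spec_fun_le (fun n => \sum_(k < K') exp_coef (t * E (tnth th) n) k -
   \sum_(k < K) exp_coef (t * E (tnth th) n) k)) => [|n]; first by rewrite addr_ge0.
have cb K1 : cnorm (\sum_(k < K1) exp_coef (t * E (tnth th) n) k - expi (- (t * E (tnth th) n))) <= exp_rem r K1.
  by apply: exp_partial_dist; rewrite normrM ler_wpM2l.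
apply: le_trans (lerD (cb K') (cb K)).
rewrite -[cnorm (\sum_(k < K) _ - _)]cnormN; apply: le_trans (ler_cnormD _ _).
by rewrite opprB addrA subrK.
Qed.

(** The contraction half of unitarity, from Plancherel for the partial series as [K] grows. *)
Lemma evol_l2 t s B : onV V s -> seq_in V B ->
  \sum_(v <- B) cabs2 (evol adj Q t (lfun s) v) <= list_norm s.
Proof.
move=> sV Bin; have [Em Em0 EEm] := E_bound; have [_ BV] := Bin.
apply: (@lim_le_lim (fun K => \sum_(v <- B | v \in B) cabs2 (evol_partial adj Q t (lfun s) v K))
  (fun K => (1 + exp_rem (`|t| * Em) K) ^+ 2 * list_norm s)).
- rewrite big_seq; apply: cvg_big_seq => v /BV Vv; apply: cabs2_cvg.
  by apply: (evol_cvg _ (A := \sum_(p <- s) cnorm p.2)) => // [|u _];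
    [apply: sumr_ge0 => p _; exact: cnorm_ge0|exact: lfun_le].
- exact: rem_sqr_cvg.
- by move=> K; rewrite -big_seq; exact: evol_partial_l2.
Qed.

(** * Truncation of the initial state to boxes *)

Section InitialState.
Variable psi : 'rV[R]_d -> R[i].
Hypothesis Hpsi : (\esum_(v in V) (cabs2 (psi v))%:E = 1)%E.

Definition cutoff N : seq ('rV[R]_d * R[i]) := [seq (v, psi v) | v <- bx a vf N].

Lemma onV_cutoff N : onV V (cutoff N).
Proof. by move=> p /mapP[v vN ->] /=; have [_] := bx_V Ha_basis HV_per Hvf_inj Hvf N; exact. Qed.

Lemma supp_cutoff N : [seq p.1 | p <- cutoff N] = bx a vf N.
Proof. by rewrite -map_comp map_id. Qed.

Lemma lfun_cutoff N v : lfun (cutoff N) v = psi v * (v \in bx a vf N)%:R.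
Proof.
rewrite /lfun big_map /= -(@sum_eq_uniq R d (bx a vf N) v (uniq_bx Ha_basis Hvf_inj Hvf N)).
by rewrite mulr_sumr; apply: eq_bigr => w _; case: eqVneq => [->|_]; rewrite ?mulr0.
Qed.

Definition tail N : R := 1 - \sum_(v <- bx a vf N) cabs2 (psi v).

Lemma psi_l2 B : seq_in V B -> \sum_(v <- B) cabs2 (psi v) <= 1.
Proof.
move=> Bin; have := esum_seq_le (fun v => cabs2_ge0 (psi v)) Bin.
by rewrite Hpsi lee_fin.
Qed.

Lemma psi_le1 v : V v -> cnorm (psi v) <= 1.
Proof.
move=> Vv; have Bin : seq_in V [:: v] by split=> // u; rewrite inE => /eqP->.
have := psi_l2 Bin; rewrite big_seq1 -cnorm_sqr -[X in _ <= X -> _](expr1n _ 2) ler_sqr //.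
  by rewrite nnegrE cnorm_ge0.
by rewrite nnegrE.
Qed.

Lemma tail_ge0 N : 0 <= tail N.
Proof. by rewrite subr_ge0; apply: psi_l2; exact: bx_V. Qed.

Lemma tail_cvg0 : tail N @[N --> \oo] --> 0.
Proof.
apply/cvgrPdist_le => e e0.
have [B Bin BP] := esum_adherent Hpsi e0.
have [N0 N0P] := sub_bx Ha_basis HV_per Hvf Bin.
near=> N; rewrite sub0r normrN ger0_norm ?tail_ge0 // /tail.
have BN : {subset B <= bx a vf N} by apply: N0P; near: N; exact: nbhs_infty_ge.
have : \sum_(v <- B) cabs2 (psi v) <= \sum_(v <- bx a vf N) cabs2 (psi v).
  have [Bu _] := Bin; rewrite [leRHS](bigID (fun v => v \in B)) /= -[X in _ <= X + _]big_filter.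
  have -> : \sum_(v <- [seq v <- bx a vf N | v \in B]) cabs2 (psi v) = \sum_(v <- B) cabs2 (psi v).
    apply: perm_big; apply: uniq_perm; rewrite ?filter_uniq ?(uniq_bx Ha_basis Hvf_inj Hvf) //.
    by move=> v; rewrite mem_filter; case: (boolP (v \in B)) => // /BN ->.
  by rewrite lerDl sumr_ge0 // => v _; exact: cabs2_ge0.
lra.
Unshelve. all: by end_near. Qed.

Lemma cutoff_diff N M : (N <= M)%N ->
  list_norm (lsub (cutoff M) (cutoff N)) <= tail N.
Proof.
move=> NM; set s := lsub _ _.
have sV : onV V s by apply: onV_lsub; exact: onV_cutoff.
have NsM : {subset bx a vf N <= bx a vf M} by exact: bx_mono.
have sM : {subset [seq p.1 | p <- s] <= bx a vf M}.
  move=> v; rewrite map_cat mem_cat supp_cutoff => /orP[//|vN]; apply: NsM.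
  by move: vN; rewrite -map_comp -[bx a vf N]supp_cutoff.
rewrite (plancherel sV (bx_V Ha_basis HV_per Hvf_inj Hvf M) sM).
have := psi_l2 (bx_V Ha_basis HV_per Hvf_inj Hvf M).
rewrite /tail (bigID (fun v => v \in bx a vf N)) /= -[X in X + _ <= _]big_filter.
have -> : \sum_(v <- [seq v <- bx a vf M | v \in bx a vf N]) cabs2 (psi v) =
    \sum_(v <- bx a vf N) cabs2 (psi v).
  apply: perm_big; apply: uniq_perm; rewrite ?filter_uniq ?(uniq_bx Ha_basis Hvf_inj Hvf) //.
  by move=> v; rewrite mem_filter; case: (boolP (v \in bx a vf N)) => // /NsM ->.
have -> : \sum_(v <- bx a vf M) cabs2 (lfun s v) =
    \sum_(v <- bx a vf M | v \notin bx a vf N) cabs2 (psi v).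
  rewrite [RHS]big_mkcond big_seq [RHS]big_seq; apply: eq_bigr => v vM.
  have -> : lfun s v = psi v * (v \notin bx a vf N)%:R.
    rewrite lfun_lsub !lfun_cutoff vM mulr1.
    by case: (v \in _) => /=; rewrite ?mulr1 ?mulr0 ?subr0 // subrr.
  by case: (v \notin _); rewrite ?mulr1 // mulr0 cabs2_0.
lra.
Qed.

(* For fixed [K] the partial exponential series at [v] only sees finitely many vertices, so
   [psi] may be replaced there by a large cutoff, to which Plancherel applies. *)
Lemma evol_cutoff_l2 t N B : seq_in V B ->
  \sum_(v <- B) cabs2 (evol adj Q t psi v - evol adj Q t (lfun (cutoff N)) v) <= tail N.
Proof.
move=> Bin; have [Em Em0 EEm] := E_bound; have [_ BV] := Bin.
pose fs M := lsub (cutoff M) (cutoff N).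
have fsV M : onV V (fs M) by apply: onV_lsub; exact: onV_cutoff.
apply: (@lim_le_lim (fun K => \sum_(v <- B | v \in B)
    cabs2 (evol_partial adj Q t psi v K - evol_partial adj Q t (lfun (cutoff N)) v K))
  (fun K => (1 + exp_rem (`|t| * Em) K) ^+ 2 * tail N)).
- rewrite big_seq; apply: cvg_big_seq => v /BV Vv; apply: cabs2_cvg.
  have h1 := evol_cvg t ler01 psi_le1 Vv.
  have h2 : cnorm (evol_partial adj Q t (lfun (cutoff N)) v K - evol adj Q t (lfun (cutoff N)) v)
      @[K --> \oo] --> 0.
    by apply: (evol_cvg _ (A := \sum_(p <- cutoff N) cnorm p.2)) => // [|u _];
      [apply: sumr_ge0 => p _; exact: cnorm_ge0|exact: lfun_le].
  apply: cvg_dist_le; last by have := cvgD h1 h2; rewrite addr0; exact.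
  move=> K /=; rewrite subr0 ger0_norm ?cnorm_ge0 // -[X in _ <= _ + X]cnormN.
  by apply: le_trans (ler_cnormD _ _); rewrite le_eqVlt; apply/orP; left; apply/eqP; congr cnorm; ring.
- exact: rem_sqr_cvg.
move=> K; rewrite -big_seq.
have lM : forall v, V v -> \forall M \near \oo, lfun (fs M) v = psi v - lfun (cutoff N) v.
  move=> v Vv; have Bin1 : seq_in V [:: v] by split=> // u; rewrite inE => /eqP->.
  have [N0 N0P] := sub_bx Ha_basis HV_per Hvf Bin1.
  near=> M; rewrite lfun_lsub lfun_cutoff (N0P M) ?mem_head ?mulr1 //.
  by near: M; exact: nbhs_infty_ge.
have near1 := @evol_partial_local (fun M => lfun (fs M)) _ t K B lM Bin.
have : \forall M \near \oo, (N <= M)%N /\ forall v, v \in B ->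
    evol_partial adj Q t (lfun (fs M)) v K = evol_partial adj Q t (fun v => psi v - lfun (cutoff N) v) v K.
  by near=> M; split; near: M; [exact: nbhs_infty_ge|exact: near1].
move=> /filter_ex[M [NM MP]].
apply: (@le_trans _ _ ((1 + exp_rem (`|t| * Em) K) ^+ 2 * list_norm (fs M))); last first.
  by apply: ler_wpM2l; [exact: sqr_ge0|exact: cutoff_diff].
apply: le_trans (evol_partial_l2 t K (fsV M) Em0 EEm Bin).
rewrite big_seq [leRHS]big_seq; apply: ler_sum => v vB.
by rewrite (MP v vB) evol_partialB //; exact: BV.
Unshelve. all: by end_near. Qed.

End InitialState.

(** * Correlations of the evolved state on the Bloch side *)

Lemma dotBl (x y z : 'cV[R[i]]_nu) : dot (x - y) z = dot x z - dot y z.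
Proof.
rewrite !dotE -sumrB; apply: eq_bigr => m _.
by rewrite !mxE rmorphB /= mulrBl.
Qed.

Lemma vnN (x : 'cV[R[i]]_nu) : vn (- x) = vn x.
Proof.
congr (Num.sqrt _); apply: eq_bigr => m _; rewrite mxE.
by rewrite -!cnorm_sqr cnormN.
Qed.

Lemma dot_dist (x y x' y' : 'cV[R[i]]_nu) c :
  `|complex.Re (expi c * dot x y) - complex.Re (expi c * dot x' y')| <=
    nu%:R * (vn (x - x') * vn y + vn x' * vn (y - y')).
Proof.
rewrite -ReN -ReD -mulrBr; apply: le_trans (Re_le_cnorm _) _.
rewrite cnormM cnorm_expi mul1r.
have -> : dot x y - dot x' y' = dot (x - x') y + dot x' (y - y').
  by rewrite dotBl dotBr addrA subrK.
apply: le_trans (ler_cnormD _ _) _; rewrite mulrDr.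
by apply: lerD; exact: cnorm_dot.
Qed.

Lemma Re_dot_le (x y : 'cV[R[i]]_nu) c : `|complex.Re (expi c * dot x y)| <= nu%:R * (vn x * vn y).
Proof.
apply: le_trans (Re_le_cnorm _) _; rewrite cnormM cnorm_expi mul1r; exact: cnorm_dot.
Qed.

Definition symbol_corr t s ze c th : R :=
  complex.Re (expi c * dot (evol_symbol t s th) (evol_symbol t s (fun i => th i - ze i))).

Definition partial_corr t K s ze c th : R :=
  complex.Re (expi c * dot (F (lpartial adj Q t K s) th) (F (lpartial adj Q t K s) (fun i => th i - ze i))).

Lemma vn_symbol t s th : vn (evol_symbol t s th) = vn (F s th).
Proof. exact: (vn_phase t _ (EPH th)). Qed.

Lemma vn_le_of_sqr (x y : 'cV[R[i]]_nu) m : 0 <= m -> vnorm2 x <= m ^+ 2 * vnorm2 y -> vn x <= m * vn y.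
Proof.
move=> m0; rewrite -!vn_sqr -exprMn ler_sqr // nnegrE ?mulr_ge0 ?vn_ge0 //.
Qed.

(** The bound is uniform in theta, in the shift and in the phase, so it yields both measurability of
    [symbol_corr] and convergence of its integrals. *)
Lemma corr_dist t s : onV V s -> exists2 r : R, 0 <= r & exists2 S : R, 0 <= S & forall K ze c th,
  `|partial_corr t K s ze c th - symbol_corr t s ze c th| <= exp_rem r K * S.
Proof.
move=> sV; have [Em Em0 EEm] := E_bound; exists (`|t| * Em); first by rewrite mulr_ge0.
pose S := nu%:R * \sum_(p <- s) cnorm p.2.
have S0 : 0 <= S by rewrite mulr_ge0 // sumr_ge0 // => p _; exact: cnorm_ge0.
have r0 : 0 <= `|t| * Em by rewrite mulr_ge0.
exists (nu%:R * ((2 + expR (`|t| * Em)) * (S * S))).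
  apply: mulr_ge0 => //; apply: mulr_ge0; last exact: mulr_ge0.
  by have := expR_ge0 (`|t| * Em); lra.
move=> K ze c th; set rm := exp_rem _ _.
have rm0 : 0 <= rm by exact: exp_rem_ge0.
have rm1 : rm <= expR (`|t| * Em) by exact: exp_rem_le.
apply: le_trans (dot_dist _ _ _ _ _) _; rewrite vn_symbol mulrCA ler_wpM2l //.
set th' := fun i => th i - ze i.
have vS th0 : vn (F s th0) <= S by exact: vn_fourier_le.
have bp th0 : vn (F (lpartial adj Q t K s) th0) <= (1 + rm) * S.
  apply: le_trans (vn_le_of_sqr _ (symbol_bounds t K th0 sV Em0 EEm).1) _; first by rewrite addr_ge0.
  by apply: ler_wpM2l => //; rewrite addr_ge0.
have bd th0 : vn (F (lpartial adj Q t K s) th0 - evol_symbol t s th0) <= rm * S.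
  apply: le_trans (vn_le_of_sqr rm0 (symbol_bounds t K th0 sV Em0 EEm).2) _.
  exact: ler_wpM2l.
have h1 : vn (F (lpartial adj Q t K s) th - evol_symbol t s th) * vn (F (lpartial adj Q t K s) th') <=
    (rm * S) * ((1 + rm) * S) by apply: ler_pM; rewrite ?vn_ge0.
have h2 : vn (F s th) * vn (F (lpartial adj Q t K s) th' - evol_symbol t s th') <= S * (rm * S).
  by apply: ler_pM; rewrite ?vn_ge0.
have h3 : rm * (S * S) * rm <= rm * (S * S) * expR (`|t| * Em).
  by rewrite ler_wpM2l // mulr_ge0 // mulr_ge0.
have E1 : rm * S * ((1 + rm) * S) = rm * (S * S) + rm * (S * S) * rm by ring.
have E2 : S * (rm * S) = rm * (S * S) by ring.
have E3 : rm * ((2 + expR (`|t| * Em)) * (S * S)) =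
    rm * (S * S) + rm * (S * S) + rm * (S * S) * expR (`|t| * Em) by ring.
rewrite E1 in h1; rewrite E2 in h2; rewrite E3 [leRHS]addrAC.
by apply: lerD h2; apply: le_trans h1 _; rewrite lerD2l.
Qed.

Lemma partial_corr_measurable t K s ze c : onV V s ->
  measurable_fun T (fun th : d.-tuple R => partial_corr t K s ze c (tnth th)).
Proof.
move=> sV; apply: lipschitz_measurable; apply: dot_fourier_lipschitz.
exact: onV_lpartial.
Qed.

(** [E] and [P] come without joint regularity; measurability is inherited from the partial series,
    whose correlations are trigonometric polynomials in theta. *)
Lemma symbol_corr_measurable t s ze c : onV V s ->
  measurable_fun T (fun th : d.-tuple R => symbol_corr t s ze c (tnth th)).
Proof.
move=> sV; have [r r0 [S S0 h]] := corr_dist t sV.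
apply: (measurable_fun_cvg (h := fun K x => partial_corr t K s ze c (tnth x))).
  by move=> K; exact: partial_corr_measurable.
move=> x _; apply: (@cvg_dist_le _ (fun K => exp_rem r K * S)) => [K|]; first exact: h.
by rewrite -[0](mul0r S); apply: cvgM; [exact: exp_rem_cvg0|exact: cvg_cst].
Qed.

Lemma symbol_corr_le t s ze c th :
  `|symbol_corr t s ze c th| <= nu%:R * (nu%:R * \sum_(p <- s) cnorm p.2) ^+ 2.
Proof.
apply: le_trans (Re_dot_le _ _ _) _; rewrite !vn_symbol ler_wpM2l // expr2.
by apply: ler_pM; rewrite ?vn_ge0 ?vn_fourier_le.
Qed.

Lemma symbol_corr_integrable t s ze c : onV V s ->
  lam.-integrable T (EFin \o (fun th : d.-tuple R => symbol_corr t s ze c (tnth th))).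
Proof.
move=> sV; apply: (@bounded_integrable _ _ _ Hlam _ _ (nu%:R * (nu%:R * \sum_(p <- s) cnorm p.2) ^+ 2)).
- exact: measurable_torus.
- exact: subset_refl.
- exact: symbol_corr_measurable.
- by move=> th _; exact: symbol_corr_le.
Qed.

Lemma Rintegral_dist (f g : d.-tuple R -> R) (e : R) : lam.-integrable T (EFin \o f) ->
  lam.-integrable T (EFin \o g) -> (forall x, T x -> `|f x - g x| <= e) ->
  `|\int[lam]_(x in T) f x - \int[lam]_(x in T) g x|%R <= e.
Proof.
move=> fi gi fg; have mT := @measurable_torus R d.
rewrite -RintegralB //; have fgi := integrableB_EFin mT fi gi.
apply: le_trans (le_normr_Rintegral mT fgi) _.
have -> : e = (\int[lam]_(x in T) (cst e x))%R.
  by rewrite Rintegral_cst // (lam_torus Hlam) mulr1.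
apply: le_Rintegral => //=.
- exact: (integrable_abse fgi).
- by apply: (@bounded_integrable _ _ _ Hlam _ _ `|e|).
Qed.

(* The weighted position sum is a finite one for the [K]-th partial exponential, whose
   [l2]-distance to the evolution tends to [0] with [K], uniformly in the finite set [B]. *)
Lemma evol_characteristic t s ze c : onV V s ->
  netlim V (fun v => cos (2 * pi * lin ze (cd a v) + c) * cabs2 (evol adj Q t (lfun s) v))
    (\int[lam]_(th in T) symbol_corr t s ze c (tnth th))%R.
Proof.
move=> sV e e0; have [r r0 [S S0 hS]] := corr_dist t sV; have [Em Em0 EEm] := E_bound.
pose m := list_norm s; have m0 : 0 <= m := list_norm_ge0 s.
(* The errors are [de * S] for the integral, [2 * de * m] for the remainder and [4 * de * m] for the
   mass of the partial sum; the last two use [de <= 1]. *)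
pose de := Num.min 1 (e / (6 * m + S + 1)).
have q0 : 0 < 6 * m + S + 1 by move: m0 S0; lra.
have de0 : 0 < de by rewrite lt_min ltr01 divr_gt0.
have de1 : de <= 1 by rewrite ge_min lexx.
have deq : de * (6 * m + S + 1) <= e by rewrite -ler_pdivlMr // ge_min lexx orbT.
have hK : \forall K \near \oo, exp_rem r K <= de /\ exp_rem (`|t| * Em) K <= de.
  have h0 rr : \forall K \near \oo, exp_rem rr K <= de.
    have /cvgrPdist_le/(_ _ de0) := @exp_rem_cvg0 R rr.
    by apply: filterS => K; rewrite sub0r normrN; exact: le_trans (ler_norm _).
  by near=> K; split; near: K; exact: h0.
have [K [rK rK']] := filter_ex hK.
set rm := exp_rem (`|t| * Em) K in rK'.
have rm0 : 0 <= rm by apply: exp_rem_ge0; rewrite mulr_ge0.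
have pV : onV V (lpartial adj Q t K s) by exact: onV_lpartial.
exists (undup [seq p.1 | p <- lpartial adj Q t K s]).
  by split; [exact: undup_uniq|move=> v; rewrite mem_undup => /mapP[p /pV pv ->]].
move=> B Bin sB; have [_ BV] := Bin.
have sB' : {subset [seq p.1 | p <- lpartial adj Q t K s] <= B}.
  by move=> v vs; apply: sB; rewrite mem_undup.
have pars := parseval Ha_basis Hdual HV_per Hvf_inj Hvf Hlam ze c pV Bin sB'.
have I1 : `|\sum_(v <- B) cos (2 * pi * lin ze (cd a v) + c) * cabs2 (lfun (lpartial adj Q t K s) v) -
     \int[lam]_(th in T) symbol_corr t s ze c (tnth th)|%R <= exp_rem r K * S.
  rewrite -pars; apply: Rintegral_dist.
  - exact: (lipschitz_integrable Hlam (@measurable_torus R d) (@subset_refl _ _)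
      (dot_fourier_lipschitz ze c pV)).
  - exact: symbol_corr_integrable.
  - by move=> th _; exact: hS.
have I2 : `|\sum_(v <- B) cos (2 * pi * lin ze (cd a v) + c) * cabs2 (evol adj Q t (lfun s) v) -
   \sum_(v <- B) cos (2 * pi * lin ze (cd a v) + c) * cabs2 (lfun (lpartial adj Q t K s) v)| <= de * (6 * m).
  rewrite -sumrB; apply: le_trans (ler_norm_sum _ _ _) _.
  pose x v := evol adj Q t (lfun s) v; pose y v := evol_partial adj Q t (lfun s) v K.
  apply: (@le_trans _ _ (\sum_(v <- B) ((1 + de^-1) * cabs2 (x v - y v) + de * cabs2 (y v)))).
    rewrite big_seq [leRHS]big_seq; apply: ler_sum => v /BV Vv.
    rewrite -mulrBr normrM (lfun_lpartial Hadj_V Hadj_sym Hlocfin) //.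
    apply: le_trans (cabs2_dist _ _ de0); rewrite -[leRHS]mul1r ler_wpM2r //.
    by rewrite ler_norml cos_geN1 cos_le1.
  rewrite big_split -!mulr_sumr /=.
  have s1 : \sum_(v <- B) cabs2 (y v) <= (1 + rm) ^+ 2 * m by exact: evol_partial_l2.
  have s2 : \sum_(v <- B) cabs2 (x v - y v) <= rm ^+ 2 * m by exact: evol_remainder_l2.
  have h1 : (1 + rm) ^+ 2 * m <= 4 * m.
    apply: ler_wpM2r => //; rewrite (_ : 4 = 2 ^+ 2); last by ring.
    by apply: lerXn2r; rewrite ?nnegrE //; move: rm0 rK' de1; lra.
  have h2 : rm ^+ 2 * m <= de ^+ 2 * m by rewrite ler_wpM2r // ler_sqr ?nnegrE // ltW.
  apply: (@le_trans _ _ ((1 + de^-1) * (de ^+ 2 * m) + de * (4 * m))).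
    apply: lerD.
      apply: ler_wpM2l (le_trans s2 h2).
      by rewrite addr_ge0 // invr_ge0 ltW.
    exact: ler_wpM2l (ltW de0) _ _ (le_trans s1 h1).
  have -> : (1 + de^-1) * (de ^+ 2 * m) = de * (de + 1) * m by field; rewrite gt_eqF.
  have : de * (de + 1) * m <= de * 2 * m.
    apply: ler_wpM2r => //; apply: (ler_wpM2l (ltW de0)); lra.
  lra.
have : exp_rem r K * S <= de * S by rewrite ler_wpM2r.
move: I1 I2; rewrite !ler_norml => /andP[? ?] /andP[? ?] ?; apply/andP; split; lra.
Unshelve. all: by end_near. Qed.

(** * Linear bound on the spreading *)

Lemma lfun_weight s : exists2 A, 0 <= A & forall v, cnorm (lfun s v) <= A * weight a v.
Proof.
have w0 v : 0 < weight a v by exact: expR_gt0.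
exists (\sum_(p <- s) cnorm p.2 / weight a p.1).
  by apply: sumr_ge0 => p _; rewrite mulr_ge0 ?cnorm_ge0 // invr_ge0 ltW.
move=> v; apply: le_trans (ler_cnorm_sum _ _ _) _; rewrite mulr_suml.
apply: ler_sum => p _; rewrite cnormM; case: eqVneq => [->|_].
  by rewrite divfK ?gt_eqF // -expi0 cnorm_expi mulr1.
rewrite cnorm0 mulr0 mulr_ge0 ?mulr_ge0 ?cnorm_ge0 ?invr_ge0 //; exact: ltW.
Qed.

(** The amplitude is at most [A * weight * exp (r * t)]. Of the two weights in its square, one stays
    for summability and the other is at most [exp (- (2 * r + 1) * t)] outside the box, leaving
    [exp (- t)]. The speed [2 * r + 1] depends on the graph and potential, not on the state. *)
Lemma evol_tail : exists2 L, 0 < L & forall s, onV V s -> forall e, 0 < e ->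
  exists2 t0, 0 < t0 & forall t B, t0 <= t -> seq_in V B ->
   \sum_(v <- B | ~~ [forall i, `|cd a v i| <= L * t]) cabs2 (evol adj Q t (lfun s) v) <= e.
Proof.
have [D D0 DP] := evol_bound Ha_basis Hadj_V Hlocfin HV_per Hadj_per HQ_per Hvf.
have [be be0 beP] := neighbour_weight Ha_basis Hlocfin HV_per Hadj_per Hvf.
have [W W0 WP] := weight_sum Ha_basis HV_per Hvf_inj Hvf.
have w0 v : 0 <= weight a v by exact: weight_ge0.
pose r := D * (be + 1); have r0 : 0 <= r by rewrite mulr_ge0 ?addr_ge0.
exists (2 * r + 1); first by move: r0; lra.
move=> s sV e e0; have [A A0 AP] := lfun_weight s.
pose Z := A ^+ 2 * W; have Z0 : 0 <= Z by rewrite mulr_ge0 ?exprn_ge0.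
exists (Z / e + 1); first by rewrite ltr_wpDl // divr_ge0 // ltW.
move=> t B tt Bin; have [_ BV] := Bin.
have Ze0 : 0 <= Z / e by rewrite divr_ge0 // ltW.
have t0 : 0 <= t by move: tt Ze0; lra.
have bound v : V v -> ~~ [forall i, `|cd a v i| <= (2 * r + 1) * t] ->
    cabs2 (evol adj Q t (lfun s) v) <= A ^+ 2 * expR (- t) * weight a v.
  move=> Vv /forallPn[j]; rewrite -ltNge => iL.
  have [_ h] := DP _ _ _ _ be0 A0 w0 beP (fun v _ => AP v) t v Vv.
  rewrite -/r (ger0_norm t0) in h.
  have wL : weight a v <= expR (- ((2 * r + 1) * t)).
    rewrite /weight ler_expR lerN2 (bigD1 j) //=; apply: le_trans (ltW iL) _.
    by rewrite lerDl sumr_ge0.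
  rewrite -cnorm_sqr.
  apply: (@le_trans _ _ ((A * weight a v * expR (t * r)) ^+ 2)).
    apply: lerXn2r => //; rewrite nnegrE ?cnorm_ge0 //.
    by rewrite !mulr_ge0 // expR_ge0.
  have -> : (A * weight a v * expR (t * r)) ^+ 2 =
      (A ^+ 2 * weight a v * expR (t * r) ^+ 2) * weight a v by ring.
  apply: (@le_trans _ _ ((A ^+ 2 * weight a v * expR (t * r) ^+ 2) * expR (- ((2 * r + 1) * t)))).
    apply: ler_wpM2l wL; rewrite !mulr_ge0 ?exprn_ge0 ?expR_ge0 //.
  rewrite -mulrA [expR _ ^+ 2]expr2 -!expRD (_ : t * r + t * r + _ = - t); last by ring.
  by rewrite mulrAC.
apply: (@le_trans _ _ (\sum_(v <- B) A ^+ 2 * expR (- t) * weight a v)).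
  rewrite big_mkcond big_seq [leRHS]big_seq; apply: ler_sum => v /BV Vv.
  case: ifP => [h|_]; first exact: bound.
  by rewrite mulr_ge0 // mulr_ge0 ?exprn_ge0 ?expR_ge0.
rewrite -mulr_sumr; apply: (@le_trans _ _ (A ^+ 2 * expR (- t) * W)).
  by apply: ler_wpM2l; [rewrite mulr_ge0 ?exprn_ge0 ?expR_ge0|exact: WP].
rewrite mulrAC -/Z expRN ler_pdivrMr ?expR_gt0 //.
have : e * (1 + t) <= e * expR t by apply: (ler_wpM2l (ltW e0)); exact: expR_ge1Dx.
apply: le_trans; rewrite mulrC -ler_pdivrMr //; move: tt; lra.
Qed.

Lemma bounded_cvg_Rintegral (G : set (d.-tuple R)) (f_ : nat -> d.-tuple R -> R)
    (f : d.-tuple R -> R) (m : R) :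
  measurable G -> G `<=` T -> (forall n, measurable_fun G (f_ n)) ->
  (forall x, G x -> f_ n x @[n --> \oo] --> f x) -> (forall n x, G x -> `|f_ n x| <= m) ->
  [/\ measurable_fun G f, (forall x, G x -> `|f x| <= m) &
    (\int[lam]_(x in G) f_ n x)%R @[n --> \oo] --> (\int[lam]_(x in G) f x)%R].
Proof.
move=> mG GT mf cf fm.
have mff : measurable_fun G f by apply: (measurable_fun_cvg mf).
have fb x : G x -> `|f x| <= m.
  move=> Gx; apply: (@lim_le_lim (fun n => `|f_ n x|) (fun=> m)).
  - by apply: cvg_norm; exact: cf.
  - exact: cvg_cst.
  - by move=> n; exact: fm.
split=> //.
have inF (g : d.-tuple R -> R) : measurable_fun G g -> (forall x, G x -> `|g x| <= m) ->
    (\int[lam]_(x in G) (g x)%:E)%E \is a fin_num.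
  move=> mg gm; apply: integrable_fin_num => //.
  exact: (@bounded_integrable _ _ _ Hlam _ _ m).
have : (\int[lam]_(x in G) (f_ n x)%:E)%E @[n --> \oo] --> (\int[lam]_(x in G) (f x)%:E)%E.
  apply: (@dominated_cvg _ _ _ lam G mG (fun n x => (f_ n x)%:E) (fun x => (f x)%:E) (fun=> m%:E)).
  - by move=> n; apply/measurable_EFinP.
  - by move=> x Gx; apply/fine_cvgP; split; [exact: nearW|exact: cf].
  - by [].
  - by apply: (@bounded_integrable _ _ _ Hlam _ (fun=> m) `|m|).
  - by move=> n x Gx; rewrite lee_fin fm.
rewrite -[X in _ --> X -> _](fineK (inF f mff fb)) => /fine_cvgP[_]; exact.
Qed.

(** * Velocities at points of differentiability *)

Definition gradE th n i : R := derive1 (fun r => E (fun j => th j + (if j == i then r else 0)) n) 0.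

Definition vel th n i : R := (2 * pi)^-1 * gradE th n i.

Definition regular th := forall n, dir_differentiable (fun x => E x n) th (gradE th n).

Lemma regular_ae : exists N : set (d.-tuple R), [/\ measurable N, lam N = 0%E &
  forall th : d.-tuple R, T th -> ~ N th -> regular (tnth th)].
Proof.
(* [k] runs over all naturals to form a countable union. Band [n] then uses the sums of orders
   [n.+1] and [n]. *)
have neg (k : nat) : lam.-negligible [set th | T th /\ (k <= nu)%N /\
    ~ exists g, dir_differentiable (fun x => eigsum (E x) k) (tnth th) g].
  have [knu|knu] := leqP k nu; last first.
    by exists set0; split => // th [_ []].
  have [K K0 fK] := eigsum_semiconcave bloch_trig EPH Einc knu.
  have [C C0 fC] := eigsum_lipschitz bloch_trig EPH Einc knu.
  have [N [mN N0 NP]] := ae_good_point Hlam C0 fK fC.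
  exists N; split=> // th [Tth [_ bad]]; apply: NP; split=> // gp; apply: bad.
  exact: (good_dir_differentiable K0 fK gp).
have [N [mN N0 NP]] := negligible_bigcup neg; exists N; split=> // th Tth nN n.
have dd (k : nat) : (k <= nu)%N -> exists g, dir_differentiable (fun x => eigsum (E x) k) (tnth th) g.
  move=> knu; apply: contrapT => bad; apply: nN; apply: NP; by exists k.
have [g1 h1] := dd n.+1 (ltn_ord n); have [g0 h0] := dd n (ltnW (ltn_ord n)).
have h : dir_differentiable (fun x => E x n) (tnth th) (fun i => g1 i - g0 i).
  have := dir_differentiableB h1 h0; congr (dir_differentiable _ _ _).
  by apply/funext => x; rewrite -E_eigsum.
suff -> : gradE (tnth th) n = fun i => g1 i - g0 i by [].
by apply/funext => i; exact: (dir_differentiable_derive1 i h).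
Qed.

Lemma invS_pinfty : (j.+1%:R : R) @[j --> \oo] --> +oo.
Proof.
apply/cvgryPge => A; near=> j; apply: (@le_trans _ _ (Num.bound `|A|)%:R).
  apply: le_trans (ler_norm A) _; rewrite (le_trans (ltW (archi_boundP (normr_ge0 A)))) //.
rewrite ler_nat; apply: leqW; near: j; exact: nbhs_infty_ge.
Unshelve. all: by end_near. Qed.

Lemma dist1_shift (x v : 'I_d -> R) r : dist1 x (shift x v r) = `|r| * \sum_i `|v i|.
Proof.
rewrite mulr_sumr; apply: eq_bigr => i _; rewrite /shift opprD addrA subrr add0r normrN.
by rewrite normrM.
Qed.

Lemma vel_bounded : exists2 L, 0 <= L & forall th n i, regular th -> `|vel th n i| <= L.
Proof.
have hC n : exists C, 0 <= C /\ forall x y, `|E x n - E y n| <= C * dist1 x y.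
  by have [C C0 CP] := E_lipschitz bloch_trig EPH Einc n; exists C.
have [C CP] := choice hC.
exists ((2 * pi)^-1 * \sum_n C n).
  by rewrite mulr_ge0 ?invr_ge0 ?mulr_ge0 ?pi_ge0 // sumr_ge0 // => n _; have [] := CP n.
move=> th n i reg; have [C0 CL] := CP n.
rewrite normrM ger0_norm ?invr_ge0 ?mulr_ge0 ?pi_ge0 // ler_wpM2l ?invr_ge0 ?mulr_ge0 ?pi_ge0 //.
apply: (@le_trans _ _ (C n)); last first.
  rewrite (bigD1 n) //= lerDl; apply: sumr_ge0 => m _; by have [] := CP m.
have := dir_differentiable_cvg (v := axis i 1) (reg n) invS_pinfty; rewrite lin_axis mulr1 => cv.
apply: (lim_le_lim (cvg_norm cv) (cvg_cst (C n))) => j.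
rewrite normrM; apply: le_trans (ler_wpM2l (normr_ge0 _) (CL _ _)) _.
rewrite dist1_shift normrN normfV [C n * _]mulrCA mulVKf ?normr_eq0 //.
rewrite (bigD1 i) //= big1 => [|k /negbTE ki]; last by rewrite /axis ki normr0.
by rewrite /axis eqxx normr1 addr0 mulr1.
Qed.

Lemma fourier_lipschitz s : exists2 C, 0 <= C & forall x y k,
  cnorm (F s x k 0 - F s y k 0) <= C * dist1 x y.
Proof.
exists (\sum_(p <- s) cnorm p.2 * (2 * (2 * pi * \sum_i `|cd a p.1 i|))).
  by apply: sumr_ge0 => p _; rewrite !mulr_ge0 ?cnorm_ge0 ?pi_ge0 ?sumr_ge0.
move=> x y k; rewrite !mxE -sumrB mulr_suml; apply: le_trans (ler_cnorm_sum _ _ _) _.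
apply: ler_sum => p _; rewrite -mulrBr cnormM -[leRHS]mulrA; apply: ler_wpM2l; first exact: cnorm_ge0.
case: ifP => _; last first.
  by rewrite subrr cnorm0 !mulr_ge0 ?pi_ge0 ?sumr_ge0 // => i _; rewrite normr_ge0.
apply: le_trans (dist_expi _ _) _; rewrite -[leRHS]mulrA; apply: ler_wpM2l => //.
rewrite !(dotp_thb Ha_basis Hdual).
rewrite -opprD normrN -mulrBr normrM ger0_norm ?mulr_ge0 ?pi_ge0 // -[leRHS]mulrA.
apply: ler_wpM2l; first by rewrite mulr_ge0 ?pi_ge0.
have linC z : lin z (cd a p.1) = lin (cd a p.1) z.
  by apply: eq_bigr => i _; rewrite mulrC.
rewrite !linC; exact: dist_lin.
Qed.

Lemma cvg0_mull (C : R) (u : nat -> R) : u j @[j --> \oo] --> 0 -> C * u j @[j --> \oo] --> 0.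
Proof.
move=> u0; have hC : (fun _ : nat => C) @ \oo --> C by exact: cvg_cst.
have := cvgM hC u0; rewrite mulr0; exact.
Qed.

(* At a crossing, [E y m - E y n] attains its minimum [0] at [th]. *)
Lemma vel_crossing th (v : 'I_d -> R) n m : regular th -> E th n = E th m ->
  lin (gradE th n) v = lin (gradE th m) v.
Proof.
move=> reg; wlog nm : n m / (n <= m)%N => [H|] Enm.
  by case/orP: (leq_total n m) => h; [exact: H|symmetry; apply: H].
have : lin (fun i => gradE th m i - gradE th n i) v = 0.
  apply: dir_differentiable_extremum (dir_differentiableB (reg m) (reg n)) _ => y.
  by rewrite Enm subrr subr_ge0; exact: Einc.
have -> : lin (fun i => gradE th m i - gradE th n i) v = lin (gradE th m) v - lin (gradE th n) v.
  by rewrite -sumrB; apply: eq_bigr => i _; rewrite mulrBl.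
by move/subr0_eq.
Qed.

(** Real part of [expi c] times the integrand of the characteristic function, at [eta], of the
    velocity law of the finite state. *)
Definition vel_corr s (eta : 'I_d -> R) c th : R :=
  \sum_n cos (lin eta (vel th n) + c) * vnorm2 (P th n *m F s th).

Lemma symbol_corr_cvg s (eta : 'I_d -> R) c (t_ : nat -> R) th : regular th ->
  t_ j @[j --> \oo] --> +oo ->
  symbol_corr (t_ j) s (fun i => (t_ j)^-1 * (eta i / (2 * pi))) c th @[j --> \oo] -->
  vel_corr s eta c th.
Proof.
move=> reg tinf; pose v : 'I_d -> R := fun i => eta i / (2 * pi).
pose x j : 'I_d -> R := fun i => th i - (t_ j)^-1 * v i.
have xE j : x j = shift th v (- (t_ j)^-1) by apply/funext => i; rewrite /shift mulNr.
have tinv : `|(t_ j)^-1| @[j --> \oo] --> (0 : R).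
  rewrite -(normr0 R); apply: cvg_norm; apply/cvgrPdist_le => e e0.
  have /cvgryPge/(_ e^-1) := tinf; apply: filterS => j h.
  have tj : 0 < t_ j by apply: lt_le_trans h; rewrite invr_gt0.
  by rewrite sub0r normrN gtr0_norm ?invr_gt0 // -[e]invrK lef_pV2 ?posrE ?invr_gt0.
have dx : dist1 th (x j) @[j --> \oo] --> (0 : R).
  have -> : (fun j => dist1 th (x j)) = fun j => (\sum_i `|v i|) * `|(t_ j)^-1|.
    by apply/funext => j; rewrite xE dist1_shift normrN mulrC.
  exact: cvg0_mull.
have lip0 (C : R) : C * dist1 th (x j) @[j --> \oo] --> (0 : R).
  exact: cvg0_mull.
have cdist (z w : R[i]) : cnorm (z - w) = cnorm (w - z) by rewrite -cnormN opprB.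
have [KH KH0 HL] := H_lipschitz bloch_trig.
have [KF KF0 FL] := fourier_lipschitz s.
have := @perturbation_limit R nu (E th) (P th) _ (fun j => E (x j)) (fun j => P (x j)) _
  (EPH th) (fun j => EPH (x j)) (F s th) (fun j => F s (x j)) t_ (fun n => lin (gradE th n) v).
move=> H; have {H} : cnorm (dot (spec_fun (P th) (phase (t_ j) (E th)) (F s th))
      (spec_fun (P (x j)) (phase (t_ j) (E (x j))) (F s (x j)))
     - \sum_n expi (lin (gradE th n) v) * (vnorm2 (P th n *m F s th))%:C%C) @[j --> \oo] --> (0 : R).
  apply: H.
  - move=> k l; apply: cvg_dist_le (lip0 KH) => j.
    by rewrite subr0 ger0_norm ?cnorm_ge0 // cdist.
  - move=> k; apply: cvg_dist_le (lip0 KF) => j.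
    by rewrite subr0 ger0_norm ?cnorm_ge0 // cdist.
  - move=> n; have [KE KE0 EL] := E_lipschitz bloch_trig EPH Einc n.
    by apply: cvg_dist_le (lip0 KE) => j; rewrite distrC.
  - move=> n; under eq_fun do rewrite xE.
    exact: dir_differentiable_cvg (reg n) tinf.
  - by move=> n m; exact: vel_crossing.
apply: cvg_dist_le => j.
have -> : vel_corr s eta c th = complex.Re (expi c *
    \sum_n expi (lin (gradE th n) v) * (vnorm2 (P th n *m F s th))%:C%C).
  rewrite mulr_sumr Re_sum; apply: eq_bigr => n _; rewrite mulrA -expiD [in RHS]mulrC ReMr mulrC.
  congr (_ * cos _); rewrite addrC; congr (_ + _).
  by apply: eq_bigr => i _; rewrite /vel /v; ring.
rewrite -ReN -ReD -mulrBr; apply: le_trans (Re_le_cnorm _) _.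
by rewrite cnormM cnorm_expi mul1r.
Qed.

(** Off [Z] the limit is measurable as a pointwise limit. The integrals of [symbol_corr] do not see
    [Z], since those functions are integrable on the whole torus. *)
Lemma vel_corr_limit s (eta : 'I_d -> R) c (t_ : nat -> R) (Z : set (d.-tuple R)) : onV V s ->
  measurable Z -> lam Z = 0%E -> (forall th : d.-tuple R, T th -> ~ Z th -> regular (tnth th)) ->
  t_ j @[j --> \oo] --> +oo ->
  measurable_fun (T `\` Z) (fun th : d.-tuple R => vel_corr s eta c (tnth th)) /\
  (\int[lam]_(th in T) symbol_corr (t_ j) s (fun i => (t_ j)^-1 * (eta i / (2 * pi))) c (tnth th))%R
    @[j --> \oo] --> (\int[lam]_(th in T `\` Z) vel_corr s eta c (tnth th))%R.
Proof.
move=> sV mZ Z0 reg tinf; have mT := @measurable_torus R d.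
have mG : measurable (T `\` Z) by exact: measurableD.
have GT : T `\` Z `<=` T by apply: subDsetl.
pose f_ j (x : d.-tuple R) :=
  symbol_corr (t_ j) s (fun i => (t_ j)^-1 * (eta i / (2 * pi))) c (tnth x).
have [] := @bounded_cvg_Rintegral (T `\` Z) f_ (fun x => vel_corr s eta c (tnth x))
  (nu%:R * (nu%:R * \sum_(p <- s) cnorm p.2) ^+ 2) mG GT.
- by move=> j; apply: (measurable_funS mT GT); exact: symbol_corr_measurable.
- by move=> x [Tx Zx]; apply: symbol_corr_cvg => //; exact: reg.
- by move=> j x _; exact: symbol_corr_le.
move=> mv _ cv; split=> //.
have -> : (fun j => \int[lam]_(x in T) f_ j x)%R = fun j => (\int[lam]_(x in T `\` Z) f_ j x)%R.
  apply/funext => j; rewrite /Rintegral (negligible_integral mZ mT _ Z0) //.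
  exact: symbol_corr_integrable.
exact: cv.
Qed.

Lemma continuous_comb (g : 'rV[R]_d -> R) (q : nat -> 'I_d -> R) (l : 'I_d -> R) :
  continuous g -> (forall i, q j i @[j --> \oo] --> l i) ->
  g (\sum_i q j i *: a i) @[j --> \oo] --> g (\sum_i l i *: a i).
Proof.
move=> cg ql; apply: (@cvg_comp _ _ _ (fun j => \sum_i q j i *: a i) g); last exact: cg.
apply: cvg_big => [|i _]; [exact: add_continuous|apply: cvgZr_tmp; exact: ql].
Qed.

Definition diff_quot j th n i : R :=
  (2 * pi)^-1 * (j.+1%:R * (E th n - E (shift th (axis i 1) (- j.+1%:R^-1)) n)).

Lemma diff_quot_cvg th n i : regular th -> diff_quot j th n i @[j --> \oo] --> vel th n i.
Proof.
move=> reg; rewrite /vel -[gradE th n i]mulr1 -lin_axis; apply: cvgM; first exact: cvg_cst.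
exact: dir_differentiable_cvg (reg n) invS_pinfty.
Qed.

(** Off [Z] the velocity is a limit of difference quotients with steps [1 / (j + 1)], which are
    Lipschitz in theta; continuity of [g] then transfers measurability. *)
Lemma vel_measurable (g : 'rV[R]_d -> R) n (Z : set (d.-tuple R)) : continuous g -> measurable Z ->
  (forall th : d.-tuple R, T th -> ~ Z th -> regular (tnth th)) ->
  measurable_fun (T `\` Z) (fun th : d.-tuple R => g (\sum_i vel (tnth th) n i *: a i)).
Proof.
move=> cg mZ reg; have mT := @measurable_torus R d.
apply: (measurable_fun_cvg (h := fun j x => g (\sum_i diff_quot j (tnth x) n i *: a i))); last first.
  move=> x [Tx Zx]; apply: continuous_comb => // i; apply: diff_quot_cvg; exact: reg.
move=> j; apply: (measurable_funS mT (@subDsetl _ _ _)).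
apply: (measurable_fun_rounding (F := fun th => g (\sum_i diff_quot j th n i *: a i))) => x x0.
apply: (continuous_comb (q := fun M i => diff_quot j (round M x) n i) cg) => i.
have [C C0 CL] := E_lipschitz bloch_trig EPH Einc n.
have rd := cvg_dist1_round x0.
have cE (v : 'I_d -> R) : E (shift (round M x) v (- j.+1%:R^-1)) n @[M --> \oo] --> E (shift x v (- j.+1%:R^-1)) n.
  apply: cvg_dist_le (cvg0_mull C rd) => M; apply: le_trans (CL _ _) _.
  apply: ler_wpM2l => //; apply: ler_sum => k _; rewrite /shift.
  by rewrite opprD addrACA subrr addr0.
rewrite /diff_quot; apply: cvgM; first exact: cvg_cst.
apply: cvgM; first exact: cvg_cst.
apply: cvgB; last exact: cE.
exact: cvg_dist_le (fun M => CL _ _) (cvg0_mull C rd).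
Qed.

Lemma vnorm2_dist (x y : 'cV[R[i]]_nu) (e : R) : 0 < e ->
  `|vnorm2 x - vnorm2 y| <= (1 + e^-1) * vnorm2 (x - y) + e * vnorm2 y.
Proof.
move=> e0; rewrite /vnorm2 -sumrB !mulr_sumr -big_split; apply: le_trans (ler_norm_sum _ _ _) _.
by apply: ler_sum => m _; rewrite /= !mxE; exact: cabs2_dist.
Qed.

(** * From finite states to [psi], and from trigonometric polynomials to test functions *)

Section Convergence.
Variables (psi : 'rV[R]_d -> R[i]) (Phi : d.-tuple R -> 'I_nu -> R[i]).
Hypothesis Hpsi : (\esum_(v in V) (cabs2 (psi v))%:E = 1)%E.
Hypothesis HPhi_meas : forall n,
  measurable_fun T (fun x : d.-tuple R => complex.Re (Phi x n)) /\
  measurable_fun T (fun x : d.-tuple R => complex.Im (Phi x n)).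
Hypothesis HPhi : (fun N : nat => (\int[lam]_(th in T)
             (\sum_(n < nu) cabs2 (Upartial a b vf psi N (tnth th) n - Phi th n))%:E)%E)
          @ \oo --> 0%E.
Hypothesis Hw_meas : forall n, measurable_fun T
      (fun x : d.-tuple R => vnorm2 (P (tnth x) n *m \col_m Phi x m)).
Implicit Types x : d.-tuple R.
Local Notation phiv x := (\col_m Phi x m).
Local Notation psiN N := (cutoff psi N).

Lemma UpartialE N th n : Upartial a b vf psi N th n = F (psiN N) th n 0.
Proof.
rewrite mxE big_map big_bx /= (bigD1 n) //= [X in _ + X]big1 ?addr0.
  by apply: eq_bigr => k _; rewrite (vf_fracpt Ha_basis Hvf) eqxx mulrC.
move=> m mn; apply: big1 => k _; rewrite (vf_fracpt Ha_basis Hvf).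
by rewrite (inj_eq Hvf_inj) (negbTE mn) mulr0.
Qed.

Lemma Re_fourier_measurable s k :
  measurable_fun T (fun x => complex.Re (F s (tnth x) k 0)) /\
  measurable_fun T (fun x => complex.Im (F s (tnth x) k 0)).
Proof.
have [C C0 CL] := fourier_lipschitz s.
split.
  apply: (@lipschitz_measurable _ _ (fun th => complex.Re (F s th k 0))); exists C => // y z.
  by rewrite -ReN -ReD; apply: le_trans (Re_le_cnorm _) (CL _ _ _).
apply: (@lipschitz_measurable _ _ (fun th => complex.Im (F s th k 0))); exists C => // y z.
by rewrite -ImN -ImD; apply: le_trans (Im_le_cnorm _) (CL _ _ _).
Qed.

Lemma error_measurable s : measurable_fun T (fun x => vnorm2 (F s (tnth x) - phiv x)).
Proof.
apply: measurable_sum => m; have [h1 h2] := HPhi_meas m; have [h3 h4] := Re_fourier_measurable s m.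
have -> : (fun x => cabs2 ((F s (tnth x) - phiv x) m 0)) =
   fun x => (complex.Re (F s (tnth x) m 0) - complex.Re (Phi x m)) ^+ 2 +
            (complex.Im (F s (tnth x) m 0) - complex.Im (Phi x m)) ^+ 2.
  have e0 x : (F s (tnth x) - phiv x) m 0 = F s (tnth x) m 0 - Phi x m by rewrite !mxE.
  apply/funext => x; rewrite e0.
  by rewrite /cabs2 ReD ImD ReN ImN.
by apply: measurable_funD; apply: measurable_funX; exact: measurable_funB.
Qed.

Lemma phi_measurable : measurable_fun T (fun x => vnorm2 (phiv x)).
Proof.
have -> : (fun x => vnorm2 (phiv x)) = fun x => \sum_n vnorm2 (P (tnth x) n *m phiv x).
  by apply/funext => x; exact: (vnorm2_resolution (EPH (tnth x))).
exact: measurable_sum.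
Qed.

(** Convergence to a finite limit in the extended reals forces the integrals to be finite
    eventually; with measurability this is the source of integrability. *)
Lemma error_small e : 0 < e -> \forall N \near \oo,
  lam.-integrable T (EFin \o (fun x => vnorm2 (F (psiN N) (tnth x) - phiv x))) /\
  (\int[lam]_(x in T) vnorm2 (F (psiN N) (tnth x) - phiv x) <= e)%R.
Proof.
move=> e0; have /fine_cvgP[hf /cvgrPdist_le/(_ _ e0) hc] := HPhi.
near=> N.
have EN : (fun x => (\sum_(n < nu) cabs2 (Upartial a b vf psi N (tnth x) n - Phi x n))%:E) =
    (fun x => (vnorm2 (F (psiN N) (tnth x) - phiv x))%:E).
  apply/funext => x; congr (_%:E); apply: eq_bigr => n _.
  by rewrite UpartialE; congr (cabs2 _); rewrite !mxE.
have fN : (\int[lam]_(x in T) (vnorm2 (F (psiN N) (tnth x) - phiv x))%:E)%E \is a fin_num.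
  by rewrite -EN; near: N.
split.
  apply/integrableP; split; first by apply/measurable_EFinP; exact: error_measurable.
  have -> : (fun x => `|(EFin \o (fun x => vnorm2 (F (psiN N) (tnth x) - phiv x))) x|%E) =
      (fun x => (vnorm2 (F (psiN N) (tnth x) - phiv x))%:E).
    by apply/funext => x; rewrite /= ger0_norm // vnorm2_ge0.
  by rewrite ltey_eq fN.
have : `|0 - fine (\int[lam]_(th in T) (\sum_(n < nu) cabs2 (Upartial a b vf psi N (tnth th) n - Phi th n))%:E)%E| <= e.
  by near: N.
by rewrite EN sub0r normrN; apply: le_trans (ler_norm _).
Unshelve. all: by end_near. Qed.

Lemma phi_integrable : lam.-integrable T (EFin \o (fun x => vnorm2 (phiv x))).
Proof.
have [N [iN _]] := filter_ex (error_small ltr01).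
have mT := @measurable_torus R d.
apply: (le_integrable mT (f := EFin \o (fun x => vnorm2 (phiv x)))
  (g := EFin \o (fun x => 2 * vnorm2 (F (psiN N) (tnth x) - phiv x) + 2 * vnorm2 (F (psiN N) (tnth x))))).
- by apply/measurable_EFinP; exact: phi_measurable.
- move=> x _; rewrite /= lee_fin ger0_norm ?vnorm2_ge0 //; apply: le_trans (ler_norm _).
  have := vnorm2_dist (phiv x) (F (psiN N) (tnth x)) ltr01; rewrite invr1.
  have -> : vnorm2 (phiv x - F (psiN N) (tnth x)) = vnorm2 (F (psiN N) (tnth x) - phiv x).
    by rewrite -!vn_sqr -vnN opprB.
  rewrite ler_norml => /andP[_]; lra.
- apply: integrableD_EFin => //; apply: integrableZl_EFin => //.
  by apply: vnorm2_fourier_integrable; exact: onV_cutoff.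
Qed.

Lemma psi_norm N : list_norm (psiN N) <= 1.
Proof.
have Bin := bx_V Ha_basis HV_per Hvf_inj Hvf N.
rewrite (plancherel (@onV_cutoff psi N) Bin); last by move=> v; rewrite supp_cutoff.
apply: le_trans (psi_l2 Hpsi Bin); rewrite big_seq [leRHS]big_seq; apply: ler_sum => v vB.
by rewrite lfun_cutoff vB mulr1.
Qed.

Lemma ssum_dist f f' (m : R) : summable V f -> summable V f' ->
  (forall B, seq_in V B -> \sum_(v <- B) `|f v - f' v| <= m) -> `|ssum V f - ssum V f'| <= m.
Proof.
move=> sf sf' h; have sn := summableZ (-1) sf'.
have -> : ssum V f - ssum V f' = ssum V (fun v => f v + -1 * f' v).
  by rewrite (ssumD sf sn) (ssumZ (-1) sf') mulN1r.
apply: ssum_norm_le => B Bin; apply: le_trans (h B Bin); apply: ler_sum => v _.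
by rewrite mulN1r.
Qed.

Lemma evol_summable s t (f : 'rV[R]_d -> R) (m : R) : onV V s -> 0 <= m -> (forall v, `|f v| <= m) ->
  summable V (fun v => cabs2 (evol adj Q t (lfun s) v) * f v).
Proof.
move=> sV m0 fm; exists (list_norm s * m) => B Bin.
apply: (@le_trans _ _ (\sum_(v <- B) cabs2 (evol adj Q t (lfun s) v) * m)).
  apply: ler_sum => v _; rewrite normrM ger0_norm ?cabs2_ge0 //.
  by apply: ler_wpM2l => //; exact: cabs2_ge0.
by rewrite -mulr_suml ler_wpM2r // evol_l2.
Qed.

Lemma evol_cutoff_dist t N (e : R) B : 0 < e -> seq_in V B ->
  \sum_(v <- B) `|cabs2 (evol adj Q t psi v) - cabs2 (evol adj Q t (lfun (psiN N)) v)|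
    <= (1 + e^-1) * tail psi N + e.
Proof.
move=> e0 Bin.
apply: (@le_trans _ _ ((1 + e^-1) * tail psi N + e * list_norm (psiN N))); last first.
  by rewrite lerD2l -[leRHS]mulr1; apply: (ler_wpM2l (ltW e0)); exact: psi_norm.
apply: (@le_trans _ _ (\sum_(v <- B) ((1 + e^-1) *
    cabs2 (evol adj Q t psi v - evol adj Q t (lfun (psiN N)) v) +
    e * cabs2 (evol adj Q t (lfun (psiN N)) v)))).
  by apply: ler_sum => v _; exact: cabs2_dist.
rewrite big_split -!mulr_sumr /=; apply: lerD; apply: ler_wpM2l.
- by rewrite addr_ge0 // invr_ge0 ltW.
- exact: evol_cutoff_l2.
- exact: ltW.
- by apply: evol_l2 => //; exact: onV_cutoff.
Qed.

Lemma evol_psi_summable t (f : 'rV[R]_d -> R) (m : R) : 0 <= m -> (forall v, `|f v| <= m) ->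
  summable V (fun v => cabs2 (evol adj Q t psi v) * f v).
Proof.
move=> m0 fm; exists ((list_norm (psiN 0) + ((1 + 1^-1) * tail psi 0 + 1)) * m) => B Bin.
apply: (@le_trans _ _ (\sum_(v <- B) cabs2 (evol adj Q t psi v) * m)).
  apply: ler_sum => v _; rewrite normrM ger0_norm ?cabs2_ge0 //.
  by apply: ler_wpM2l => //; exact: cabs2_ge0.
rewrite -mulr_suml ler_wpM2r //.
apply: le_trans (lerD (evol_l2 t (@onV_cutoff psi 0) Bin) (evol_cutoff_dist t 0 ltr01 Bin)).
rewrite -big_split /=; apply: ler_sum => v _.
by rewrite -lerBlDl; exact: ler_norm.
Qed.

Lemma ssum_cutoff_dist t N (e m : R) (f : 'rV[R]_d -> R) : 0 < e -> 0 <= m -> (forall v, `|f v| <= m) ->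
  `|ssum V (fun v => cabs2 (evol adj Q t psi v) * f v) -
    ssum V (fun v => cabs2 (evol adj Q t (lfun (psiN N)) v) * f v)|
  <= ((1 + e^-1) * tail psi N + e) * m.
Proof.
move=> e0 m0 fm; apply: ssum_dist.
- exact: (evol_psi_summable t m0 fm).
- by apply: evol_summable fm => //; exact: onV_cutoff.
move=> B Bin; apply: le_trans (ler_wpM2r m0 (evol_cutoff_dist t N e0 Bin)).
rewrite mulr_suml; apply: ler_sum => v _; rewrite -mulrBl normrM.
by apply: ler_wpM2l.
Qed.

Lemma ssum_approx t s (L m e1 e3 : R) (f f' : 'rV[R]_d -> R) : onV V s -> 0 <= m -> 0 <= e1 ->
  (forall v, `|f v| <= m) -> (forall v, `|f' v| <= m) ->
  (forall v, (forall i, `|cd a v i| <= L) -> `|f v - f' v| <= e1) ->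
  (forall B, seq_in V B ->
    \sum_(v <- B | ~~ [forall i, `|cd a v i| <= L]) cabs2 (evol adj Q t (lfun s) v) <= e3) ->
  `|ssum V (fun v => cabs2 (evol adj Q t (lfun s) v) * f v) -
    ssum V (fun v => cabs2 (evol adj Q t (lfun s) v) * f' v)| <= e1 * list_norm s + 2 * m * e3.
Proof.
move=> sV m0 e10 fm f'm ff' tl; apply: ssum_dist.
- exact: evol_summable fm.
- exact: evol_summable f'm.
move=> B Bin; set p := fun v => cabs2 (evol adj Q t (lfun s) v).
have p0 v : 0 <= p v by exact: cabs2_ge0.
apply: (@le_trans _ _ (\sum_(v <- B) (e1 * p v + 2 * m * (if ~~ [forall i, `|cd a v i| <= L] then p v else 0)))).
  apply: ler_sum => v _; rewrite -mulrBr normrM (ger0_norm (p0 v)).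
  case: ifPn => [_|/negPn/forallP h].
    have h : `|f v - f' v| <= 2 * m.
      by apply: le_trans (ler_normB _ _) _; have := fm v; have := f'm v; lra.
    have := ler_wpM2l (p0 v) h; have := mulr_ge0 e10 (p0 v); rewrite -/(p v); lra.
  by rewrite mulr0 addr0 mulrC; apply: ler_wpM2r => //; exact: ff'.
rewrite big_split -!mulr_sumr -big_mkcond /=; apply: lerD; apply: ler_wpM2l => //.
- exact: evol_l2.
- by rewrite mulr_ge0.
- exact: tl.
Qed.

Lemma netlim_big (I : Type) (r : seq I) (f : I -> 'rV[R]_d -> R) (l : I -> R) :
  (forall i, netlim V (f i) (l i)) ->
  netlim V (fun v => \sum_(i <- r) f i v) (\sum_(i <- r) l i).
Proof.
move=> fl; elim: r => [|i r IH].
  move=> e e0; exists [::]; first exact: seq_in_nil.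
  move=> B _ _; rewrite big1 ?big_nil ?subrr ?normr0 ?ltW // => v _; exact: big_nil.
rewrite big_cons; have -> : (fun v => \sum_(j <- i :: r) f j v) =
    fun v => f i v + \sum_(j <- r) f j v by apply/funext => v; rewrite big_cons.
exact: netlimD.
Qed.

Lemma ssum_trig t s (tr : seq (R * ('I_d -> R) * R)) (KT : R) : onV V s -> 0 <= KT ->
  (forall y, `|trig_eval tr y| <= KT) ->
  ssum V (fun v => cabs2 (evol adj Q t (lfun s) v) * trig_eval tr (cd a (t^-1 *: v))) =
  \sum_(p <- tr) p.1.1 * (\int[lam]_(x in T)
     symbol_corr t s (fun i => t^-1 * (p.1.2 i / (2 * pi))) p.2 (tnth x))%R.
Proof.
move=> sV KT0 rK; apply: ssum_eq_netlim; first by apply: evol_summable KT0 _ => // v; exact: rK.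
have -> : (fun v => cabs2 (evol adj Q t (lfun s) v) * trig_eval tr (cd a (t^-1 *: v))) =
    fun v => \sum_(p <- tr) p.1.1 * (cos (2 * pi * lin (fun i => t^-1 * (p.1.2 i / (2 * pi))) (cd a v) + p.2)
      * cabs2 (evol adj Q t (lfun s) v)).
  apply/funext => v; rewrite mulr_sumr; apply: eq_bigr => p _.
  rewrite mulrCA [cabs2 _ * _]mulrC; congr (_ * (cos (_ + _) * _)).
  rewrite /lin mulr_sumr; apply: eq_bigr => i _; rewrite cdZ.
  have pi0 : 2 * pi != 0 :> R by rewrite gt_eqF // mulr_gt0 ?pi_gt0.
  have e0 : 2 * pi * (p.1.2 i / (2 * pi)) = p.1.2 i by rewrite mulrCA divff ?mulr1.
  by rewrite -[in LHS]e0; move: (p.1.2 i / _) (t^-1) => q t'; ring.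
by apply: netlim_big => p; apply: netlimZ; exact: evol_characteristic.
Qed.

Lemma vel_corr_integrable s (eta : 'I_d -> R) c (Z : set (d.-tuple R)) : onV V s ->
  measurable Z -> lam Z = 0%E -> (forall x, T x -> ~ Z x -> regular (tnth x)) ->
  lam.-integrable (T `\` Z) (EFin \o (fun x => vel_corr s eta c (tnth x))).
Proof.
move=> sV mZ Z0 reg; have mT := @measurable_torus R d.
apply: (@bounded_integrable _ _ _ Hlam _ _ ((nu%:R * \sum_(p <- s) cnorm p.2) ^+ 2)).
- exact: measurableD.
- exact: subDsetl.
- by have [] := vel_corr_limit eta c sV mZ Z0 reg invS_pinfty.
move=> x _; apply: (@le_trans _ _ (vnorm2 (F s (tnth x)))).
  rewrite (vnorm2_resolution (EPH (tnth x))); apply: le_trans (ler_norm_sum _ _ _) _.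
  apply: ler_sum => n _; rewrite normrM [X in _ * X]ger0_norm ?vnorm2_ge0 //.
  rewrite -[leRHS]mul1r; apply: ler_wpM2r; first exact: vnorm2_ge0.
  by rewrite ler_norml cos_geN1 cos_le1.
rewrite -vn_sqr; apply: lerXn2r; rewrite ?nnegrE ?vn_ge0 //.
  by rewrite mulr_ge0 // sumr_ge0 // => p _; exact: cnorm_ge0.
exact: vn_fourier_le.
Qed.

Definition trig_law s (tr : seq (R * ('I_d -> R) * R)) x : R :=
  \sum_n trig_eval tr (vel (tnth x) n) * vnorm2 (P (tnth x) n *m F s (tnth x)).

Lemma trig_lawE s (tr : seq (R * ('I_d -> R) * R)) x : trig_law s tr x = \sum_(p <- tr) p.1.1 * vel_corr s p.1.2 p.2 (tnth x).
Proof.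
rewrite /trig_law; under eq_bigr do rewrite mulr_suml.
rewrite exchange_big; apply: eq_bigr => p _; rewrite mulr_sumr.
by apply: eq_bigr => n _; rewrite mulrA.
Qed.

Lemma trig_law_integrable s (tr : seq (R * ('I_d -> R) * R)) (Z : set (d.-tuple R)) : onV V s ->
  measurable Z -> lam Z = 0%E -> (forall x, T x -> ~ Z x -> regular (tnth x)) ->
  lam.-integrable (T `\` Z) (EFin \o trig_law s tr).
Proof.
move=> sV mZ Z0 reg; have mT := @measurable_torus R d.
have mG : measurable (T `\` Z) by exact: measurableD.
rewrite (funext (trig_lawE s tr)); apply: integrable_sum_EFin => // p.
by apply: integrableZl_EFin => //; exact: vel_corr_integrable.
Qed.

Lemma ssum_trig_cvg s (tr : seq (R * ('I_d -> R) * R)) (KT : R) (t_ : nat -> R) (Z : set (d.-tuple R)) : onV V s -> 0 <= KT ->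
  (forall y, `|trig_eval tr y| <= KT) ->
  measurable Z -> lam Z = 0%E -> (forall x, T x -> ~ Z x -> regular (tnth x)) ->
  t_ j @[j --> \oo] --> +oo ->
  ssum V (fun v => cabs2 (evol adj Q (t_ j) (lfun s) v) * trig_eval tr (cd a ((t_ j)^-1 *: v)))
    @[j --> \oo] --> (\int[lam]_(x in T `\` Z) trig_law s tr x)%R.
Proof.
move=> sV KT0 rK mZ Z0 reg tinf; have mT := @measurable_torus R d.
have mG : measurable (T `\` Z) by exact: measurableD.
have iv (p : R * ('I_d -> R) * R) := vel_corr_integrable p.1.2 p.2 sV mZ Z0 reg.
have -> : (\int[lam]_(x in T `\` Z) trig_law s tr x)%R =
    \sum_(p <- tr) p.1.1 * (\int[lam]_(x in T `\` Z) vel_corr s p.1.2 p.2 (tnth x))%R.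
  rewrite (funext (trig_lawE s tr)) Rintegral_sum // => [|p]; last exact: integrableZl_EFin.
  by apply: eq_bigr => p _; rewrite RintegralZl.
under eq_fun do rewrite (ssum_trig _ sV KT0 rK).
apply: cvg_big_seq => p _; apply: cvgM; first exact: cvg_cst.
by have [] := vel_corr_limit p.1.2 p.2 sV mZ Z0 reg tinf.
Qed.

Definition limit_law (g : 'rV[R]_d -> R) x : R :=
  \sum_n g (\sum_i vel (tnth x) n i *: a i) * vnorm2 (P (tnth x) n *m phiv x).

Lemma limit_law_integrable (g : 'rV[R]_d -> R) (m : R) (Z : set (d.-tuple R)) :
  continuous g -> 0 <= m -> (forall y, `|g y| <= m) ->
  measurable Z -> (forall x, T x -> ~ Z x -> regular (tnth x)) ->
  lam.-integrable (T `\` Z) (EFin \o limit_law g).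
Proof.
move=> cg m0 gm mZ reg; have mT := @measurable_torus R d.
have mG : measurable (T `\` Z) by exact: measurableD.
have GT : T `\` Z `<=` T by exact: subDsetl.
apply: (le_integrable mG (g := EFin \o (fun x => m * vnorm2 (phiv x)))).
- apply/measurable_EFinP; apply: measurable_sum => n; apply: measurable_funM.
    exact: vel_measurable.
  exact: measurable_funS (Hw_meas n).
- move=> x _; rewrite /= lee_fin [leRHS]ger0_norm ?mulr_ge0 ?vnorm2_ge0 //.
  rewrite (vnorm2_resolution (EPH (tnth x))) mulr_sumr.
  apply: le_trans (ler_norm_sum _ _ _) _; apply: ler_sum => n _.
  by rewrite normrM [X in _ * X]ger0_norm ?vnorm2_ge0 // ler_wpM2r ?vnorm2_ge0.
- apply: integrableZl_EFin => //; exact: (integrableS mT mG GT phi_integrable).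
Qed.

Lemma Rintegral_null (f : d.-tuple R -> R) (Z : set (d.-tuple R)) : measurable Z -> lam Z = 0%E ->
  (\int[lam]_(x in T) f x = \int[lam]_(x in T `\` Z) f x)%R.
Proof. by move=> mZ Z0; rewrite /Rintegral (integral_null _ _ mZ Z0). Qed.

(** Replacing the truncated state by [phiv] costs the [KT] term, through [vnorm2_dist]. Replacing
    the trigonometric polynomial by [g] costs [e1], since at regular points the velocities lie in
    the box of approximation. *)
Lemma law_dist (g : 'rV[R]_d -> R) (m e e1 KT L : R) (tr : seq (R * ('I_d -> R) * R)) N (Z : set (d.-tuple R)) :
  continuous g -> 0 <= m -> (forall y, `|g y| <= m) -> 0 < e -> 0 <= e1 -> 0 <= KT ->
  (forall y, `|trig_eval tr y| <= KT) ->
  (forall y : 'I_d -> R, (forall i, `|y i| <= L) -> `|g (\sum_i y i *: a i) - trig_eval tr y| <= e1) ->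
  (forall th n i, regular th -> `|vel th n i| <= L) ->
  measurable Z -> lam Z = 0%E -> (forall x, T x -> ~ Z x -> regular (tnth x)) ->
  lam.-integrable T (EFin \o (fun x => vnorm2 (F (psiN N) (tnth x) - phiv x))) ->
  `|\int[lam]_(x in T `\` Z) trig_law (psiN N) tr x - \int[lam]_(x in T `\` Z) limit_law g x|%R <=
    KT * ((1 + e^-1) * (\int[lam]_(x in T) vnorm2 (F (psiN N) (tnth x) - phiv x))%R + e)
    + e1 * (\int[lam]_(x in T) vnorm2 (phiv x))%R.
Proof.
move=> cg m0 gm e0 e10 KT0 rK gr velL mZ Z0 reg ierr; have mT := @measurable_torus R d.
have mG : measurable (T `\` Z) by exact: measurableD.
have GT : T `\` Z `<=` T by exact: subDsetl.
have sV : onV V (psiN N) by exact: onV_cutoff.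
have i1 := trig_law_integrable tr sV mZ Z0 reg.
have i2 := limit_law_integrable cg m0 gm mZ reg.
pose err x := vnorm2 (F (psiN N) (tnth x) - phiv x).
have ie : lam.-integrable (T `\` Z) (EFin \o err) by exact: (integrableS mT mG GT ierr).
have iu : lam.-integrable (T `\` Z) (EFin \o (fun x => vnorm2 (F (psiN N) (tnth x)))).
  exact: (integrableS mT mG GT (vnorm2_fourier_integrable sV)).
have ip : lam.-integrable (T `\` Z) (EFin \o (fun x => vnorm2 (phiv x))).
  exact: (integrableS mT mG GT phi_integrable).
have e10' : 0 <= 1 + e^-1 by rewrite addr_ge0 // invr_ge0 ltW.
have iq1 := integrableZl_EFin (1 + e^-1) mG ie.
have iq2 := integrableZl_EFin e mG iu.
have iq := integrableD_EFin mG iq1 iq2.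
have iqK := integrableZl_EFin KT mG iq.
have iqp := integrableZl_EFin e1 mG ip.
have ibd := integrableD_EFin mG iqK iqp.
rewrite -RintegralB //; have i12 := integrableB_EFin mG i1 i2.
apply: le_trans (le_normr_Rintegral mG i12) _.
apply: (@le_trans _ _ (\int[lam]_(x in T `\` Z) (KT * ((1 + e^-1) * err x +
    e * vnorm2 (F (psiN N) (tnth x))) + e1 * vnorm2 (phiv x)))%R).
  apply: le_Rintegral => //; first exact: (integrable_abse i12).
  move=> x [Tx Zx]; have regx := reg x Tx Zx; rewrite -sumrB.
  apply: le_trans (ler_norm_sum _ _ _) _; rewrite /err.
  rewrite !(vnorm2_resolution (EPH (tnth x))) !mulr_sumr -big_split mulr_sumr -big_split.
  apply: ler_sum => n _ /=; rewrite mulmxBr.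
  set u := P _ n *m F _ _; set p := P _ n *m phiv x.
  set tv := trig_eval tr _; set gv := g _.
  have -> : tv * vnorm2 u - gv * vnorm2 p = tv * (vnorm2 u - vnorm2 p) + (tv - gv) * vnorm2 p by ring.
  apply: le_trans (ler_normD _ _) _; rewrite !normrM; apply: lerD; last first.
    rewrite (ger0_norm (vnorm2_ge0 p)); apply: ler_wpM2r; first exact: vnorm2_ge0.
    by rewrite distrC; apply: gr => i; exact: velL.
  apply: ler_pM => //; first exact: rK.
  rewrite distrC; have -> : u - p = - (p - u) by rewrite opprB.
  by rewrite -[vnorm2 (- _)]vn_sqr vnN vn_sqr; exact: vnorm2_dist.
rewrite RintegralD // RintegralZl // RintegralD // !RintegralZl //.
rewrite -!(Rintegral_null _ mZ Z0) lerD2r; apply: ler_wpM2l => //.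
by rewrite lerD2l -[leRHS]mulr1; apply: (ler_wpM2l (ltW e0)); exact: psi_norm.
Qed.

(** Read with [x1] the law of [psi] tested on [g], [x2] the truncated state, [x3] the trigonometric
    test function, [x] the limit of [x3] and [y] the limit law. *)
Lemma dist_chain (x y x1 x2 x3 : R) :
  `|y - x1| <= `|x - y| + `|x - x3| + `|x2 - x3| + `|x1 - x2|.
Proof.
have -> : y - x1 = - (x - y) + (x - x3) - (x2 - x3) - (x1 - x2) by ring.
apply: le_trans (ler_normB _ _) _; rewrite lerD2r.
apply: le_trans (ler_normB _ _) _; rewrite lerD2r.
by apply: le_trans (ler_normD _ _) _; rewrite normrN.
Qed.

Lemma convergence_in_law (g : 'rV[R]_d -> R) (m : R) : continuous g -> (forall y, `|g y| <= m) ->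
  ssum V (fun v => cabs2 (evol adj Q t psi v) * g (t^-1 *: v)) @[t --> +oo] -->
  fine (\int[lam]_(x in T) (limit_law g x)%:E)%E.
Proof.
move=> cg gm; have m0 : 0 <= m := le_trans (normr_ge0 _) (gm 0).
have [Z [mZ Z0 reg]] := regular_ae.
rewrite -[fine _]/(\int[lam]_(x in T) limit_law g x)%R (Rintegral_null _ mZ Z0).
(* Dominated convergence concerns sequences, so [t] is replaced by an arbitrary sequence tending to
   infinity. *)
set J := (X in _ --> X); apply/cvg_pinftyP => t_ tinf; apply/cvgrPdist_le => e e0.
have [Lv Lv0 velL] := vel_bounded; have [L0 L00 tailP] := evol_tail.
(* One box must contain both the bulk of [X_t / t] and all velocities, because the approximation of
   [g] holds only there. *)
pose L := L0 + Lv; have Lp : 0 < L by rewrite ltr_wpDr.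
pose C := (\int[lam]_(x in T) vnorm2 (phiv x))%R.
have C0 : 0 <= C by apply: Rintegral_ge0 => x _; exact: vnorm2_ge0.
(* [e1] is paid [C] times in the limit law, once for the limit in time and at most once for the
   truncated state: [e / 4] in all. *)
pose e1 := e / (4 * (C + 2)); have e10 : 0 < e1 by rewrite divr_gt0 // mulr_gt0 //; lra.
have e1E : e1 * (C + 2) = e / 4 by rewrite /e1; field; rewrite gt_eqF //; lra.
have [tf [tr trE] gtf] := trig_approximation a cg gm Lp e10.
have gtr y : (forall i, `|y i| <= L) -> `|g (\sum_i y i *: a i) - trig_eval tr y| <= e1.
  by move=> yL; rewrite -trE; exact: gtf.
have [KT KT0 rK] := trigpoly_bounded (ex_intro _ tr (fun y => erefl (trig_eval tr y))).
pose B := m + KT; have B0 : 0 <= B by rewrite addr_ge0.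
(* [e2] is paid [2 * m] times for truncation, [2 * KT] times in the limit law and [2 * B] times for
   the tail, so [4 * B] times: at most [e / 4]. *)
pose e2 := e / (16 * (B + 1)); have e20 : 0 < e2 by rewrite divr_gt0 // mulr_gt0 //; lra.
have e2E : e2 * (B + 1) = e / 16 by rewrite /e2; field; rewrite gt_eqF //; lra.
have c0 : 0 < 1 + e2^-1 by rewrite ltr_wpDr ?invr_ge0 ?ltW.
have e2c : 0 < e2 / (1 + e2^-1) by rewrite divr_gt0.
have : \forall N \near \oo, tail psi N <= e2 / (1 + e2^-1) /\
    (lam.-integrable T (EFin \o (fun x => vnorm2 (F (psiN N) (tnth x) - phiv x))) /\
    (\int[lam]_(x in T) vnorm2 (F (psiN N) (tnth x) - phiv x) <= e2 / (1 + e2^-1))%R).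
  near=> N; split; last by near: N; exact: error_small.
  near: N; have /cvgrPdist_le/(_ _ e2c) := tail_cvg0 Hpsi.
  by apply: filterS => N; rewrite sub0r normrN; apply: le_trans (ler_norm _).
move=> /filter_ex[N [tailN [iN errN]]].
have sV : onV V (psiN N) by exact: onV_cutoff.
have tailN' : (1 + e2^-1) * tail psi N <= e2 by rewrite mulrC -ler_pdivlMr.
have errN' : (1 + e2^-1) * (\int[lam]_(x in T) vnorm2 (F (psiN N) (tnth x) - phiv x))%R <= e2.
  by rewrite mulrC -ler_pdivlMr.
have [t0 t00 t0P] := tailP _ sV _ e20.
pose I := (\int[lam]_(x in T `\` Z) trig_law (psiN N) tr x)%R.
have IJ : `|I - J| <= KT * (e2 + e2) + e1 * C.
  have := law_dist cg m0 gm e20 (ltW e10) KT0 rK gtr _ mZ Z0 reg iN.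
  move=> H; apply: le_trans (H _) _.
    by move=> th n i rg; apply: le_trans (velL _ _ _ rg) _; rewrite /L lerDr ltW.
  by rewrite lerD2r; apply: ler_wpM2l => //; rewrite lerD2r.
have /cvgrPdist_le/(_ _ e10) cvI := ssum_trig_cvg sV KT0 rK mZ Z0 reg tinf.
have tge : \forall j \near \oo, t0 <= t_ j by move/cvgryPge: tinf; exact.
near=> j; have tj : t0 <= t_ j by near: j.
have tj0 : 0 < t_ j by apply: lt_le_trans tj.
have hI : `|I - ssum V (fun v => cabs2 (evol adj Q (t_ j) (lfun (psiN N)) v) *
    trig_eval tr (cd a ((t_ j)^-1 *: v)))| <= e1 by near: j.
have h1 := @ssum_cutoff_dist (t_ j) N e2 m (fun v => g ((t_ j)^-1 *: v)) e20 m0 (fun v => gm _).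
have h2 : `|ssum V (fun v => cabs2 (evol adj Q (t_ j) (lfun (psiN N)) v) * g ((t_ j)^-1 *: v)) -
    ssum V (fun v => cabs2 (evol adj Q (t_ j) (lfun (psiN N)) v) *
      trig_eval tr (cd a ((t_ j)^-1 *: v)))| <= e1 * list_norm (psiN N) + 2 * B * e2.
  apply: (@ssum_approx _ _ (L * t_ j)) => //.
  - exact: ltW.
  - by move=> v; apply: le_trans (gm _) _; rewrite lerDl.
  - by move=> v; apply: le_trans (rK _) _; rewrite lerDr.
  - move=> v vL; rewrite -{1}[_ *: v](cdK Ha_basis); apply: gtr => i.
    by rewrite cdZ normrM gtr0_norm ?invr_gt0 // ler_pdivrMl // mulrC.
  move=> B' Bin; apply: le_trans (t0P (t_ j) B' tj Bin).
  rewrite big_mkcond [leRHS]big_mkcond; apply: ler_sum => v _.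
  case: ifPn => [/forallPn[k kL]|_]; last by case: ifP => // _; exact: cabs2_ge0.
  rewrite ifT //; apply/forallPn; exists k; move: kL; rewrite -!ltNge; apply: le_lt_trans.
  by apply: ler_wpM2r; [exact: ltW|rewrite /L lerDl].
have h3 : e1 * list_norm (psiN N) <= e1.
  by rewrite -[leRHS]mulr1; apply: (ler_wpM2l (ltW e10)); exact: psi_norm.
have h4 : ((1 + e2^-1) * tail psi N + e2) * m <= (e2 + e2) * m.
  by apply: ler_wpM2r => //; rewrite lerD2r.
move: h1 h2 hI IJ h3 h4; set A1 := ssum _ _; set A2 := ssum _ _; set A3 := ssum _ _.
set ln := list_norm _; set tl := (_ * tail _ _); move=> h1 h2 hI IJ h3 h4.
have e2B : 4 * (e2 * B) <= e / 4 by move: e2E e20; lra.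
have eB : e2 * B = e2 * m + e2 * KT by rewrite -mulrDr.
have key := dist_chain I J A1 A2 A3.
apply: le_trans key _; move: h1 h2 hI IJ h3 h4 e1E e2B eB.
move: (`|I - J|) (`|I - A3|) (`|A2 - A3|) (`|A1 - A2|) => x1 x2 x3 x4.
move: (tl) => tl0 h1 h2 hI IJ h3 h4 e1E e2B eB; clear -h1 h2 hI IJ h3 h4 e1E e2B eB e0 e10.
lra.
Unshelve. all: by end_near. Qed.
End Convergence.

End Propagation.

Theorem theorem5p4 (R : realType) (d : nat)
  (* basis a_1..a_d of R^d and its dual basis b_1..b_d *)
  (a b : 'I_d -> 'rV[R]_d)
  (Ha_basis : basis_mx a \in unitmx)
  (Hdual : forall i j : 'I_d, dotp (a i) (b j) = 2 * pi * (i == j)%:R)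
  (* locally finite infinite simple graph Gamma = (V, E), V in R^d *)
  (V : set 'rV[R]_d) (adj : 'rV[R]_d -> 'rV[R]_d -> Prop)
  (Hadj_V : forall u v, adj u v -> V u /\ V v)
  (Hadj_sym : forall u v, adj u v -> adj v u)
  (Hadj_irr : forall v, ~ adj v v)
  (Hlocfin : forall v, V v -> finite_set [set u | adj v u])
  (Hinf : infinite_set V)
  (* invariance under the translations by each a_i *)
  (HV_per : forall i v, V (v + a i) <-> V v)
  (Hadj_per : forall i u v, adj (u + a i) (v + a i) <-> adj u v)
  (* real periodic potential *)
  (Q : 'rV[R]_d -> R) (HQ_per : forall i v, V v -> Q (v + a i) = Q v)
  (* V_f = V cap C_a = {v_1, ..., v_nu} *)
  (nu : nat) (vf : 'I_nu -> 'rV[R]_d) (Hvf_inj : injective vf)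
  (Hvf : forall v, (V `&` cellA a) v <-> exists n, vf n = v)
  (* eigen-decomposition H(x) = sum_n E_n(x) P_n(x), x = theta_b,
     eigenvalues increasing, counted with multiplicity *)
  (E : 'rV[R]_d -> 'I_nu -> R) (P : 'rV[R]_d -> 'I_nu -> 'M[R[i]]_nu)
  (HP_herm : forall x n, map_mx Num.conj (P x n)^T = P x n)
  (HP_orth : forall x n m, P x n *m P x m = if n == m then P x n else 0)
  (HP_sum : forall x, \sum_(n < nu) P x n = 1%:M)
  (HP_rank : forall x n, \rank (P x n) = 1%N)
  (HH_dec : forall x, bloch_mx a adj Q vf x = \sum_(n < nu) (E x n)%:C%C *: P x n)
  (HE_incr : forall x (n m : 'I_nu), (n <= m)%N -> E x n <= E x m)
  (* psi in l^2(Gamma), ||psi|| = 1 *)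
  (psi : 'rV[R]_d -> R[i])
  (Hpsi : (\esum_(v in V) (cabs2 (psi v))%:E = 1)%E)
  (* Lebesgue measure on R^d *)
  (lam : {measure set (d.-tuple R) -> \bar R})
  (Hlam : is_lebesgue_measure lam)
  (* Phi = U psi in L^2(T^d_*; C^nu): L^2-limit of the partial Fourier sums *)
  (Phi : d.-tuple R -> 'I_nu -> R[i])
  (HPhi_meas : forall n, measurable_fun (@torus R d) (fun th => complex.Re (Phi th n))
                      /\ measurable_fun (@torus R d) (fun th => complex.Im (Phi th n)))
  (HPhi : (fun N : nat => (\int[lam]_(th in @torus R d)
             (\sum_(n < nu) cabs2 (Upartial a b vf psi N (tnth th) n - Phi th n))%:E)%E)
          @ \oo --> 0%E)
  (* the density of mu^psi is measurable *)
  (Hw_meas : forall n, measurable_fun (@torus R d)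
      (fun th => vnorm2 (P (thb b (tnth th)) n *m \col_m Phi th m))) :
  (* X_t / t converges in distribution to Y ~ nu_infty^psi = h_* mu^psi *)
  forall g : 'rV[R]_d -> R, continuous g -> (exists M, forall x, `|g x| <= M) ->
    (ssum V (fun v => cabs2 (evol adj Q t psi v) * g (t^-1 *: v)))
      @[t --> +oo] -->
    fine (\int[lam]_(th in @torus R d)
            (\sum_(n < nu) g (hmap a b (fun x => E x n) (tnth th))
               * vnorm2 (P (thb b (tnth th)) n *m \col_m Phi th m))%:E)%E.
Proof.
move=> g cg [m gm].
(* Pulling the bands back along [thb] makes the derivatives in [gradE] literally those of
   [pderiv_b]. *)
pose Eb (th : 'I_d -> R) n := E (thb b th) n; pose Pb (th : 'I_d -> R) n := P (thb b th) n.
have EPH th : spectral (Eb th) (Pb th) (bloch_mx a adj Q vf (thb b th)).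
  by split; [exact: HP_herm|exact: HP_orth|exact: HP_sum|exact: HP_rank|exact: HH_dec].
have Einc th (n k : 'I_nu) : (n <= k)%N -> Eb th n <= Eb th k by exact: HE_incr.
have := convergence_in_law Ha_basis Hdual Hadj_V Hadj_sym Hlocfin HV_per Hadj_per HQ_per
  Hvf_inj Hvf Hlam EPH Einc Hpsi HPhi_meas HPhi Hw_meas cg gm.
congr (_ --> fine _); apply: eq_integral => x _; congr (_%:E); apply: eq_bigr => n _.
congr (g _ * _); rewrite /hmap scaler_sumr; apply: eq_bigr => i _.
by rewrite scalerA.
Qed.
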